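(* Let $y=y(x)$ be the cosine law function. (1) All closed 1-forms of the form $w=\sum_{i=1}^3 f(y_i)\,dg(x_i)$, where $f,g$ are two non-constant smooth functions, are, up to scaling and complex conjugation, $$\omega_\lambda=\sum_{i=1}^3\int^{y_i}\sin^\lambda(t)\,dt\; d\Big(\int^{x_i}\sin^{-\lambda-1}(t)\,dt\Big)=\sum_{i=1}^3\frac{\int^{y_i}\sin^\lambda(t)\,dt}{\sin^{\lambda+1}(x_i)}\,dx_i$$ for some $\lambda\in\mathbb C$ (and each $\omega_\lambda$ is closed). In particular, all such closed 1-forms are holomorphic or anti-holomorphic. (2) Let $r_i=\frac12(x_j+x_k-x_i)$ for $\{i,j,k\}=\{1,2,3\}$, so that $x_i=r_j+r_k$. All closed 1-forms of the form $\sum_{i=1}^3 f(y_i)\,dg(r_i)$, where $f,g$ are two non-constant smooth functions, are, up to scaling and complex conjugation, $$\eta_\lambda=\sum_{i=1}^3\int^{y_i}\tan^\lambda(t/2)\,dt\; d\Big(\int^{r_i}\cos^{-\lambda-1}(t)\,dt\Big)=\sum_{i=1}^3\frac{\int^{y_i}\tan^\lambda(t/2)\,dt}{\cos^{\lambda+1}(r_i)}\,dr_i$$ for some $\lambda\in\mathbb C$ (and each $\eta_\lambda$ is closed). In particular, all such closed 1-forms are holomorphic or anti-holomorphic.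
   Context: The cosine law function is a function $y=(y_1,y_2,y_3)\in\mathbb C^3$ of $x=(x_1,x_2,x_3)$ in an open connected set of $\mathbb C^3$, satisfying $$\cos(y_i)=\frac{\cos x_i+\cos x_j\cos x_k}{\sin(x_j)\sin(x_k)},\qquad \{i,j,k\}=\{1,2,3\},$$ a holomorphic solution whose domain contains a point $(a,a,a)$ with $y(a,a,a)=(b,b,b)$, so that $\sin y_i\sin x_j\sin x_k$ (assumed nonzero) is independent of the indices. Here $f,g$ are complex-valued functions of one complex variable, smooth in the real sense. The symbol $\int^{z}h(t)\,dt$ denotes an antiderivative of $h$ (defined up to an additive constant), with the same antiderivative and the same branch of the power functions used for $i=1,2,3$.
   Formalization: ''Non-constant'' is required at corresponding values: for some point x of the domain and some i, f is not locally constant at y_i and g is not locally constant at x_i (resp. r_i); otherwise bump functions with unrelated supports give closed forms that are not of the stated kind. *)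

(* Defs.v *)
From Stdlib Require Import Reals.
From Coquelicot Require Import Coquelicot.

Open Scope C_scope.

(** * Complex elementary functions *)

Definition Cexp (z : C) : C :=
  (exp (Re z) * cos (Im z), exp (Re z) * sin (Im z))%R.
Definition Ccos (z : C) : C := (Cexp (Ci * z) + Cexp (- (Ci * z))) / 2.
Definition Csin (z : C) : C := (Cexp (Ci * z) - Cexp (- (Ci * z))) / (2 * Ci).
Definition Ctan (z : C) : C := Csin z / Ccos z.

(** * The space C^3 *)

Definition C3 : Type := (C * C * C)%type.

(* C^3 is used both as a complex space (holomorphy) and as a real space
   (smoothness, closedness); the two structures have the same topology. *)
Definition C3_C : NormedModule C_AbsRing :=
  prod_NormedModule C_AbsRing
    (prod_NormedModule C_AbsRing C_NormedModule C_NormedModule) C_NormedModule.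
Definition C3_R : NormedModule R_AbsRing :=
  prod_NormedModule R_AbsRing
    (prod_NormedModule R_AbsRing C_R_NormedModule C_R_NormedModule)
    C_R_NormedModule.

Inductive index3 : Set := I1 | I2 | I3.

Definition coord (i : index3) (p : C3) : C :=
  match i with
  | I1 => fst (fst p)
  | I2 => snd (fst p)
  | I3 => snd p
  end.

Definition sum3 (F : index3 -> C) : C := F I1 + F I2 + F I3.

(* {i, j, k} = {1, 2, 3} *)
Definition distinct3 (i j k : index3) : Prop := i <> j /\ j <> k /\ i <> k.

(* [radius i x] is (x_j + x_k - x_i) / 2. *)
Definition radius (i : index3) (p : C3) : C :=
  (sum3 (fun j => coord j p) - 2 * coord i p) / 2.

Definition openC (U : C -> Prop) : Prop := @open C_UniformSpace U.
Definition openC3 (Omega : C3 -> Prop) : Prop := @open C3_R Omega.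

(* Connectedness of an open set: no partition into two non-empty open sets. *)
Definition connected_open (Omega : C3 -> Prop) : Prop :=
  forall A B : C3 -> Prop,
    openC3 A -> openC3 B ->
    (forall p, Omega p -> A p \/ B p) ->
    (forall p, Omega p -> ~ (A p /\ B p)) ->
    (forall p, Omega p -> A p) \/ (forall p, Omega p -> B p).

(** * The cosine law function *)

Definition holomorphic_fun (Omega : C3 -> Prop) (P : C3 -> C) : Prop :=
  forall p, Omega p ->
    @ex_filterdiff C_AbsRing C3_C C_NormedModule P (@locally C3_C p).

Record cosine_law_function (Omega : C3 -> Prop) (y : C3 -> C3) : Prop := {
  clf_open : openC3 Omega;
  clf_connected : connected_open Omega;
  clf_holomorphic :
    forall i, holomorphic_fun Omega (fun x => coord i (y x));
  clf_nonzero : forall x i j k, Omega x -> distinct3 i j k ->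
    Csin (coord i (y x)) * Csin (coord j x) * Csin (coord k x) <> 0;
  clf_law : forall x i j k, Omega x -> distinct3 i j k ->
    Ccos (coord i (y x)) =
      (Ccos (coord i x) + Ccos (coord j x) * Ccos (coord k x))
        / (Csin (coord j x) * Csin (coord k x));
  clf_base : exists a b : C, Omega (a, a, a) /\ y (a, a, a) = (b, b, b)
}.

(** * Real differential calculus *)

(* The real differential dh_p(v) = d/dt h(p + t v) at t = 0 of a
   complex-valued function; used only where h is real-differentiable. *)
Definition rdiff {V : NormedModule R_AbsRing} (h : V -> C) (p v : V) : C :=
  (Derive (fun t : R => Re (h (plus p (scal t v)))) 0,
   Derive (fun t : R => Im (h (plus p (scal t v)))) 0).

Definition rdifferentiable {V : NormedModule R_AbsRing} (h : V -> C) (p : V)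
  : Prop :=
  @ex_filterdiff R_AbsRing V C_R_NormedModule h (locally p).

Fixpoint Cn_on (n : nat) (U : C -> Prop) (f : C -> C) : Prop :=
  match n with
  | O => forall z, U z -> @continuous C_UniformSpace C_UniformSpace f z
  | S m =>
      (forall z, U z -> @rdifferentiable C_R_NormedModule f z) /\
      (forall v : C, Cn_on m U (fun z => @rdiff C_R_NormedModule f z v))
  end.

(* smooth in the real sense *)
Definition smooth_on (U : C -> Prop) (f : C -> C) : Prop :=
  forall n, Cn_on n U f.

(** * Complex-valued 1-forms on a domain of C^3 *)

(* [w p v] is the value of w at the point p on the real tangent vector v. *)
Definition form1 : Type := C3 -> C3 -> C.

Definition form_eq (Omega : C3 -> Prop) (w w' : form1) : Prop :=
  forall p v, Omega p -> w p v = w' p v.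

Definition form_scale (c : C) (w : form1) : form1 := fun p v => c * w p v.
Definition form_conj (w : form1) : form1 := fun p v => Cconj (w p v).

(* dw(u, v) = u(w(v)) - v(w(u)) for constant vector fields u and v. *)
Definition closed_form (Omega : C3 -> Prop) (w : form1) : Prop :=
  (forall v p, Omega p -> @rdifferentiable C3_R (fun q => w q v) p) /\
  (forall u v p, Omega p ->
     @rdiff C3_R (fun q => w q v) p u = @rdiff C3_R (fun q => w q u) p v).

(* A form of type (1,0) with holomorphic coefficients. *)
Definition holomorphic_form (Omega : C3 -> Prop) (w : form1) : Prop :=
  exists P : index3 -> C3 -> C,
    (forall i, holomorphic_fun Omega (P i)) /\
    (forall p v, Omega p -> w p v = sum3 (fun i => P i p * coord i v)).

Definition antiholomorphic_form (Omega : C3 -> Prop) (w : form1) : Prop :=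
  holomorphic_form Omega (form_conj w).

(* sum_i f(y_i) d(g(s_i)) *)
Definition fdg_form (f g : C -> C) (y : C3 -> C3) (s : index3 -> C3 -> C)
  : form1 :=
  fun p v =>
    sum3 (fun i =>
      f (coord i (y p)) * @rdiff C3_R (fun q => g (s i q)) p v).

(* sum_i F(y_i) / m(s_i) ds_i *)
Definition quotient_form (F m : C -> C) (y : C3 -> C3)
  (s : index3 -> C3 -> C) : form1 :=
  fun p v =>
    sum3 (fun i =>
      F (coord i (y p)) / m (s i p) * @rdiff C3_R (s i) p v).

(* The union of the images of Omega under s_1, s_2, s_3. *)
Definition values (Omega : C3 -> Prop) (s : index3 -> C3 -> C) : C -> Prop :=
  fun z => exists i p, Omega p /\ z = s i p.

Definition y_values (Omega : C3 -> Prop) (y : C3 -> C3) : C -> Prop :=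
  values Omega (fun i p => coord i (y p)).

Definition constant_near (f : C -> C) (z : C) : Prop :=
  @locally C_UniformSpace z (fun t => f t = f z).

(* The non-constancy of f and g is required at a pair of corresponding values
   y_i(p), s_i(p).  Over a large Omega it is not enough that f and g be
   non-constant somewhere: if near every p and for every i one of f(y_i),
   g(s_i) is locally constant (bump functions with unrelated supports), then
   each term f(y_i) dg(s_i) is closed on its own, for no reason related to
   the cosine law.  If f and g are not locally constant anywhere, the
   condition below holds at every p. *)
Definition nonconstant_pair (Omega : C3 -> Prop) (y : C3 -> C3)
  (s : index3 -> C3 -> C) (f g : C -> C) : Prop :=
  exists p i, Omega p /\
    ~ constant_near f (coord i (y p)) /\ ~ constant_near g (s i p).

Definition smooth_nonconstant_pair (Omega : C3 -> Prop) (y : C3 -> C3)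
  (s : index3 -> C3 -> C) (f g : C -> C) : Prop :=
  (exists U, openC U /\ (forall z, y_values Omega y z -> U z) /\
     smooth_on U f) /\
  (exists V, openC V /\ (forall z, values Omega s z -> V z) /\
     smooth_on V g) /\
  nonconstant_pair Omega y s f g.

(** * Branches of powers and their antiderivatives *)

(* h is a single-valued branch of phi^lambda near every point of A: locally
   h = exp(lambda L) for a continuous logarithm L of phi.  Below A is always a
   connected open set, on which such an h is unique up to a constant factor. *)
Definition power_branch (A : C -> Prop) (phi : C -> C) (lambda : C)
  (h : C -> C) : Prop :=
  forall z, A z -> exists L : C -> C,
    @locally C_UniformSpace z (fun t =>
      @continuous C_UniformSpace C_UniformSpace L t /\
      Cexp (L t) = phi t /\ h t = Cexp (lambda * L t)).

(* F is an antiderivative, on A, of a branch of phi^lambda. *)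
Definition power_antiderivative (A : C -> Prop) (phi : C -> C) (lambda : C)
  (F : C -> C) : Prop :=
  exists h, power_branch A phi lambda h /\
    forall z, A z -> @is_derive C_AbsRing C_NormedModule F z (h z).

(* Main.v *)
Require Import Defs.
From Stdlib Require Import Reals Lra Psatz Classical FunctionalExtensionality.
From Coquelicot Require Import Coquelicot.

(* In suitable coordinates u_i (u_i = x_i or u_i = r_i) the cosine law gives
   dy_i = (tau(u_i) / mu) sum_j E_ij du_j with E symmetric, and
   sigma(y_i) / tau(u_i) independent of i, where sigma = tau = sin in part 1 and
   sigma = tan(t/2), tau = cos in part 2.  Closedness of sum_i f(y_i) dg(u_i)
   then says that f_z(y_i) g_z(u_i) tau(u_i) is independent of i, together with
   equations between f_z g_zbar and f_zbar g_z that force these products to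
   vanish because E is not real up to phases.  So, up to conjugation, f and g
   are holomorphic near a point where both are non-constant.  Differentiating
   the first relation along the third coordinate, f''/f' is proportional to
   sigma'/sigma at each of the independent variables y_i, hence
   f''/f' = lambda sigma'/sigma and g''/g' = -(lambda + 1) tau'/tau with lambda
   constant.  These equations keep f' and g' away from zero, so they propagate
   to all of Omega.  Conversely, if f' and g' are branches of sigma^lambda and
   tau^(-lambda-1), then f'(y_i) g'(u_i) tau(u_i) is independent of i up to a
   locally constant factor, which is 1 at the base point. *)

Open Scope C_scope.

(** * Real differentials of complex-valued functions *)

(** No integral formula enters: a holomorphic function is a smooth one satisfying the Cauchy-Riemann
    equations, and symmetry of second real derivatives makes its derivative another one. A non-zero
    mixed product would give a non-zero solution of al_i E_ij = be_j conj(E_ij). Eliminating al and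
    be leaves a holomorphic function that would have to be real: cos^2 y_k in part 1, (cos y_2 + cos
    y_3) / (1 + cos y_1) in part 2. Real values on an open set would force its differential to
    vanish, against the cosine law. So the argument works on a dense set of points, and continuity
    supplies the others. In part 1, psi = cot may vanish at y_i, so lambda cannot be defined as the
    quotient of f''/f' by psi; the quotient of the derivatives is used, since psi' = -1/sin^2 has no
    zero. The functions f and g live on the union of the images of three coordinates. These
    coordinates agree at the base point, and this is what lets one branch of each power serve all
    three. *)

Notation RMod := (NormedModule R_AbsRing).
Notation C_R := C_R_NormedModule.

Ltac ring_real :=
  unfold Re, Im; cbn; unfold minus, plus, opp, mult, scal; cbn;
  unfold mult; cbn;
  match goal with |- @eq _ ?a ?b => change (@eq R a b) end; ring.

Ltac ring_components := apply injective_projections; ring_real.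

Definition has_rdiff {V : RMod} (f : V -> C) (p : V)
  (l : V -> C) : Prop :=
  @filterdiff R_AbsRing V C_R f (locally p) l.

(** Complex differentiability is a real differential that multiplies by a number, so that functions
    of one complex variable compose directly with real-differentiable maps on C^3. *)
Definition has_cderiv (f : C -> C) (z d : C) : Prop :=
  @has_rdiff C_R f z (fun v => d * v).

Lemma has_rdiff_ext_lin {V : RMod} (f : V -> C) p l l' :
  has_rdiff f p l -> (forall v, l v = l' v) -> has_rdiff f p l'.
Proof.
intros H E. eapply filterdiff_ext_lin; [exact H | exact E].
Qed.

Lemma has_rdiff_ext_loc {V : RMod} (f g : V -> C) p l :
  locally p (fun q => f q = g q) -> has_rdiff f p l -> has_rdiff g p l.
Proof.
intros E H. eapply filterdiff_ext_locally; [exact E | exact H].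
Qed.

Lemma has_rdiff_ext {V : RMod} (f g : V -> C) p l :
  (forall q, f q = g q) -> has_rdiff f p l -> has_rdiff g p l.
Proof.
intros E. apply has_rdiff_ext_loc. now apply filter_forall.
Qed.

Lemma has_rdiff_const {V : RMod} (c : C) (p : V) :
  has_rdiff (fun _ => c) p (fun _ => 0).
Proof.
apply (@filterdiff_const R_AbsRing V C_R); apply locally_filter.
Qed.

Lemma has_rdiff_plus {V : RMod} (f g : V -> C) p lf lg :
  has_rdiff f p lf -> has_rdiff g p lg ->
  has_rdiff (fun q => f q + g q) p (fun v => lf v + lg v).
Proof.
intros Hf Hg.
exact (@filterdiff_plus_fct R_AbsRing V C_R _ _ _ _ _ _ Hf Hg).
Qed.

Lemma has_rdiff_opp {V : RMod} (f : V -> C) p lf :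
  has_rdiff f p lf -> has_rdiff (fun q => - f q) p (fun v => - lf v).
Proof.
intros Hf. exact (@filterdiff_opp_fct R_AbsRing V C_R _ _ _ _ Hf).
Qed.

Lemma has_rdiff_minus {V : RMod} (f g : V -> C) p lf lg :
  has_rdiff f p lf -> has_rdiff g p lg ->
  has_rdiff (fun q => f q - g q) p (fun v => lf v - lg v).
Proof.
intros Hf Hg. apply has_rdiff_plus; [exact Hf | now apply has_rdiff_opp].
Qed.

Lemma has_rdiff_comp {V W : RMod} (f : V -> W) (g : W -> C)
  p lf lg :
  filterdiff f (locally p) lf -> has_rdiff g (f p) lg ->
  has_rdiff (fun q => g (f q)) p (fun v => lg (lf v)).
Proof.
intros Hf Hg. exact (filterdiff_comp' f g p lf lg Hf Hg).
Qed.

Lemma has_rdiff_linear {V : RMod} (l : V -> C) p :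
  @is_linear R_AbsRing V C_R l -> has_rdiff l p l.
Proof.
apply (@filterdiff_linear R_AbsRing V C_R).
Qed.

Lemma has_rdiff_is_linear {V : RMod} (f : V -> C) p l :
  has_rdiff f p l -> @is_linear R_AbsRing V C_R l.
Proof. intros H; apply H. Qed.

Lemma has_rdiff_continuous {V : RMod} (f : V -> C) p l :
  has_rdiff f p l -> @continuous V C_UniformSpace f p.
Proof.
intros H. apply (@filterdiff_continuous R_AbsRing V C_R).
exists l; exact H.
Qed.

Lemma filterdiff_Re (z : C) : @filterdiff R_AbsRing C_R R_NormedModule Re (locally z) Re.
Proof. apply (@filterdiff_linear R_AbsRing C_R R_NormedModule). apply is_linear_fst. Qed.

Lemma filterdiff_Im (z : C) : @filterdiff R_AbsRing C_R R_NormedModule Im (locally z) Im.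
Proof. apply (@filterdiff_linear R_AbsRing C_R R_NormedModule). apply is_linear_snd. Qed.

Lemma has_rdiff_Re {V : RMod} (f : V -> C) p l :
  has_rdiff f p l ->
  @filterdiff R_AbsRing V R_NormedModule (fun q => Re (f q)) (locally p) (fun v => Re (l v)).
Proof.
intros H. exact (@filterdiff_comp' R_AbsRing V C_R R_NormedModule f Re p l Re H (filterdiff_Re _)).
Qed.

Lemma has_rdiff_Im {V : RMod} (f : V -> C) p l :
  has_rdiff f p l ->
  @filterdiff R_AbsRing V R_NormedModule (fun q => Im (f q)) (locally p) (fun v => Im (l v)).
Proof.
intros H. exact (@filterdiff_comp' R_AbsRing V C_R R_NormedModule f Im p l Im H (filterdiff_Im _)).
Qed.

Lemma has_rdiff_pair {V : RMod} (a b : V -> R) p la lb :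
  @filterdiff R_AbsRing V R_NormedModule a (locally p) la ->
  @filterdiff R_AbsRing V R_NormedModule b (locally p) lb ->
  has_rdiff (fun q => (a q, b q)) p (fun v => (la v, lb v)).
Proof.
intros Ha Hb.
refine (@filterdiff_comp'_2 R_AbsRing V R_NormedModule R_NormedModule C_R a b (fun x y => (x, y))
  p la lb (fun x y => (x, y)) Ha Hb _).
apply (filterdiff_ext (fun t => t)).
now intros [u v].
apply (filterdiff_ext_lin _ (fun t => t)).
apply (@filterdiff_id R_AbsRing C_R).
now intros [u v].
Qed.

Lemma has_rdiff_mult {V : RMod} (f g : V -> C) p lf lg :
  has_rdiff f p lf -> has_rdiff g p lg ->
  has_rdiff (fun q => f q * g q) p (fun v => lf v * g p + f p * lg v).
Proof.
intros Hf Hg.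
pose proof (has_rdiff_Re _ _ _ Hf) as Hf1. pose proof (has_rdiff_Im _ _ _ Hf) as Hf2.
pose proof (has_rdiff_Re _ _ _ Hg) as Hg1. pose proof (has_rdiff_Im _ _ _ Hg) as Hg2.
pose proof (filterdiff_mult_fct _ _ _ _ _ Rmult_comm Hf1 Hg1) as H11.
pose proof (filterdiff_mult_fct _ _ _ _ _ Rmult_comm Hf2 Hg2) as H22.
pose proof (filterdiff_mult_fct _ _ _ _ _ Rmult_comm Hf1 Hg2) as H12.
pose proof (filterdiff_mult_fct _ _ _ _ _ Rmult_comm Hf2 Hg1) as H21.
pose proof (filterdiff_minus_fct _ _ _ _ H11 H22) as A.
pose proof (filterdiff_plus_fct _ _ _ _ H12 H21) as B.
eapply has_rdiff_ext_lin.
refine (has_rdiff_ext _ _ _ _ _ (has_rdiff_pair _ _ _ _ _ A B)).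
- intros q. ring_components.
- intros v. ring_components.
Qed.

Lemma has_rdiff_cmult_l {V : RMod} (c : C) (f : V -> C) p l :
  has_rdiff f p l -> has_rdiff (fun q => c * f q) p (fun v => c * l v).
Proof.
intros H. eapply has_rdiff_ext_lin.
exact (has_rdiff_mult _ _ _ _ _ (has_rdiff_const c p) H).
intros v; cbn; ring.
Qed.

Lemma has_rdiff_conj {V : RMod} (f : V -> C) p l :
  has_rdiff f p l -> has_rdiff (fun q => Cconj (f q)) p (fun v => Cconj (l v)).
Proof.
intros H. apply has_rdiff_pair.
now apply has_rdiff_Re.
apply (filterdiff_opp_fct (V := R_NormedModule) (fun q => Im (f q)) (fun v => Im (l v))).
now apply has_rdiff_Im.
Qed.

Lemma has_rdiff_id (z : C) : @has_rdiff C_R (fun w => w) z (fun v => v).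
Proof. apply (@filterdiff_id R_AbsRing C_R). Qed.

Lemma has_cderiv_comp {V : RMod} (f : V -> C) (g : C -> C) p l d :
  has_rdiff f p l -> has_cderiv g (f p) d ->
  has_rdiff (fun q => g (f q)) p (fun v => d * l v).
Proof.
intros Hf Hg. exact (@has_rdiff_comp V C_R f g p l _ Hf Hg).
Qed.

Lemma is_derive_Re_Im (c : R -> C) (t : R) (l : C) :
  @has_rdiff R_NormedModule c t (fun s => RtoC s * l) ->
  is_derive (fun s => Re (c s)) t (Re l) /\ is_derive (fun s => Im (c s)) t (Im l).
Proof.
intros H. split.
- eapply filterdiff_ext_lin. exact (has_rdiff_Re _ _ _ H).
  intros s; ring_real.
- eapply filterdiff_ext_lin. exact (has_rdiff_Im _ _ _ H).
  intros s; ring_real.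
Qed.

Lemma filterdiff_line {V : RMod} (p v : V) (t : R) :
  filterdiff (fun s : R_NormedModule => plus p (scal s v)) (locally t) (fun s => scal s v).
Proof.
eapply filterdiff_ext_lin.
apply filterdiff_plus_fct.
apply filterdiff_const.
apply (filterdiff_linear (fun s : R_NormedModule => scal s v)).
exact (@is_linear_scal_l R_AbsRing V v).
intros s; cbn. apply plus_zero_l.
Qed.

Lemma has_rdiff_line {V : RMod} (h : V -> C) (p v : V) (t : R) l :
  has_rdiff h (plus p (scal t v)) l ->
  @has_rdiff R_NormedModule (fun s => h (plus p (scal s v))) t (fun s => RtoC s * l v).
Proof.
intros H. eapply has_rdiff_ext_lin.
exact (@has_rdiff_comp R_NormedModule V _ h t _ l (filterdiff_line p v t) H).
intros s; cbn. rewrite (linear_scal l (has_rdiff_is_linear _ _ _ H)).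
apply scal_R_Cmult.
Qed.

(** The directional derivatives in [rdiff] are taken along the line p + t v at t = 0, where the
    chain rule applies. All later statements about [rdiff] go through a differential by this
    lemma. *)
Lemma has_rdiff_rdiff {V : RMod} (h : V -> C) p l v :
  has_rdiff h p l -> rdiff h p v = l v.
Proof.
intros H.
assert (H0 : has_rdiff h (plus p (scal (0 : R_Ring) v)) l).
{ replace (plus p (scal (0 : R_Ring) v)) with p; [exact H|].
  change (0 : R_Ring)%R with (@zero R_Ring). now rewrite scal_zero_l, plus_zero_r. }
destruct (is_derive_Re_Im _ _ _ (has_rdiff_line h p v 0%R l H0)) as [A B].
apply injective_projections.
exact (is_derive_unique _ _ _ A).
exact (is_derive_unique _ _ _ B).
Qed.

Lemma rdifferentiable_rdiff {V : RMod} (h : V -> C) p :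
  rdifferentiable h p -> has_rdiff h p (rdiff h p).
Proof.
intros [l H]. eapply has_rdiff_ext_lin. exact H.
intros v. symmetry. now apply has_rdiff_rdiff.
Qed.

Lemma has_rdiff_unique {V : RMod} (h : V -> C) p l l' v :
  has_rdiff h p l -> has_rdiff h p l' -> l v = l' v.
Proof.
intros H H'. rewrite <- (has_rdiff_rdiff _ _ _ v H). now apply has_rdiff_rdiff.
Qed.

Lemma has_rdiff_eq {V : RMod} (h k : V -> C) p l l' v :
  locally p (fun q => h q = k q) -> has_rdiff h p l -> has_rdiff k p l' -> l v = l' v.
Proof.
intros E H H'. apply (has_rdiff_unique k p). now apply (has_rdiff_ext_loc h). exact H'.
Qed.

Ltac cring := cbn; match goal with |- @eq _ ?a ?b => change (@eq C a b) end; ring.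
Ltac introC := match goal with |- forall v : _, @?P v => change (forall v : C, P v); intros v;
  cbv beta end.
Ltac cfield := cbn; match goal with |- @eq _ ?a ?b => change (@eq C a b) end; field.

Lemma is_linear_cmult (d : C) :
  @is_linear R_AbsRing C_R C_R (fun v => d * v).
Proof.
split.
- intros x y. change (d * (x + y) = d * x + d * y). ring.
- intros k x. change (d * (scal k x : C) = scal k (d * x : C)).
  rewrite !scal_R_Cmult. ring.
- exists (Cmod d + 1)%R. split.
  + pose proof (Cmod_ge_0 d). lra.
  + intros x. rewrite <- !Cmod_norm, Cmod_mult.
    pose proof (Cmod_ge_0 x). nra.
Qed.

Lemma locally_C_iff (z : C) (P : C -> Prop) :
  @locally C_UniformSpace z P <->
  exists delta : posreal, forall w, (Cmod (w - z) < delta)%R -> P w.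
Proof.
rewrite locally_C. split; intros [d H]; exists d; intros w Hw; apply H; exact Hw.
Qed.

Lemma has_cderiv_iff (f : C -> C) (z d : C) :
  has_cderiv f z d <->
  forall eps : posreal, @locally C_UniformSpace z
    (fun w => (Cmod (f w - f z - d * (w - z)) <= eps * Cmod (w - z))%R).
Proof.
split.
- intros [_ H] eps. specialize (H z (fun P Q => Q) eps).
  revert H. apply filter_imp. intros w Hw. rewrite !Cmod_norm. exact Hw.
- intros H. split.
  + apply is_linear_cmult.
  + intros x Hx. apply (@is_filter_lim_locally_unique R_AbsRing C_R) in Hx.
    subst x. intros eps. generalize (H eps). apply filter_imp.
    intros w Hw. rewrite !Cmod_norm in Hw. exact Hw.
Qed.

Lemma has_cderiv_is_derive (f : C -> C) (z d : C) :
  has_cderiv f z d <-> @is_derive C_AbsRing C_NormedModule f z d.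
Proof.
rewrite has_cderiv_iff. split.
- intros H. split.
  + apply (@is_linear_scal_l C_AbsRing C_NormedModule).
  + intros x Hx. apply (@is_filter_lim_locally_unique C_AbsRing (AbsRing_NormedModule C_AbsRing))
    in Hx.
    subst x. intros eps. generalize (H eps). rewrite locally_C. apply filter_imp.
    intros w Hw. rewrite (Cmult_comm d) in Hw. exact Hw.
- intros [_ H] eps. specialize (H z (fun P Q => Q) eps).
  rewrite locally_C. revert H. apply filter_imp.
  intros w Hw. rewrite (Cmult_comm d). exact Hw.
Qed.

Lemma has_cderiv_quadratic (f : C -> C) (z d : C) (M : R) :
  @locally C_UniformSpace z
    (fun w => (Cmod (f w - f z - d * (w - z)) <= M * (Cmod (w - z) * Cmod (w - z)))%R) ->
  has_cderiv f z d.
Proof.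
intros H. apply has_cderiv_iff. intros eps.
assert (P : (0 < eps / (Rabs M + 1))%R).
{ apply Rdiv_lt_0_compat. apply cond_pos. pose proof (Rabs_pos M); lra. }
assert (H2 : @locally C_UniformSpace z (fun w => (Cmod (w - z) < eps / (Rabs M + 1))%R)).
{ apply locally_C_iff. exists (mkposreal _ P). now intros w Hw. }
generalize (filter_and _ _ H H2). apply filter_imp. intros w [A B].
eapply Rle_trans; [exact A|]. rewrite <- Rmult_assoc.
apply Rmult_le_compat_r. apply Cmod_ge_0.
pose proof (Rabs_pos M) as Q. pose proof (Rle_abs M). pose proof (Cmod_ge_0 (w - z)).
assert (M * Cmod (w - z) <= (Rabs M + 1) * (eps / (Rabs M + 1)))%R by nra.
replace ((Rabs M + 1) * (eps / (Rabs M + 1)))%R with (pos eps) in H3 by (field; lra).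
exact H3.
Qed.

Lemma has_cderiv_inv (z : C) : z <> 0 -> has_cderiv Cinv z (- / (z * z)).
Proof.
intros Hz. assert (Pz : (0 < Cmod z)%R) by (now apply Cmod_gt_0).
(* The remainder of 1/w at z is (w - z)^2 / (z^2 w), and |w| > |z|/2 on the disc of radius |z|/2;
   this gives the constant 2/|z|^3. *)
apply has_cderiv_quadratic with (M := (2 / (Cmod z * Cmod z * Cmod z))%R).
apply locally_C_iff. assert (P : (0 < Cmod z / 2)%R) by lra.
exists (mkposreal _ P). cbn. intros w Hw.
assert (Hw2 : (Cmod z / 2 < Cmod w)%R).
{ pose proof (Cmod_triangle (z - w) w) as T. replace (z - w + w) with z in T by ring.
  rewrite <- Cmod_opp in Hw. replace (- (w - z)) with (z - w) in Hw by ring. lra. }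
assert (Nw : w <> 0) by (apply Cmod_gt_0; lra).
replace (/ w - / z - - / (z * z) * (w - z)) with ((w - z) * (w - z) / (z * z * w)) by (field; auto).
rewrite Cmod_div, !Cmod_mult by (repeat apply Cmult_neq_0; auto).
pose proof (Cmod_ge_0 (w - z)).
unfold Rdiv. rewrite Rmult_comm. apply Rmult_le_compat_r. nra.
replace (2 * / (Cmod z * Cmod z * Cmod z))%R with (/ (Cmod z * Cmod z * (Cmod z / 2)))%R by
  (field; lra).
apply Rinv_le_contravar. repeat apply Rmult_lt_0_compat; lra.
apply Rmult_le_compat_l; [nra | lra].
Qed.

Lemma has_rdiff_inv {V : RMod} (f : V -> C) p l :
  f p <> 0 -> has_rdiff f p l ->
  has_rdiff (fun q => / f q) p (fun v => - l v / (f p * f p)).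
Proof.
intros N H. eapply has_rdiff_ext_lin.
exact (has_cderiv_comp f Cinv p l _ H (has_cderiv_inv _ N)).
intros v; cfield; exact N.
Qed.

Lemma has_rdiff_div {V : RMod} (f g : V -> C) p lf lg :
  g p <> 0 -> has_rdiff f p lf -> has_rdiff g p lg ->
  has_rdiff (fun q => f q / g q) p (fun v => (lf v * g p - f p * lg v) / (g p * g p)).
Proof.
intros N Hf Hg. eapply has_rdiff_ext_lin.
exact (has_rdiff_mult _ _ _ _ _ Hf (has_rdiff_inv _ _ _ N Hg)).
intros v; cfield; exact N.
Qed.

Lemma has_cderiv_ext_d (f : C -> C) z d d' : has_cderiv f z d -> d = d' -> has_cderiv f z d'.
Proof. now intros H <-. Qed.

Lemma has_cderiv_ext_loc (f g : C -> C) z d :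
  @locally C_UniformSpace z (fun w => f w = g w) -> has_cderiv f z d -> has_cderiv g z d.
Proof. exact (@has_rdiff_ext_loc C_R f g z _). Qed.

Lemma has_cderiv_const c z : has_cderiv (fun _ => c) z 0.
Proof.
eapply has_rdiff_ext_lin. apply has_rdiff_const. introC; cring.
Qed.

Lemma has_cderiv_id z : has_cderiv (fun w => w) z 1.
Proof.
eapply has_rdiff_ext_lin. apply has_rdiff_id. introC; cring.
Qed.

Lemma has_cderiv_plus (f g : C -> C) (z a b : C) :
  has_cderiv f z a -> has_cderiv g z b -> has_cderiv (fun w => f w + g w) z (a + b).
Proof.
intros Hf Hg. eapply has_rdiff_ext_lin. exact (has_rdiff_plus _ _ _ _ _ Hf Hg).
introC; cring.
Qed.

Lemma has_cderiv_opp (f : C -> C) z a : has_cderiv f z a -> has_cderiv (fun w => - f w) z (- a).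
Proof.
intros Hf. eapply has_rdiff_ext_lin. exact (has_rdiff_opp _ _ _ Hf).
introC; cring.
Qed.

Lemma has_cderiv_minus (f g : C -> C) (z a b : C) :
  has_cderiv f z a -> has_cderiv g z b -> has_cderiv (fun w => f w - g w) z (a - b).
Proof.
intros Hf Hg. apply has_cderiv_plus; [exact Hf | now apply has_cderiv_opp].
Qed.

Lemma has_cderiv_mult (f g : C -> C) (z a b : C) :
  has_cderiv f z a -> has_cderiv g z b ->
  has_cderiv (fun w => f w * g w) z (a * g z + f z * b).
Proof.
intros Hf Hg. eapply has_rdiff_ext_lin. exact (has_rdiff_mult _ _ _ _ _ Hf Hg).
introC; cring.
Qed.

Lemma has_cderiv_div (f g : C -> C) (z a b : C) :
  g z <> 0 -> has_cderiv f z a -> has_cderiv g z b ->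
  has_cderiv (fun w => f w / g w) z ((a * g z - f z * b) / (g z * g z)).
Proof.
intros N Hf Hg. eapply has_rdiff_ext_lin. exact (has_rdiff_div _ _ _ _ _ N Hf Hg).
introC; cfield; exact N.
Qed.

Lemma has_cderiv_chain (f g : C -> C) (z a b : C) :
  has_cderiv f z a -> has_cderiv g (f z) b -> has_cderiv (fun w => g (f w)) z (b * a).
Proof.
intros Hf Hg. eapply has_rdiff_ext_lin. exact (has_cderiv_comp f g z _ _ Hf Hg).
introC; cring.
Qed.

Lemma has_cderiv_continuous f z d :
  has_cderiv f z d -> @continuous C_UniformSpace C_UniformSpace f z.
Proof. exact (@has_rdiff_continuous C_R f z _). Qed.

(** * Complex-linear maps and holomorphy on C^3 *)

Definition clinear (l : C3 -> C) : Prop :=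
  exists a : index3 -> C, forall v, l v = sum3 (fun i => a i * coord i v).

Lemma norm_C3 (v : C3) : @norm R_AbsRing C3_R v = @norm C_AbsRing C3_C v.
Proof.
destruct v as [[a b] c].
change (sqrt (sqrt (@norm R_AbsRing C_R a ^ 2 +
  @norm R_AbsRing C_R b ^ 2) ^ 2 + @norm R_AbsRing C_R c ^ 2) =
  sqrt (sqrt (Cmod a ^ 2 + Cmod b ^ 2) ^ 2 + Cmod c ^ 2))%R.
now rewrite !Cmod_norm.
Qed.

Lemma clinear_is_linear_C (l : C3 -> C) :
  clinear l -> @is_linear C_AbsRing C3_C C_NormedModule l.
Proof.
intros [a H].
assert (G : @is_linear C_AbsRing C3_C C_NormedModule (fun v => sum3 (fun i => a i * coord i v))).
{ unfold sum3.
  assert (L : forall i, @is_linear C_AbsRing C3_C C_NormedModule (fun v => a i * coord i v)).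
  { intros i.
    apply (@is_linear_comp C_AbsRing C3_C C_NormedModule C_NormedModule (coord i) (fun z => a i *
      z)).
    - destruct i; cbn.
      + apply (@is_linear_comp C_AbsRing C3_C (prod_NormedModule C_AbsRing C_NormedModule
        C_NormedModule) C_NormedModule fst fst); apply is_linear_fst.
      + apply (@is_linear_comp C_AbsRing C3_C (prod_NormedModule C_AbsRing C_NormedModule
        C_NormedModule) C_NormedModule fst snd); [apply is_linear_fst | apply is_linear_snd].
      + apply is_linear_snd.
    - exact (@is_linear_scal_r C_AbsRing C_NormedModule (a i) Cmult_comm). }
  pose proof (L I1) as L1. pose proof (L I2) as L2. pose proof (L I3) as L3.
  split.
  - intros x y. rewrite (linear_plus _ L1), (linear_plus _ L2), (linear_plus _ L3).
    change (a I1 * coord I1 x + a I1 * coord I1 y + (a I2 * coord I2 x + a I2 * coord I2 y)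
      + (a I3 * coord I3 x + a I3 * coord I3 y) =
      a I1 * coord I1 x + a I2 * coord I2 x + a I3 * coord I3 x
      + (a I1 * coord I1 y + a I2 * coord I2 y + a I3 * coord I3 y)). ring.
  - intros k x. rewrite (linear_scal _ L1), (linear_scal _ L2), (linear_scal _ L3).
    change (k * (a I1 * coord I1 x) + k * (a I2 * coord I2 x) + k * (a I3 * coord I3 x) =
      k * (a I1 * coord I1 x + a I2 * coord I2 x + a I3 * coord I3 x)). ring.
  - destruct (linear_norm _ L1) as [M1 [P1 N1]]. destruct (linear_norm _ L2) as [M2 [P2 N2]].
    destruct (linear_norm _ L3) as [M3 [P3 N3]].
    exists (M1 + M2 + M3)%R. split. lra. intros x.
    eapply Rle_trans. apply (@norm_triangle C_AbsRing C_NormedModule).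
    eapply Rle_trans. apply Rplus_le_compat_r. apply (@norm_triangle C_AbsRing C_NormedModule).
    specialize (N1 x). specialize (N2 x). specialize (N3 x).
    rewrite !Rmult_plus_distr_r. apply Rplus_le_compat; [apply Rplus_le_compat|]; assumption. }
destruct G as [G1 G2 G3]. split.
- intros x y. rewrite !H. apply G1.
- intros k x. rewrite !H. apply G2.
- destruct G3 as [M [P N]]. exists M. split; [exact P|]. intros x. rewrite H. apply N.
Qed.

Lemma is_linear_C_clinear (l : C3 -> C) :
  @is_linear C_AbsRing C3_C C_NormedModule l -> clinear l.
Proof.
intros H.
exists (fun i => match i with I1 => l (RtoC 1, RtoC 0, RtoC 0)
  | I2 => l (RtoC 0, RtoC 1, RtoC 0) | I3 => l (RtoC 0, RtoC 0, RtoC 1) end).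
intros [[a b] c]. unfold sum3, coord; cbn.
pose proof (linear_scal l H a (RtoC 1, RtoC 0, RtoC 0)) as Ea.
pose proof (linear_scal l H b (RtoC 0, RtoC 1, RtoC 0)) as Eb.
pose proof (linear_scal l H c (RtoC 0, RtoC 0, RtoC 1)) as Ec.
pose proof (linear_plus l H (a, b, RtoC 0) (RtoC 0, RtoC 0, c)) as E1.
pose proof (linear_plus l H (a, RtoC 0, RtoC 0) (RtoC 0, b, RtoC 0)) as E2.
change (l (a * 1, a * 0, a * 0) = a * l (RtoC 1, RtoC 0, RtoC 0)) in Ea.
change (l (b * 0, b * 1, b * 0) = b * l (RtoC 0, RtoC 1, RtoC 0)) in Eb.
change (l (c * 0, c * 0, c * 1) = c * l (RtoC 0, RtoC 0, RtoC 1)) in Ec.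
change (l (a + 0, b + 0, 0 + c) = l (a, b, RtoC 0) + l (RtoC 0, RtoC 0, c)) in E1.
change (l (a + 0, 0 + b, 0 + 0) = l (a, RtoC 0, RtoC 0) + l (RtoC 0, b, RtoC 0)) in E2.
rewrite Cmult_1_r, Cmult_0_r in Ea. rewrite Cmult_1_r, Cmult_0_r in Eb. rewrite Cmult_1_r,
  Cmult_0_r in Ec.
rewrite !Cplus_0_r, Cplus_0_l in E1. rewrite !Cplus_0_r, Cplus_0_l in E2.
rewrite E1, E2, Ea, Eb, Ec. ring.
Qed.

Lemma is_linear_C_R (l : C3 -> C) :
  @is_linear C_AbsRing C3_C C_NormedModule l ->
  @is_linear R_AbsRing C3_R C_R l.
Proof.
intros H. split.
- exact (linear_plus l H).
- intros k x.
  assert (E : @scal R_Ring C3_R k x = @scal C_Ring C3_C (RtoC k) x).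
  { destruct x as [[a b] c].
    change (((@scal R_Ring C_R k a : C), (@scal R_Ring C_R k b : C),
      (@scal R_Ring C_R k c : C)) = (RtoC k * a, RtoC k * b, RtoC k * c)).
    now rewrite !scal_R_Cmult. }
  transitivity (l (@scal C_Ring C3_C (RtoC k) x)). now rewrite <- E.
  transitivity (RtoC k * l x). exact (linear_scal l H (RtoC k) x).
  symmetry. apply scal_R_Cmult.
- destruct (linear_norm l H) as [M [P N]]. exists M. split; [exact P|].
  intros x. rewrite norm_C3, <- Cmod_norm. apply N.
Qed.

(** The real and complex norms on C^3 coincide, so the two remainder estimates are the same and only
    the linearity of the differential differs. Holomorphy is used and proved below only in this
    form. *)
Lemma ex_filterdiff_C3 (P : C3 -> C) (p : C3) :
  @ex_filterdiff C_AbsRing C3_C C_NormedModule P (@locally C3_C p) <->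
  exists l, clinear l /\ @has_rdiff C3_R P p l.
Proof.
split.
- intros [l [Hl H]]. exists l. split. now apply is_linear_C_clinear.
  split. now apply is_linear_C_R.
  intros x Hx. apply (@is_filter_lim_locally_unique R_AbsRing C3_R) in Hx. subst x.
  intros eps. generalize (H p (fun _ Q => Q) eps). apply filter_imp.
  intros q Hq. rewrite norm_C3, <- Cmod_norm. exact Hq.
- intros [l [Hl [_ H]]]. exists l. split. now apply clinear_is_linear_C.
  intros x Hx. apply (@is_filter_lim_locally_unique C_AbsRing C3_C) in Hx. subst x.
  intros eps. generalize (H p (fun _ Q => Q) eps). apply filter_imp.
  intros q Hq. rewrite norm_C3, <- Cmod_norm in Hq. exact Hq.
Qed.

Lemma clinear_coord i : clinear (coord i).
Proof.
exists (fun j => match i, j with I1, I1 | I2, I2 | I3, I3 => 1 | _, _ => 0 end).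
intros v. destruct i; unfold sum3; cbn; ring.
Qed.

Lemma clinear_plus l l' : clinear l -> clinear l' -> clinear (fun v => l v + l' v).
Proof.
intros [a H] [b H']. exists (fun i => a i + b i). intros v. rewrite H, H'. unfold sum3; ring.
Qed.

Lemma clinear_scal c l : clinear l -> clinear (fun v => c * l v).
Proof.
intros [a H]. exists (fun i => c * a i). intros v. rewrite H. unfold sum3; ring.
Qed.

Lemma clinear_is_linear (l : C3 -> C) :
  clinear l -> @is_linear R_AbsRing C3_R C_R l.
Proof. intros H. now apply is_linear_C_R, clinear_is_linear_C. Qed.

(** * Vanishing differentials, connectedness, induction on an interval *)

Lemma locally_norm_iff {V : RMod} (p : V) (P : V -> Prop) :
  locally p P <->
  exists eps : posreal, forall q, (norm (minus q p) < eps)%R -> P q.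
Proof.
split.
- intros H. apply (locally_norm_le_locally p) in H.
  destruct H as [e H]. exists e. intros q Hq. now apply H.
- intros [e H]. apply (locally_le_locally_norm p). exists e. intros q Hq. now apply H.
Qed.

Lemma minus_plus_l (G : AbelianGroup) (p v : G) : minus (plus p v) p = v.
Proof.
transitivity (plus v (plus p (opp p))).
- rewrite plus_assoc, (plus_comm v p). reflexivity.
- rewrite plus_opp_r. apply plus_zero_r.
Qed.

Lemma plus_minus_r (G : AbelianGroup) (p q : G) : plus p (minus q p) = q.
Proof.
transitivity (plus (plus p (opp p)) q).
- rewrite <- plus_assoc. apply (f_equal (plus p)). apply plus_comm.
- rewrite plus_opp_r. apply plus_zero_l.
Qed.

Lemma norm_segment {V : RMod} (p q : V) (t : R) :
  (0 <= t <= 1)%R ->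
  (norm (minus (plus p (scal t (minus q p))) p) <= norm (minus q p))%R.
Proof.
intros Ht.
replace (minus (plus p (scal t (minus q p))) p) with (scal t (minus q p)).
- eapply Rle_trans. apply (@norm_scal R_AbsRing V).
  change (Rabs t * norm (minus q p) <= norm (minus q p))%R.
  pose proof (norm_ge_0 (minus q p)). rewrite Rabs_pos_eq by apply Ht. nra.
- symmetry. exact (minus_plus_l (NormedModule.AbelianGroup R_AbsRing V) p _).
Qed.

Lemma segment_0 {V : RMod} (p q : V) :
  plus p (scal (0 : R_Ring) (minus q p)) = p.
Proof.
change (0 : R_Ring)%R with (@zero R_Ring). now rewrite scal_zero_l, plus_zero_r.
Qed.

Lemma segment_1 {V : RMod} (p q : V) :
  plus p (scal (1 : R_Ring) (minus q p)) = q.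
Proof.
change (1 : R_Ring)%R with (@one R_Ring). rewrite scal_one.
exact (plus_minus_r (NormedModule.AbelianGroup R_AbsRing V) p q).
Qed.

Lemma has_rdiff_0_locally_const {V : RMod} (Q : V -> C) p :
  locally p (fun q => has_rdiff Q q (fun _ => 0)) ->
  locally p (fun q => Q q = Q p).
Proof.
rewrite !locally_norm_iff. intros [e H]. exists e. intros q Hq.
assert (E : Q (plus p (scal (0 : R_Ring) (minus q p))) = Q (plus p (scal (1 : R_Ring) (minus q
  p)))).
{ apply (@eq_is_derive C_R (fun t => Q (plus p (scal t (minus q p)))) 0 1).
  - intros t Ht.
    pose proof (has_rdiff_line Q p (minus q p) t (fun _ => 0)) as L.
    eapply filterdiff_ext_lin.
    + apply L. apply H. eapply Rle_lt_trans; [now apply norm_segment | exact Hq].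
    + intros s; cbn. rewrite Cmult_0_r. symmetry.
      apply (@scal_zero_r R_AbsRing C_R).
  - lra. }
rewrite segment_0, segment_1 in E. now symmetry.
Qed.

Lemma open_locally (Omega : C3 -> Prop) (p : C3) :
  openC3 Omega -> Omega p -> @locally C3_R p Omega.
Proof. intros H Hp. now apply H. Qed.

(** Connectedness concerns two open sets, so the complement of [P] enters through its interior [B].
    The second hypothesis, closedness of [P] relative to [Omega], makes [P] and [B] cover
    [Omega]. *)
Lemma connected_clopen (Omega P : C3 -> Prop) (p0 : C3) :
  openC3 Omega -> connected_open Omega ->
  (forall p, Omega p -> P p -> @locally C3_R p P) ->
  (forall p, Omega p ->
    (forall N, @locally C3_R p N -> exists q, N q /\ Omega q /\ P q) -> P p) ->
  Omega p0 -> P p0 ->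
  forall p, Omega p -> P p.
Proof.
intros Ho Hc H1 H2 Hp0 P0.
pose (B := fun q : C3 => @locally C3_R q (fun q' => Omega q' -> ~ P q')).
destruct (Hc (fun q => Omega q /\ P q) (fun q => Omega q /\ B q)) as [H|H].
- intros q [Hq Pq]. apply filter_and. now apply open_locally. now apply H1.
- intros q [Hq Bq]. apply filter_and. now apply open_locally.
  apply (@locally_locally C3_R). exact Bq.
- intros p Hp. destruct (classic (P p)) as [Pp|Np]; [left; now split|right].
  split; [exact Hp|]. apply NNPP. intros NB. apply Np, H2; [exact Hp|].
  intros N HN. apply NNPP. intros NE. apply NB. unfold B. revert HN. apply filter_imp.
  intros q Nq Oq Pq. apply NE. now exists q.
- intros p Hp [[_ Pp] [_ Bp]]. exact (locally_singleton _ _ Bp Hp Pp).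
- intros p Hp. now apply H.
- exfalso. destruct (H p0 Hp0) as [_ Bp]. exact (locally_singleton _ _ Bp Hp0 P0).
Qed.

Lemma has_rdiff_0_const (Omega : C3 -> Prop) (Q : C3 -> C) :
  openC3 Omega -> connected_open Omega ->
  (forall p, Omega p -> @has_rdiff C3_R Q p (fun _ => 0)) ->
  forall p q, Omega p -> Omega q -> Q p = Q q.
Proof.
intros Ho Hc H p q Hp Hq. revert p Hp.
assert (L : forall p, Omega p -> @locally C3_R p (fun r => Q r = Q p)).
{ intros p Hp. apply (@has_rdiff_0_locally_const C3_R).
  generalize (open_locally _ _ Ho Hp). apply filter_imp. exact H. }
apply (connected_clopen Omega (fun p => Q p = Q q) q Ho Hc).
- intros p Hp E. rewrite <- E. now apply L.
- intros p Hp D. destruct (D _ (L p Hp)) as [r [E [_ E']]]. now rewrite <- E.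
- exact Hq.
- reflexivity.
Qed.

(** The supremum of the t such that [P] holds on [0, t] satisfies [P] by the first hypothesis and is
    exceeded by the second, unless it is 1. The case t = 0 of the first hypothesis is the start,
    since no s then lies below t. *)
Lemma real_induction (P : R -> Prop) :
  (forall t, (0 <= t <= 1)%R -> (forall s, (0 <= s < t)%R -> P s) -> P t) ->
  (forall t, (0 <= t <= 1)%R -> P t ->
    exists d : posreal, forall s, (0 <= s <= 1)%R -> (Rabs (s - t) < d)%R -> P s) ->
  forall t, (0 <= t <= 1)%R -> P t.
Proof.
intros Hl Hr.
set (E := fun t => (0 <= t <= 1)%R /\ forall s, (0 <= s <= t)%R -> P s).
assert (P0 : P 0%R) by (apply Hl; [lra | intros s Hs; lra]).
destruct (completeness E) as [m [Hm1 Hm2]].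
- exists 1%R. intros t [Ht _]. lra.
- exists 0%R. split. lra. intros s Hs. now replace s with 0%R by lra.
- assert (m01 : (0 <= m <= 1)%R).
  { split. apply Hm1. split. lra. intros s Hs. now replace s with 0%R by lra.
    apply Hm2. intros t [Ht _]. lra. }
  assert (Pm : forall s, (0 <= s < m)%R -> P s).
  { intros s Hs. apply NNPP. intros N.
    assert (m <= s)%R; [|lra]. apply Hm2. intros t [Ht Ht'].
    destruct (Rle_or_lt t s) as [|L]; [assumption|]. exfalso. apply N, Ht'. lra. }
  pose proof (Hl m m01 Pm) as Pmm.
  destruct (Hr m m01 Pmm) as [d Hd].
  assert (m1 : m = 1%R).
  { destruct (Rlt_or_le m 1) as [L|]; [exfalso|lra].
    pose proof (cond_pos d) as Pd.
    set (t := Rmin 1 (m + d / 2)).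
    assert (Ht : (m < t <= 1 /\ t <= m + d / 2)%R).
    { unfold t. split. split. apply Rmin_glb_lt; lra. apply Rmin_l. apply Rmin_r. }
    assert (t <= m)%R; [|lra]. apply Hm1. split. lra.
    intros s Hs. destruct (Rlt_or_le s m) as [|G]. apply Pm; lra.
    apply Hd. lra. rewrite Rabs_pos_eq; lra. }
  intros t Ht. destruct (Rle_lt_or_eq_dec t 1 (proj2 Ht)) as [L| ->].
  apply Pm; lra. now rewrite <- m1.
Qed.

(** * The complex exponential, logarithm and cosine *)

Lemma Cexp_plus a b : Cexp (a + b) = Cexp a * Cexp b.
Proof.
unfold Cexp. apply injective_projections; cbn; unfold Re, Im; cbn;
  rewrite exp_plus; [rewrite cos_plus | rewrite sin_plus]; ring.
Qed.

Lemma Cexp_0 : Cexp 0 = 1.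
Proof.
unfold Cexp; cbn. rewrite exp_0, cos_0, sin_0. apply injective_projections; cbn; ring.
Qed.

Lemma Cexp_opp_r a : Cexp a * Cexp (- a) = 1.
Proof. rewrite <- Cexp_plus. replace (a + - a) with (RtoC 0) by ring. apply Cexp_0. Qed.

Lemma Cexp_neq_0 a : Cexp a <> 0.
Proof.
intros H. pose proof (Cexp_opp_r a) as E. rewrite H, Cmult_0_l in E.
apply C1_nz. now symmetry.
Qed.

Lemma Cexp_opp a : Cexp (- a) = / Cexp a.
Proof.
pose proof (Cexp_opp_r a) as E.
replace (Cexp (- a)) with ((Cexp a * Cexp (- a)) / Cexp a) by (field; apply Cexp_neq_0).
rewrite E. field. apply Cexp_neq_0.
Qed.

Lemma has_cderiv_Cexp z : has_cderiv Cexp z (Cexp z).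
Proof.
assert (D : forall (f : R -> R) (g : C -> R) d l,
  @filterdiff R_AbsRing C_R R_NormedModule g (locally z) l ->
  is_derive f (g z) d ->
  @filterdiff R_AbsRing C_R R_NormedModule (fun w => f (g w)) (locally z) (fun w => l w * d)%R).
{ intros f g d l Hg Hf.
  exact (@filterdiff_comp' R_AbsRing C_R R_NormedModule R_NormedModule g f z l _ Hg Hf). }
pose proof (D exp Re _ _ (filterdiff_Re z) (is_derive_exp (Re z))) as E.
pose proof (D cos Im _ _ (filterdiff_Im z) (is_derive_cos (Im z))) as Cs.
pose proof (D sin Im _ _ (filterdiff_Im z) (is_derive_sin (Im z))) as Sn.
pose proof (filterdiff_mult_fct (U := C_R) _ _ _ _ _ Rmult_comm E Cs) as A.
pose proof (filterdiff_mult_fct (U := C_R) _ _ _ _ _ Rmult_comm E Sn) as B.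
eapply has_rdiff_ext_lin. exact (has_rdiff_pair _ _ _ _ _ A B).
introC. unfold Cexp. ring_components.
Qed.

Lemma Csin2_Ccos2 z : Csin z * Csin z + Ccos z * Ccos z = 1.
Proof.
unfold Csin, Ccos. pose proof (Cexp_opp_r (Ci * z)) as E.
assert (I2 : Ci * Ci = - (1)) by (apply injective_projections; cbn; ring).
set (e := Cexp (Ci * z)) in *. set (f := Cexp (- (Ci * z))) in *.
replace ((e - f) / (2 * Ci) * ((e - f) / (2 * Ci)) + (e + f) / 2 * ((e + f) / 2))
  with ((e - f) * (e - f) / (4 * (Ci * Ci)) + (e + f) * (e + f) / 4) by (field; apply Ci_nz).
rewrite I2.
replace ((e - f) * (e - f) / (4 * - (1)) + (e + f) * (e + f) / 4) with (e * f) by field.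
exact E.
Qed.

Lemma has_cderiv_Cexp_scal (c z : C) : has_cderiv (fun w => Cexp (c * w)) z (c * Cexp (c * z)).
Proof.
eapply has_cderiv_ext_d.
apply (has_cderiv_chain (fun w => c * w) Cexp).
- apply (has_cderiv_mult (fun _ => c) (fun w => w)). apply has_cderiv_const. apply has_cderiv_id.
- apply has_cderiv_Cexp.
- cbn. ring.
Qed.

Lemma Ccos_alt z : Ccos z = (Cexp (Ci * z) + Cexp (- Ci * z)) / 2.
Proof. unfold Ccos. do 3 f_equal. ring. Qed.

Lemma Csin_alt z : Csin z = (Cexp (Ci * z) - Cexp (- Ci * z)) / (2 * Ci).
Proof. unfold Csin. do 3 f_equal. ring. Qed.

Lemma Ci2 : Ci * Ci = - (1).
Proof. apply injective_projections; cbn; ring. Qed.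

Lemma C2_nz : RtoC 2 <> 0.
Proof. intros E. apply RtoC_inj in E. lra. Qed.

Lemma Cmod_2 : Cmod 2 = 2%R.
Proof.
unfold Cmod; cbn. replace (2 * (2 * 1) + 0 * (0 * 1))%R with (2 * 2)%R by ring.
apply sqrt_square. lra.
Qed.

Lemma two_Ci_nz : 2 * Ci <> 0.
Proof. apply Cmult_neq_0. apply C2_nz. apply Ci_nz. Qed.

Lemma has_cderiv_Ccos z : has_cderiv Ccos z (- Csin z).
Proof.
apply (has_cderiv_ext_loc (fun w => (Cexp (Ci * w) + Cexp (- Ci * w)) * / 2)).
{ apply filter_forall. intros w. rewrite Ccos_alt. reflexivity. }
eapply has_cderiv_ext_d.
apply has_cderiv_mult. apply has_cderiv_plus; apply has_cderiv_Cexp_scal.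
apply has_cderiv_const.
cbn. rewrite Csin_alt.
unfold Cdiv. replace (/ (2 * Ci)) with (/ 2 * / Ci) by (field; apply Ci_nz).
rewrite Ci_inv. ring.
Qed.

Lemma has_cderiv_Csin z : has_cderiv Csin z (Ccos z).
Proof.
apply (has_cderiv_ext_loc (fun w => (Cexp (Ci * w) - Cexp (- Ci * w)) * / (2 * Ci))).
{ apply filter_forall. intros w. rewrite Csin_alt. reflexivity. }
eapply has_cderiv_ext_d.
apply has_cderiv_mult. apply has_cderiv_minus; apply has_cderiv_Cexp_scal.
apply has_cderiv_const.
cbn. rewrite Ccos_alt. field. apply Ci_nz.
Qed.

Lemma Cexp_inj_small z : Cexp z = 1 -> (Rabs (Im z) < 2 * PI)%R -> z = 0.
Proof.
destruct z as [a b]; unfold Cexp; cbn. intros E Hb.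
apply (f_equal fst) in E as E1. apply (f_equal snd) in E as E2. cbn in E1, E2.
pose proof (exp_pos a) as P. pose proof (sin2_cos2 b) as SC. unfold Rsqr in SC.
(* The squares of the two components add up to exp(a)^2 = 1. Then cos b = 1 gives sin(b/2) = 0, and
   |b/2| < pi. *)
assert (Ea : exp a = 1%R) by nra.
assert (a0 : a = 0%R). { apply exp_inv. now rewrite exp_0. }
assert (Ec : cos b = 1%R) by nra.
assert (Es : sin (b / 2) = 0%R).
{ replace b with (2 * (b / 2))%R in Ec by field. rewrite cos_2a_sin in Ec. nra. }
assert (b0 : b = 0%R).
{ destruct (Rtotal_order b 0) as [L|[L|L]]; [exfalso|exact L|exfalso].
  - rewrite Rabs_left in Hb by lra.
    assert (0 < sin (- (b / 2)))%R by (apply sin_gt_0; lra).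
    rewrite sin_neg in H. lra.
  - rewrite Rabs_pos_eq in Hb by lra.
    assert (0 < sin (b / 2))%R by (apply sin_gt_0; lra). lra. }
subst. reflexivity.
Qed.

(** The principal logarithm of the right half-plane. Elsewhere a logarithm is obtained by first
    dividing by a nearby value, which brings the argument close to 1. *)
Definition Clog (w : C) : C := (ln (Re w * Re w + Im w * Im w) / 2, atan (Im w / Re w))%R.

Lemma Cexp_Clog w : (0 < Re w)%R -> Cexp (Clog w) = w.
Proof.
destruct w as [a b]; unfold Clog, Cexp; cbn. intros Ha.
assert (P : (0 < a * a + b * b)%R) by nra.
assert (S : sqrt (1 + (b / a) ^ 2) = (sqrt (a * a + b * b) / a)%R).
{ replace (1 + (b / a) ^ 2)%R with ((a * a + b * b) / (a * a))%R by (field; lra).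
  rewrite sqrt_div_alt by nra. now rewrite sqrt_square by lra. }
assert (E : exp (ln (a * a + b * b) / 2) = sqrt (a * a + b * b)).
{ symmetry. apply sqrt_lem_1; [lra | left; apply exp_pos |].
  rewrite <- exp_plus. replace (ln (a * a + b * b) / 2 + ln (a * a + b * b) / 2)%R
    with (ln (a * a + b * b)) by field. now apply exp_ln. }
assert (Sp : (0 < sqrt (a * a + b * b))%R) by now apply sqrt_lt_R0.
rewrite E, cos_atan, sin_atan. unfold Rsqr.
replace (1 + b / a * (b / a))%R with (1 + (b / a) ^ 2)%R by ring. rewrite S.
apply injective_projections; cbn; field; lra.
Qed.

Lemma continuous_Clog w : (0 < Re w)%R -> @continuous C_UniformSpace C_UniformSpace Clog w.
Proof.
intros Hw.
pose proof (fun f (g : C -> R) d l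
  (Hg : @filterdiff R_AbsRing C_R R_NormedModule g (locally w) l)
  (Hf : is_derive f (g w) d) =>
  @filterdiff_comp' R_AbsRing C_R R_NormedModule R_NormedModule g f w l _ Hg Hf) as D.
pose proof (filterdiff_Re w) as R1. pose proof (filterdiff_Im w) as I1'.
pose proof (filterdiff_mult_fct (U := C_R) _ _ _ _ _ Rmult_comm R1 R1) as RR.
pose proof (filterdiff_mult_fct (U := C_R) _ _ _ _ _ Rmult_comm I1' I1') as II.
pose proof (filterdiff_plus_fct _ _ _ _ RR II) as N.
assert (Dl : is_derive (fun t => ln t / 2)%R (Re w * Re w + Im w * Im w)%R (/ (Re w * Re w + Im w
  * Im w) / 2)%R).
{ auto_derive. nra. field. nra. }
assert (Di : is_derive Rinv (Re w) (- / (Re w * Re w))%R).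
{ auto_derive. lra. field. lra. }
pose proof (D _ _ _ _ R1 Di) as IR.
pose proof (filterdiff_mult_fct (U := C_R) _ _ _ _ _ Rmult_comm I1' IR) as Q.
pose proof (D _ _ _ _ N Dl) as A.
pose proof (D _ _ _ _ Q (is_derive_atan _)) as B.
exact (has_rdiff_continuous _ _ _ (has_rdiff_pair _ _ _ _ _ A B)).
Qed.

Lemma Clog_1 : Clog 1 = 0.
Proof.
unfold Clog; cbn. replace (1 * 1 + 0 * 0)%R with 1%R by ring.
rewrite ln_1. unfold Rdiv. rewrite !Rmult_0_l, atan_0. reflexivity.
Qed.

(** Multiplication by -1, i or -i, all of them exponentials, brings a non-zero number into the right
    half-plane, where [Clog] is available. *)
Lemma Cexp_surj (z : C) : z <> 0 -> exists L, Cexp L = z.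
Proof.
intros Hz.
assert (P : Cexp (0, PI)%R = - (1)).
{ unfold Cexp; cbn. rewrite exp_0, cos_PI, sin_PI. apply injective_projections; cbn; ring. }
assert (P2 : Cexp (0, PI / 2)%R = Ci).
{ unfold Cexp; cbn. rewrite exp_0, cos_PI2, sin_PI2. apply injective_projections; cbn; ring. }
assert (H1 : forall w : C, (0 < Re w)%R -> exists L, Cexp L = w).
{ intros w Hw. exists (Clog w). now apply Cexp_Clog. }
assert (H2 : forall w : C, w <> 0 -> (0 <= Re w)%R -> exists L, Cexp L = w).
{ intros w N [Hw|Hw]; [now apply H1|].
  assert (K : Im w <> 0%R).
  { intros E. apply N. apply injective_projections; [now symmetry in Hw | exact E]. }
  destruct (Rtotal_order (Im w) 0) as [L|[L|L]]; [|contradiction|].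
  - destruct (H1 (Ci * w)) as [M HM]. cbn. unfold Im in L. lra.
    exists (M - (0, PI / 2)%R). unfold Cminus. rewrite Cexp_plus, HM, Cexp_opp, P2. field. apply
      Ci_nz.
  - destruct (H1 (- Ci * w)) as [M HM]. cbn. unfold Im in L. lra.
    exists (M + (0, PI / 2)%R). rewrite Cexp_plus, HM, P2.
    replace (- Ci * w * Ci) with (- (Ci * Ci) * w) by ring. rewrite Ci2. ring. }
destruct (Rle_or_lt 0 (Re z)) as [L|L]; [now apply H2|].
destruct (H2 (- z)) as [M HM].
- intros E. apply Hz. replace z with (- - z) by ring. rewrite E. ring.
- rewrite re_opp. lra.
- exists (M + (0, PI)%R). rewrite Cexp_plus, HM, P. ring.
Qed.

Lemma Csqrt_exists (z : C) : exists w, w * w = z.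
Proof.
destruct (Ceq_dec z 0) as [->|N]; [exists 0; ring|].
destruct (Cexp_surj z N) as [L HL]. exists (Cexp (L / 2)).
rewrite <- Cexp_plus. replace (L / 2 + L / 2) with L by field. exact HL.
Qed.

Lemma locally_Clog_small (eps : posreal) :
  exists d : posreal, forall w, (Cmod (w - 1) < d)%R -> (0 < Re w)%R /\ (Cmod (Clog w) < eps)%R.
Proof.
assert (P1 : (0 < Re 1)%R) by (cbn; lra).
pose proof (continuous_Clog 1 P1) as Hc.
assert (H : @locally C_UniformSpace (Clog 1) (fun v => (Cmod v < eps)%R)).
{ rewrite Clog_1. apply locally_C_iff. exists eps. intros w Hw.
  now replace (w - 0) with w in Hw by ring. }
specialize (Hc _ H). apply locally_C_iff in Hc. destruct Hc as [d Hd].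
assert (Q : (0 < Rmin d 1)%R) by (apply Rmin_glb_lt; [apply cond_pos | lra]).
exists (mkposreal _ Q). cbn. intros w Hw. split.
- pose proof (Rmin_r d 1). pose proof (re_le_Cmod (w - 1)) as T.
  destruct w as [a b]. cbn in *. apply Rabs_le_between in T. lra.
- apply Hd. pose proof (Rmin_l d 1). lra.
Qed.

Lemma Cexp_iz_quadratic z :
  Cexp (Ci * z) * Cexp (Ci * z) + 1 = 2 * Ccos z * Cexp (Ci * z).
Proof.
unfold Ccos. rewrite Cexp_opp. field. apply Cexp_neq_0.
Qed.

(* With e = exp (i n), solving cos n = v is solving e^2 - 2 v e + 1 = 0; at
   e0 = exp (i n0) this polynomial takes the value 2 e0 (cos n0 - v), so it has
   a root close to e0, even where sin n0 = 0. *)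
Lemma Ccos_open (n0 : C) (eps : posreal) :
  exists delta : posreal, forall v, (Cmod (v - Ccos n0) < delta)%R ->
    exists n, (Cmod (n - n0) < eps)%R /\ Ccos n = v.
Proof.
destruct (locally_Clog_small eps) as [d Hd].
set (e0 := Cexp (Ci * n0)). assert (N0 : e0 <> 0) by apply Cexp_neq_0.
assert (P0 : (0 < Cmod e0)%R) by now apply Cmod_gt_0.
pose proof (cond_pos d) as Pd.
assert (Q : (0 < d * d * Cmod e0 / 2)%R).
{ apply Rdiv_lt_0_compat; [repeat apply Rmult_lt_0_compat|]; lra. }
exists (mkposreal _ Q). cbn. intros v Hv.
destruct (Csqrt_exists (v * v - 1)) as [s Hs].
assert (K : forall e f, e * f = 1 -> e + f = 2 * v -> (Cmod (e0 - e) < d * Cmod e0)%R ->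
  exists n, (Cmod (n - n0) < eps)%R /\ Ccos n = v).
{ intros e f Hef Sef He.
  assert (Ne : e <> 0) by (intros ->; rewrite Cmult_0_l in Hef; apply C1_nz; now symmetry).
  destruct (Hd (e / e0)) as [H1 H2].
  - replace (e / e0 - 1) with ((- (e0 - e)) / e0) by (field; exact N0).
    rewrite Cmod_div, Cmod_opp by exact N0. apply (Rmult_lt_reg_r (Cmod e0)); [exact P0|].
    unfold Rdiv. rewrite Rmult_assoc, Rinv_l by lra. lra.
  - exists (n0 - Ci * Clog (e / e0)). split.
    + replace (n0 - Ci * Clog (e / e0) - n0) with (- (Ci * Clog (e / e0))) by ring.
      rewrite Cmod_opp, Cmod_mult.
      replace (Cmod Ci) with 1%R; [lra|]. unfold Cmod; cbn.
      replace (0 * (0 * 1) + 1 * (1 * 1))%R with 1%R by ring. now rewrite sqrt_1.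
    + assert (E : Cexp (Ci * (n0 - Ci * Clog (e / e0))) = e).
      { replace (Ci * (n0 - Ci * Clog (e / e0))) with (Ci * n0 + - (Ci * Ci) * Clog (e / e0)) by
        ring.
        rewrite Ci2. replace (- - (1) * Clog (e / e0)) with (Clog (e / e0)) by ring.
        rewrite Cexp_plus, Cexp_Clog by exact H1. fold e0. field. exact N0. }
      unfold Ccos. rewrite Cexp_opp, E.
      replace (/ e) with f. rewrite Sef. field.
      replace f with (e * f * / e) by (field; exact Ne). rewrite Hef. field. exact Ne. }
(* The roots are v + s and v - s, with product 1. The polynomial at e0 is the product of the
   differences from e0 to the roots, of modulus 2 |e0| |v - cos n0|; the choice of the radius makes
   this less than (d |e0|)^2, so one of the two factors is less than d |e0|. *)
assert (Pr : (Cmod (e0 - (v + s)) * Cmod (e0 - (v - s)) < (d * Cmod e0) * (d * Cmod e0))%R).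
{ rewrite <- Cmod_mult.
  replace ((e0 - (v + s)) * (e0 - (v - s))) with (- (2 * e0 * (v - Ccos n0))).
  - rewrite Cmod_opp, !Cmod_mult. rewrite Cmod_2.
    replace (d * Cmod e0 * (d * Cmod e0))%R with (2 * Cmod e0 * (d * d * Cmod e0 / 2))%R by field.
    apply Rmult_lt_compat_l; lra.
  - replace ((e0 - (v + s)) * (e0 - (v - s))) with (e0 * e0 - 2 * v * e0 + v * v - s * s) by ring.
    rewrite Hs. pose proof (Cexp_iz_quadratic n0) as E. fold e0 in E.
    replace (e0 * e0 - 2 * v * e0 + v * v - (v * v - 1)) with (e0 * e0 + 1 - 2 * v * e0) by ring.
    rewrite E. ring. }
assert (Vs : (v + s) * (v - s) = 1).
{ replace ((v + s) * (v - s)) with (v * v - s * s) by ring. rewrite Hs. ring. }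
destruct (Rlt_or_le (Cmod (e0 - (v + s))) (d * Cmod e0)) as [L|L].
- apply (K (v + s) (v - s)); [exact Vs | ring | exact L].
- apply (K (v - s) (v + s)); [now rewrite Cmult_comm | ring |].
  destruct (Rlt_or_le (Cmod (e0 - (v - s))) (d * Cmod e0)) as [M|M]; [exact M|exfalso].
  assert (0 < d * Cmod e0)%R by nra. nra.
Qed.

(** With a = exp(iy) and b = exp(iw), equality of cosines reads (a - b)(ab - 1) = 0. The case ab = 1
    would give sin((y + w)/2) = 0, impossible near [y0]; in the case a = b, closeness of y and w
    excludes a difference by a non-zero period. *)
Lemma Ccos_inj_local (y0 : C) : Csin y0 <> 0 ->
  exists delta : posreal, forall y w, (Cmod (y - y0) < delta)%R -> (Cmod (w - y0) < delta)%R ->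
    Ccos y = Ccos w -> y = w.
Proof.
intros N.
assert (H : @locally C_UniformSpace y0 (fun t => Csin t <> 0)).
{ pose proof (has_cderiv_continuous _ _ _ (has_cderiv_Csin y0)) as Hc.
  apply (Hc (fun v : C => v <> 0)). apply locally_C_iff.
  assert (P : (0 < Cmod (Csin y0))%R) by now apply Cmod_gt_0.
  exists (mkposreal _ P). intros w Hw E. cbn in Hw. rewrite E in Hw.
  replace (0 - Csin y0) with (- Csin y0) in Hw by ring. rewrite Cmod_opp in Hw. lra. }
apply locally_C_iff in H. destruct H as [d Hd].
assert (Q : (0 < Rmin d 1)%R) by (apply Rmin_glb_lt; [apply cond_pos | lra]).
exists (mkposreal _ Q). cbn. intros y w Hy Hw E.
pose proof (Rmin_l d 1). pose proof (Rmin_r d 1).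
set (h := (y + w) / 2).
assert (Nh : Csin h <> 0).
{ apply Hd. replace (h - y0) with (((y - y0) + (w - y0)) / 2) by (unfold h; field).
  rewrite Cmod_div by apply C2_nz. rewrite Cmod_2.
  pose proof (Cmod_triangle (y - y0) (w - y0)). lra. }
set (a := Cexp (Ci * y)). set (b := Cexp (Ci * w)).
assert (Na : a <> 0) by apply Cexp_neq_0. assert (Nb : b <> 0) by apply Cexp_neq_0.
assert (F : (a - b) * (a * b - 1) = 0).
{ unfold Ccos in E. rewrite !Cexp_opp in E. fold a b in E.
  replace ((a - b) * (a * b - 1)) with (2 * a * b * ((a + / a) / 2 - (b + / b) / 2)) by (field;
    auto).
  rewrite E. ring. }
assert (Nab : a * b - 1 <> 0).
{ intros Z. apply Nh. unfold Csin. rewrite Cexp_opp. set (e := Cexp (Ci * h)).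
  assert (Ne : e <> 0) by apply Cexp_neq_0.
  assert (Ee : e * e = a * b).
  { unfold e, a, b. rewrite <- !Cexp_plus. f_equal. unfold h. field. }
  replace ((e - / e) / (2 * Ci)) with ((e * e - 1) / (2 * Ci * e)).
  2: { field. split; [exact Ne | apply Ci_nz]. }
  rewrite Ee, Z. field. split; [exact Ne | apply Ci_nz]. }
assert (Eab : a = b).
{ destruct (Ceq_dec (a - b) 0) as [Z|Z]; [now apply Ceq_minus|].
  exfalso. exact (Cmult_neq_0 _ _ Z Nab F). }
assert (Z : Ci * (y - w) = 0).
{ apply Cexp_inj_small.
  - replace (Ci * (y - w)) with (Ci * y + - (Ci * w)) by ring.
    rewrite Cexp_plus, Cexp_opp. fold a b. rewrite Eab. field. exact Nb.
  - replace (Im (Ci * (y - w))) with (Re (y - w)) by (cbn; unfold Re; cbn; ring).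
    eapply Rle_lt_trans. apply re_le_Cmod.
    replace (y - w) with ((y - y0) + - (w - y0)) by ring.
    eapply Rle_lt_trans. apply Cmod_triangle. rewrite Cmod_opp.
    pose proof PI2_1. lra. }
apply Ceq_minus. destruct (Ceq_dec (y - w) 0) as [|M]; [assumption|].
exfalso. exact (Cmult_neq_0 _ _ Ci_nz M Z).
Qed.

(** Let x be the remainder of L. Continuity of L allows the expansion of exp at L z to be applied to
    L t; comparing it with that of phi bounds |phi z| |x| by eta (|L t - L z| + |t - z|). As |L t -
    L z| is at most |x| + |d| |t - z|, a choice of eta below |phi z|/2 absorbs the term in |x|, and
    the second bound on eta leaves eps |t - z|. *)
Lemma continuous_log_has_cderiv (phi L : C -> C) (z d : C) :
  @continuous C_UniformSpace C_UniformSpace L z ->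
  @locally C_UniformSpace z (fun t => Cexp (L t) = phi t) ->
  has_cderiv phi z (d * phi z) -> has_cderiv L z d.
Proof.
intros Hc HL Hphi. apply has_cderiv_iff. intros eps.
pose proof (locally_singleton _ _ HL) as EL. cbn in EL.
assert (N : phi z <> 0) by (rewrite <- EL; apply Cexp_neq_0).
assert (P : (0 < Cmod (phi z))%R) by now apply Cmod_gt_0.
pose proof (cond_pos eps) as Pe. pose proof (Cmod_ge_0 d) as Pd.
set (D := Cmod (phi z)) in *.
assert (Qe : (0 < Rmin (D / 2) (eps * D / (2 * (Cmod d + 1))))%R).
{ apply Rmin_glb_lt. lra. apply Rdiv_lt_0_compat; nra. }
set (eta := mkposreal _ Qe).
pose proof (proj1 (has_cderiv_iff _ _ _) Hphi eta) as A.
pose proof (Hc _ (proj1 (has_cderiv_iff _ _ _) (has_cderiv_Cexp (L z)) eta)) as B.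
unfold filtermap in B.
generalize (filter_and _ _ HL (filter_and _ _ A B)). apply filter_imp.
intros t [Et [At Bt]]. rewrite Et, EL in Bt.
set (x := L t - L z - d * (t - z)).
assert (T1 : (D * Cmod x <= eta * Cmod (L t - L z) + eta * Cmod (t - z))%R).
{ unfold D. rewrite <- Cmod_mult.
  replace (phi z * x) with ((phi t - phi z - d * phi z * (t - z)) + - (phi t - phi z - phi z * (L
    t - L z)))
    by (unfold x; ring).
  eapply Rle_trans. apply Cmod_triangle. rewrite Cmod_opp. lra. }
assert (T2 : (Cmod (L t - L z) <= Cmod x + Cmod d * Cmod (t - z))%R).
{ replace (L t - L z) with (x + d * (t - z)) by (unfold x; ring).
  eapply Rle_trans. apply Cmod_triangle. rewrite Cmod_mult. lra. }
assert (E1 : (eta <= D / 2)%R) by (unfold eta; cbn; apply Rmin_l).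
assert (E2 : (eta * (Cmod d + 1) <= eps * D / 2)%R).
{ assert (eta <= eps * D / (2 * (Cmod d + 1)))%R by (unfold eta; cbn; apply Rmin_r).
  replace (eps * D / 2)%R with (eps * D / (2 * (Cmod d + 1)) * (Cmod d + 1))%R by (field; lra).
  apply Rmult_le_compat_r; lra. }
pose proof (cond_pos eta) as Pn. pose proof (Cmod_ge_0 x) as Px. pose proof (Cmod_ge_0 (t - z))
  as Pt.
assert (T3 : (D / 2 * Cmod x <= eta * (Cmod d + 1) * Cmod (t - z))%R) by nra.
assert (T4 : (D / 2 * Cmod x <= eps * D / 2 * Cmod (t - z))%R) by nra.
apply (Rmult_le_reg_l (D / 2)); [lra|]. fold x. nra.
Qed.

Lemma locally_log (phi psi : C -> C) (z : C) :
  @locally C_UniformSpace z (fun t => has_cderiv phi t (psi t * phi t)) -> phi z <> 0 ->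
  exists L, @locally C_UniformSpace z (fun t => @continuous C_UniformSpace C_UniformSpace L t /\
    Cexp (L t) = phi t /\ has_cderiv L t (psi t)).
Proof.
intros H N. destruct (Cexp_surj _ N) as [L0 H0].
(* The quotient phi t / phi z is close to 1, hence in the half-plane of [Clog], and [L0] restores
   the factor phi z. *)
exists (fun t => L0 + Clog (phi t / phi z)).
assert (Hq : forall t, has_cderiv phi t (psi t * phi t) ->
  has_cderiv (fun t => phi t / phi z) t (psi t * phi t / phi z)).
{ intros t Ht. eapply has_cderiv_ext_d.
  apply has_cderiv_div; [exact N | exact Ht | apply has_cderiv_const]. cfield; exact N. }
assert (Pos : @locally C_UniformSpace z (fun t => (0 < Re (phi t / phi z))%R)).
{ apply (has_cderiv_continuous _ _ _ (Hq z (locally_singleton _ _ H)) (fun v : C => (0 < Re v)%R)).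
  unfold Cdiv. rewrite Cinv_r by exact N.
  apply locally_C_iff. exists (mkposreal 1 Rlt_0_1). cbn. intros w Hw.
  pose proof (re_le_Cmod (w - 1)) as T. apply Rabs_le_between in T.
  destruct w; cbn in *. lra. }
assert (A : @locally C_UniformSpace z (fun t => @continuous C_UniformSpace C_UniformSpace
    (fun t => L0 + Clog (phi t / phi z)) t /\ Cexp (L0 + Clog (phi t / phi z)) = phi t)).
{ generalize (filter_and _ _ H Pos). apply filter_imp. intros t [Ht Pt]. split.
  - apply (@continuous_plus C_UniformSpace R_AbsRing C_R (fun _ => L0)).
    apply continuous_const.
    apply (@continuous_comp C_UniformSpace C_UniformSpace C_UniformSpace (fun t => phi t / phi z)
      Clog).
    exact (has_cderiv_continuous _ _ _ (Hq t Ht)). now apply continuous_Clog.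
  - rewrite Cexp_plus, Cexp_Clog, H0 by exact Pt. field. exact N. }
generalize (filter_and _ _ H (locally_locally _ _ A)). apply filter_imp.
intros t [Ht At]. destruct (locally_singleton _ _ At) as [A1 A2].
split; [exact A1|]. split; [exact A2|].
apply (continuous_log_has_cderiv phi); [exact A1 | | exact Ht].
revert At. apply filter_imp. now intros u [_ Hu].
Qed.

(** * Functions smooth in the real sense *)

Notation rdiffC := (@rdiff C_R).

Lemma Cn_on_has_rdiff n U f z :
  Cn_on (S n) U f -> U z -> @has_rdiff C_R f z (rdiffC f z).
Proof. intros [H _] Uz. now apply (@rdifferentiable_rdiff C_R), H. Qed.

Lemma smooth_has_rdiff U f z :
  smooth_on U f -> U z -> @has_rdiff C_R f z (rdiffC f z).
Proof. intros H. apply (Cn_on_has_rdiff 0). exact (H 1%nat). Qed.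

Lemma smooth_rdiff U f v : smooth_on U f -> smooth_on U (fun z => rdiffC f z v).
Proof. intros H n. apply (H (S n)). Qed.

Lemma smooth_continuous U f z :
  smooth_on U f -> U z -> @continuous C_UniformSpace C_UniformSpace f z.
Proof. intros H. exact (H 0%nat z). Qed.

Lemma Cn_on_incl n (U V : C -> Prop) f :
  (forall z, V z -> U z) -> Cn_on n U f -> Cn_on n V f.
Proof.
intros I. revert f. induction n as [|n IH]; intros f; cbn.
- intros H z Vz. now apply H, I.
- intros [H1 H2]. split.
  + intros z Vz. now apply H1, I.
  + intros v. now apply IH.
Qed.

Lemma smooth_incl (U V : C -> Prop) f :
  (forall z, V z -> U z) -> smooth_on U f -> smooth_on V f.
Proof. intros I H n. now apply (Cn_on_incl n U). Qed.

Lemma rdiff_Cconj {V : RMod} (f : V -> C) p v :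
  rdiff (fun q => Cconj (f q)) p v = Cconj (rdiff f p v).
Proof.
unfold rdiff, Cconj; cbn. apply injective_projections; cbn; [reflexivity|].
apply (Derive_opp (fun t => Im (f (plus p (scal t v))))).
Qed.

Lemma Cn_on_conj n U f : Cn_on n U f -> Cn_on n U (fun z => Cconj (f z)).
Proof.
revert f. induction n as [|n IH]; intros f.
- intros H z Uz.
  apply (@continuous_comp C_UniformSpace C_UniformSpace C_UniformSpace f Cconj).
  now apply H.
  exact (has_rdiff_continuous _ _ _ (has_rdiff_conj _ _ _ (has_rdiff_id (f z)))).
- intros [H1 H2]. split.
  + intros z Uz. destruct (H1 z Uz) as [l Hl]. eexists. exact (has_rdiff_conj _ _ _ Hl).
  + intros v.
    refine (eq_ind_r (Cn_on n U) (IH _ (H2 v)) _).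
    apply functional_extensionality. intros z.
    apply (@rdiff_Cconj C_R).
Qed.

Lemma smooth_conj U f : smooth_on U f -> smooth_on U (fun z => Cconj (f z)).
Proof. intros H n. now apply Cn_on_conj. Qed.

(** * Symmetry of second real derivatives *)

Section Schwarz.
Variables (U : C -> Prop) (f : C -> C).
Hypotheses (HU : openC U) (Hf : Cn_on 2 U f).
Variables (z a b : C) (pi : C -> R).
Hypotheses (Uz : U z) (Hpi : @is_linear R_AbsRing C_R R_NormedModule pi).

Let pt (s t : R) : C := z + (RtoC s * a + RtoC t * b).

Lemma has_rdiff_Rmult (c : C) (t : R) :
  @has_rdiff R_NormedModule (fun s => RtoC s * c) t (fun s => RtoC s * c).
Proof.
pose proof (@filterdiff_line C_R (RtoC 0) c t) as H.
eapply has_rdiff_ext_lin.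
- eapply has_rdiff_ext; [|exact H]. intros s. cbn beta.
  rewrite scal_R_Cmult. apply Cplus_0_l.
- intros s. apply scal_R_Cmult.
Qed.

Lemma pt_continuous (s t : R) (P : C -> Prop) :
  @locally C_UniformSpace (pt s t) P -> locally_2d (fun u v => P (pt u v)) s t.
Proof.
intros H. apply locally_2d_locally.
assert (Hc : @continuous (prod_UniformSpace R_UniformSpace R_UniformSpace) C_UniformSpace
    (fun u => pt (fst u) (snd u)) (s, t)).
{ unfold pt. apply (@has_rdiff_continuous (prod_NormedModule R_AbsRing R_NormedModule
  R_NormedModule))
    with (l := fun u => 0 + (RtoC (fst u) * a + RtoC (snd u) * b)).
  apply has_rdiff_plus; [apply has_rdiff_const|]. apply has_rdiff_plus.
  - apply (@has_rdiff_comp (prod_NormedModule R_AbsRing R_NormedModule R_NormedModule)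
      R_NormedModule fst (fun r => RtoC r * a) (s, t) fst (fun r => RtoC r * a)).
    apply filterdiff_linear, is_linear_fst. apply has_rdiff_Rmult.
  - apply (@has_rdiff_comp (prod_NormedModule R_AbsRing R_NormedModule R_NormedModule)
      R_NormedModule snd (fun r => RtoC r * b) (s, t) snd (fun r => RtoC r * b)).
    apply filterdiff_linear, is_linear_snd. apply has_rdiff_Rmult. }
exact (Hc P H).
Qed.

Lemma is_derive_pi (c : R -> C) (t : R) (v : C) (g : C -> C) l :
  @has_rdiff R_NormedModule c t (fun s => RtoC s * v) ->
  @has_rdiff C_R g (c t) l ->
  is_derive (fun s => pi (g (c s))) t (pi (l v)).
Proof.
intros Hc Hg.
pose proof (@has_rdiff_comp R_NormedModule C_R c g t _ _ Hc Hg) as H.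
pose proof (@filterdiff_comp' R_AbsRing R_NormedModule C_R R_NormedModule _ pi t _ pi H
  (filterdiff_linear _ Hpi)) as K.
eapply filterdiff_ext_lin. exact K.
intros s. cbn beta. rewrite <- scal_R_Cmult, (linear_scal _ (has_rdiff_is_linear _ _ _ Hg)).
apply (linear_scal _ Hpi).
Qed.

Lemma is_derive_pt_t (s t : R) (g : C -> C) l :
  @has_rdiff C_R g (pt s t) l ->
  is_derive (fun t' => pi (g (pt s t'))) t (pi (l b)).
Proof.
intros Hg. apply is_derive_pi; [|exact Hg]. unfold pt.
eapply has_rdiff_ext_lin.
- apply has_rdiff_plus; [apply has_rdiff_const|].
  apply has_rdiff_plus; [apply has_rdiff_const | apply has_rdiff_Rmult].
- intros r. cbn beta. ring.
Qed.

Lemma is_derive_pt_s (s t : R) (g : C -> C) l :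
  @has_rdiff C_R g (pt s t) l ->
  is_derive (fun s' => pi (g (pt s' t))) s (pi (l a)).
Proof.
intros Hg. apply is_derive_pi; [|exact Hg]. unfold pt.
eapply has_rdiff_ext_lin.
- apply has_rdiff_plus; [apply has_rdiff_const|].
  apply has_rdiff_plus; [apply has_rdiff_Rmult | apply has_rdiff_const].
- intros r. cbn beta. ring.
Qed.

(** Both sides are mixed second partial derivatives at the origin of the real function pi(f(z + s a
    + t b)) of s and t, where [pi] will be the real or the imaginary part. The continuity that
    Schwarz's theorem requires is the last level of [Cn_on 2]. *)
Lemma rdiff_sym_pi :
  pi (rdiffC (fun w => rdiffC f w b) z a) = pi (rdiffC (fun w => rdiffC f w a) z b).
Proof.
destruct Hf as [Hf1 Hf2].
assert (D0 : forall w, U w -> @has_rdiff C_R f w (rdiffC f w)).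
{ intros w. exact (Cn_on_has_rdiff 1 U f w Hf). }
assert (D1 : forall v w, U w -> @has_rdiff C_R (fun w => rdiffC f w v) w
  (rdiffC (fun w => rdiffC f w v) w)).
{ intros v w. exact (Cn_on_has_rdiff 0 U _ w (Hf2 v)). }
assert (p0 : pt 0 0 = z) by (unfold pt; ring).
assert (Hloc : forall s t, U (pt s t) -> locally_2d (fun u v => U (pt u v)) s t).
{ intros s t Hst. apply pt_continuous. now apply HU. }
assert (U0 : U (pt 0 0)) by now rewrite p0.
set (F := fun s t => pi (f (pt s t))).
assert (Dt : forall s t, U (pt s t) -> is_derive (fun t' => F s t') t (pi (rdiffC f (pt s t) b))).
{ intros s t Hst. exact (is_derive_pt_t s t f _ (D0 _ Hst)). }
assert (Ds : forall s t, U (pt s t) -> is_derive (fun s' => F s' t) s (pi (rdiffC f (pt s t) a))).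
{ intros s t Hst. exact (is_derive_pt_s s t f _ (D0 _ Hst)). }
assert (Dts : forall s t, U (pt s t) ->
  is_derive (fun s' => Derive (fun t' => F s' t') t) s (pi (rdiffC (fun w => rdiffC f w b) (pt s
    t) a))).
{ intros s t Hst.
  apply (is_derive_ext_loc (fun s' => pi (rdiffC f (pt s' t) b))).
  - generalize (locally_2d_1d_const_y _ _ _ (Hloc _ _ Hst)). apply filter_imp.
    intros s' Hs'. symmetry. apply is_derive_unique. now apply Dt.
  - exact (is_derive_pt_s s t _ _ (D1 b _ Hst)). }
assert (Dst : forall s t, U (pt s t) ->
  is_derive (fun t' => Derive (fun s' => F s' t') s) t (pi (rdiffC (fun w => rdiffC f w a) (pt s
    t) b))).
{ intros s t Hst.
  apply (is_derive_ext_loc (fun t' => pi (rdiffC f (pt s t') a))).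
  - generalize (locally_2d_1d_const_x _ _ _ (Hloc _ _ Hst)). apply filter_imp.
    intros t' Ht'. symmetry. apply is_derive_unique. now apply Ds.
  - exact (is_derive_pt_t s t _ _ (D1 a _ Hst)). }
assert (Cont : forall v w, continuity_2d_pt (fun s t => pi (rdiffC (fun w' => rdiffC f w' v) (pt
  s t) w)) 0 0).
{ intros v w. apply continuity_2d_pt_filterlim.
  pose proof (proj2 (Hf2 v) w _ U0) as K.
  pose proof (@filterdiff_continuous R_AbsRing C_R R_NormedModule pi
    (rdiffC (fun w' => rdiffC f w' v) (pt 0 0) w)) as K2.
  intros P HP.
  apply (proj1 (locally_2d_locally (fun s t => P (pi (rdiffC (fun w' => rdiffC f w' v) (pt s t)
    w))) 0 0)).
  apply (pt_continuous 0 0 (fun u => P (pi (rdiffC (fun w' => rdiffC f w' v) u w)))).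
  refine (K (fun y : C => P (pi y)) _). refine (K2 _ P HP).
  exists pi. now apply filterdiff_linear. }
rewrite <- p0.
transitivity (Derive (fun s => Derive (fun t => F s t) 0) 0).
symmetry. exact (is_derive_unique _ _ _ (Dts 0%R 0%R U0)).
transitivity (Derive (fun t => Derive (fun s => F s t) 0) 0).
2: exact (is_derive_unique _ _ _ (Dst 0%R 0%R U0)).
apply Schwarz.
- generalize (Hloc _ _ U0). apply locally_2d_impl. apply locally_2d_forall. intros s t Hst.
  split; [eexists; exact (Ds s t Hst)|]. split; [eexists; exact (Dt s t Hst)|].
  split; [eexists; exact (Dts s t Hst) | eexists; exact (Dst s t Hst)].
- refine (continuity_2d_pt_ext_loc _ _ _ _ _ (Cont b a)).
  generalize (Hloc _ _ U0). apply locally_2d_impl. apply locally_2d_forall. intros s t Hst.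
  symmetry. apply is_derive_unique. now apply Dts.
- refine (continuity_2d_pt_ext_loc _ _ _ _ _ (Cont a b)).
  generalize (Hloc _ _ U0). apply locally_2d_impl. apply locally_2d_forall. intros s t Hst.
  symmetry. apply is_derive_unique. now apply Dst.
Qed.
End Schwarz.

Lemma rdiff_sym (U : C -> Prop) (f : C -> C) (z a b : C) :
  openC U -> smooth_on U f -> U z ->
  rdiffC (fun w => rdiffC f w b) z a = rdiffC (fun w => rdiffC f w a) z b.
Proof.
intros HU Hf Uz. apply injective_projections.
- apply (rdiff_sym_pi U f HU (Hf 2%nat) z a b Re Uz). apply is_linear_fst.
- apply (rdiff_sym_pi U f HU (Hf 2%nat) z a b Im Uz). apply is_linear_snd.
Qed.

(** * Wirtinger derivatives and the Cauchy-Riemann equations *)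

Definition dz (f : C -> C) (z : C) : C := (rdiffC f z (RtoC 1) - Ci * rdiffC f z Ci) / 2.
Definition dzbar (f : C -> C) (z : C) : C := (rdiffC f z (RtoC 1) + Ci * rdiffC f z Ci) / 2.

Lemma dz_conj f z : dz (fun w => Cconj (f w)) z = Cconj (dzbar f z).
Proof.
unfold dz, dzbar.
assert (K : forall v : C, rdiffC (fun w : C => Cconj (f w)) z v = Cconj (rdiffC f z v))
  by exact (@rdiff_Cconj C_R f z).
rewrite !K.
rewrite Cdiv_conj, Cplus_conj, Cmult_conj by apply C2_nz.
replace (Cconj 2) with (RtoC 2) by (apply injective_projections; cbn; ring).
replace (Cconj Ci) with (- Ci) by (apply injective_projections; cbn; ring).
field.
Qed.

Lemma linear_C_decomp (l : C -> C) (v : C) :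
  @is_linear R_AbsRing C_R C_R l ->
  l v = (l 1 - Ci * l Ci) / 2 * v + (l 1 + Ci * l Ci) / 2 * Cconj v.
Proof.
intros Hl. destruct v as [x y].
pose proof (@linear_scal R_AbsRing C_R C_R l Hl x (RtoC 1)) as E1.
pose proof (@linear_scal R_AbsRing C_R C_R l Hl y Ci) as E2.
pose proof (@linear_plus R_AbsRing C_R C_R l Hl (RtoC x * 1) (RtoC y * Ci)) as E.
rewrite !scal_R_Cmult in E1, E2.
change (l (RtoC x * 1 + RtoC y * Ci) = l (RtoC x * 1) + l (RtoC y * Ci)) in E.
rewrite E1, E2 in E.
replace (x, y) with (x * 1 + y * Ci) by (apply injective_projections; cbn; ring).
transitivity (x * l 1 + y * l Ci); [exact E|].
replace (Cconj (x * 1 + y * Ci)) with (x * 1 - y * Ci) by (apply injective_projections; cbn; ring).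
replace ((l 1 - Ci * l Ci) / 2 * (x * 1 + y * Ci) + (l 1 + Ci * l Ci) / 2 * (x * 1 - y * Ci))
  with (x * l 1 - (Ci * Ci) * (y * l Ci)) by field.
rewrite Ci2. ring.
Qed.

Lemma smooth_rdiff_decomp U f z v :
  smooth_on U f -> U z -> rdiffC f z v = dz f z * v + dzbar f z * Cconj v.
Proof.
intros Hf Uz. apply linear_C_decomp.
exact (has_rdiff_is_linear _ _ _ (smooth_has_rdiff U f z Hf Uz)).
Qed.

(** The Cauchy-Riemann equations in the form df/dy = i df/dx. Smoothness is part of the definition
    so that derivatives of all orders are at hand. *)
Definition hol (W : C -> Prop) (f : C -> C) : Prop :=
  smooth_on W f /\ forall z, W z -> rdiffC f z Ci = Ci * rdiffC f z (RtoC 1).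

Definition Cder (f : C -> C) (z : C) : C := rdiffC f z (RtoC 1).

Lemma hol_has_cderiv W f z : hol W f -> W z -> has_cderiv f z (Cder f z).
Proof.
intros [Hf CR] Wz. eapply has_rdiff_ext_lin. exact (smooth_has_rdiff W f z Hf Wz).
introC. rewrite (smooth_rdiff_decomp W f z v Hf Wz). unfold dz, dzbar, Cder. rewrite (CR z Wz).
replace ((rdiffC f z (RtoC 1) - Ci * (Ci * rdiffC f z (RtoC 1))) / 2 * v + (rdiffC f z (RtoC 1) +
  Ci * (Ci * rdiffC f z (RtoC 1))) / 2 * Cconj v)
 with ((rdiffC f z (RtoC 1) - (Ci * Ci) * rdiffC f z (RtoC 1)) / 2 * v + (rdiffC f z (RtoC 1) +
   (Ci * Ci) * rdiffC f z (RtoC 1)) / 2 * Cconj v) by field.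
rewrite Ci2. field.
Qed.

(** Write f_x and f_y for the derivatives along 1 and i. Then (f_x)_y = (f_y)_x by symmetry, and f_y
    = i f_x makes this i (f_x)_x. *)
Lemma hol_Cder W f : openC W -> hol W f -> hol W (Cder f).
Proof.
intros HW [Hf CR]. split. now apply smooth_rdiff.
intros z Wz. unfold Cder.
etransitivity. exact (rdiff_sym W f z Ci (RtoC 1) HW Hf Wz).
assert (L : @locally C_UniformSpace z W) by now apply HW.
apply (@has_rdiff_eq C_R (fun w => rdiffC f w Ci) (fun w => Ci * rdiffC f w (RtoC 1)) z
  (rdiffC (fun w => rdiffC f w Ci) z) (fun v => Ci * rdiffC (fun w => rdiffC f w (RtoC 1)) z v)).
- revert L. apply filter_imp. exact CR.
- exact (smooth_has_rdiff _ _ z (smooth_rdiff W f Ci Hf) Wz).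
- apply has_rdiff_cmult_l. exact (smooth_has_rdiff _ _ z (smooth_rdiff W f (RtoC 1) Hf) Wz).
Qed.

(** * Branches of powers *)

Notation has_rdiff3 := (@has_rdiff C3_R).
Notation locally3 := (@locally C3_R).
Notation locallyC := (@locally C_UniformSpace).
Notation continuousC := (@continuous C_UniformSpace C_UniformSpace).
Notation continuous3 := (@continuous C3_R C_UniformSpace).

Lemma neq_locally {T : UniformSpace} (h : T -> C) p (c : C) :
  @continuous T C_UniformSpace h p -> h p <> c -> locally p (fun q => h q <> c).
Proof.
intros Hc N. apply (Hc (fun v : C => v <> c)). apply locally_C_iff.
assert (P : (0 < Cmod (h p - c))%R) by (apply Cmod_gt_0; now apply Cminus_eq_contra).
exists (mkposreal _ P). intros w Hw E. cbn in Hw. rewrite E in Hw.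
replace (c - h p) with (- (h p - c)) in Hw by ring. rewrite Cmod_opp in Hw. lra.
Qed.

Lemma continuous_Cmult {T : UniformSpace} (h k : T -> C) p :
  @continuous T C_UniformSpace h p -> @continuous T C_UniformSpace k p ->
  @continuous T C_UniformSpace (fun q => h q * k q) p.
Proof.
intros Hh Hk.
assert (M : @filterlim (C * C) C (fun z => fst z * snd z)
  (@locally (prod_UniformSpace C_UniformSpace C_UniformSpace) (h p, k p)) (locallyC (h p * k p))).
{ pose proof (@has_rdiff_mult (prod_NormedModule R_AbsRing C_R C_R) fst snd (h p, k p) fst snd)
  as H.
  exact (has_rdiff_continuous _ _ _ (H
    (@filterdiff_linear R_AbsRing (prod_NormedModule R_AbsRing C_R C_R) C_R _ fst is_linear_fst)
    (@filterdiff_linear R_AbsRing (prod_NormedModule R_AbsRing C_R C_R) C_R _ snd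
      is_linear_snd))). }
exact (@continuous_comp_2 T C_UniformSpace C_UniformSpace C_UniformSpace h k Cmult p Hh Hk M).
Qed.

Lemma continuous_Cplus {T : UniformSpace} (h k : T -> C) p :
  @continuous T C_UniformSpace h p -> @continuous T C_UniformSpace k p ->
  @continuous T C_UniformSpace (fun q => h q + k q) p.
Proof. exact (@continuous_plus T R_AbsRing C_R h k p). Qed.

Lemma continuous_Copp {T : UniformSpace} (h : T -> C) p :
  @continuous T C_UniformSpace h p -> @continuous T C_UniformSpace (fun q => - h q) p.
Proof. exact (@continuous_opp T R_AbsRing C_R h p). Qed.

Lemma continuous_Cconst {T : UniformSpace} (c : C) (p : T) :
  @continuous T C_UniformSpace (fun _ => c) p.
Proof. exact (@continuous_const T C_UniformSpace c p). Qed.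

Lemma continuous_Ccomp {T : UniformSpace} (h : T -> C) (k : C -> C) p :
  @continuous T C_UniformSpace h p -> continuousC k (h p) ->
  @continuous T C_UniformSpace (fun q => k (h q)) p.
Proof. exact (@continuous_comp T C_UniformSpace C_UniformSpace h k p). Qed.

Lemma smooth_continuous_dz U f z : smooth_on U f -> U z -> continuousC (dz f) z.
Proof.
intros Hf Uz. unfold dz, Cdiv, Cminus.
apply (@continuous_Cmult C_UniformSpace); [|apply (@continuous_Cconst C_UniformSpace)].
apply (@continuous_Cplus C_UniformSpace).
- exact (smooth_continuous U _ z (smooth_rdiff U f (RtoC 1) Hf) Uz).
- apply (@continuous_Copp C_UniformSpace).
  apply (@continuous_Cmult C_UniformSpace); [apply (@continuous_Cconst C_UniformSpace)|].
  exact (smooth_continuous U _ z (smooth_rdiff U f Ci Hf) Uz).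
Qed.

Lemma smooth_continuous_dzbar U f z : smooth_on U f -> U z -> continuousC (dzbar f) z.
Proof.
intros Hf Uz. unfold dzbar, Cdiv.
apply (@continuous_Cmult C_UniformSpace); [|apply (@continuous_Cconst C_UniformSpace)].
apply (@continuous_Cplus C_UniformSpace).
- exact (smooth_continuous U _ z (smooth_rdiff U f (RtoC 1) Hf) Uz).
- apply (@continuous_Cmult C_UniformSpace); [apply (@continuous_Cconst C_UniformSpace)|].
  exact (smooth_continuous U _ z (smooth_rdiff U f Ci Hf) Uz).
Qed.

Lemma nonconstant_rdiff (U : C -> Prop) f z (d : posreal) :
  openC U -> smooth_on U f -> U z -> ~ constant_near f z ->
  exists w, (Cmod (w - z) < d)%R /\ (dz f w <> 0 \/ dzbar f w <> 0).
Proof.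
intros HU Hf Uz N. apply NNPP. intros NE. apply N.
apply (@has_rdiff_0_locally_const C_R f z).
assert (B : locallyC z (fun w => (Cmod (w - z) < d)%R)) by (apply locally_C_iff; now exists d).
generalize (filter_and _ _ (HU z Uz) B). apply filter_imp. intros w [Uw Bw].
eapply has_rdiff_ext_lin. exact (smooth_has_rdiff U f w Hf Uw).
intros v. rewrite (smooth_rdiff_decomp U f w v Hf Uw).
destruct (Ceq_dec (dz f w) 0) as [E1|E1]; [|exfalso; apply NE; exists w; auto].
destruct (Ceq_dec (dzbar f w) 0) as [E2|E2]; [|exfalso; apply NE; exists w; auto].
rewrite E1, E2. cring.
Qed.

(** Taking x and y among 1 and i gives four equations whose signs form an invertible system. It will
    split the closedness condition into its holomorphic, mixed and antiholomorphic components. *)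
Lemma bilinear_coefs (a b c d : C) :
  (forall x y : C, a * x * y + b * x * Cconj y + c * Cconj x * y + d * Cconj x * Cconj y = 0) ->
  a = 0 /\ b = 0 /\ c = 0 /\ d = 0.
Proof.
intros H.
assert (C1 : Cconj 1 = 1) by (apply injective_projections; cbn; ring).
assert (CI : Cconj Ci = - Ci) by (apply injective_projections; cbn; ring).
pose proof (H 1 1) as H1. pose proof (H Ci Ci) as H2. pose proof (H 1 Ci) as H3. pose proof (H Ci
  1) as H4.
rewrite C1 in *. rewrite CI in *.
assert (K2 : - a + b + c - d = 0).
{ rewrite <- H2. replace (a * Ci * Ci + b * Ci * - Ci + c * - Ci * Ci + d * - Ci * - Ci) with ((a
  - b - c + d) * (Ci * Ci)) by ring.
  rewrite Ci2. ring. }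
assert (K3 : a - b + c - d = 0).
{ replace (a - b + c - d) with (- (Ci * Ci) * (a - b + c - d)) by (rewrite Ci2; ring).
  replace (- (Ci * Ci) * (a - b + c - d)) with (- Ci * (a * 1 * Ci + b * 1 * - Ci + c * 1 * Ci +
    d * 1 * - Ci)) by ring.
  rewrite H3. ring. }
assert (K4 : a + b - c - d = 0).
{ replace (a + b - c - d) with (- (Ci * Ci) * (a + b - c - d)) by (rewrite Ci2; ring).
  replace (- (Ci * Ci) * (a + b - c - d)) with (- Ci * (a * Ci * 1 + b * Ci * 1 + c * - Ci * 1 +
    d * - Ci * 1)) by ring.
  rewrite H4. ring. }
assert (K1 : a + b + c + d = 0) by (rewrite <- H1; ring).
repeat split.
- replace a with (((a + b + c + d) - (- a + b + c - d) + (a - b + c - d) + (a + b - c - d)) / 4)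
    by field.
  rewrite K1, K2, K3, K4. field.
- replace b with (((a + b + c + d) + (- a + b + c - d) - (a - b + c - d) + (a + b - c - d)) / 4)
    by field.
  rewrite K1, K2, K3, K4. field.
- replace c with (((a + b + c + d) + (- a + b + c - d) + (a - b + c - d) - (a + b - c - d)) / 4)
    by field.
  rewrite K1, K2, K3, K4. field.
- replace d with (((a + b + c + d) - (- a + b + c - d) - (a - b + c - d) - (a + b - c - d)) / 4)
    by field.
  rewrite K1, K2, K3, K4. field.
Qed.

Ltac ring_from H :=
  match type of H with ?a = ?b => transitivity a; [ring | rewrite H; ring] end.
Ltac ring_diff H :=
  match type of H with ?a = ?b => transitivity (a - b); [ring | rewrite H; ring] end.
Ltac ring_diff_rev H :=
  match type of H with ?a = ?b => transitivity (b - a); [ring | rewrite H; ring] end.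

Lemma Cmult_integral (a b : C) : a * b = 0 -> a = 0 \/ b = 0.
Proof.
intros H. destruct (Ceq_dec a 0) as [E|E]; [now left|].
destruct (Ceq_dec b 0) as [F|F]; [now right|]. exfalso. exact (Cmult_neq_0 a b E F H).
Qed.

Lemma Cmult_reg_l (a b c : C) : a <> 0 -> a * b = a * c -> b = c.
Proof.
intros N H. apply Ceq_minus. destruct (Cmult_integral a (b - c)) as [E|E]; [|contradiction|exact E].
replace (a * (b - c)) with (a * b - a * c) by ring. rewrite H. ring.
Qed.

Lemma exists_third (i j : index3) : i <> j -> exists k, k <> i /\ k <> j.
Proof.
intros H. destruct i, j; try congruence;
  first [exists I1; split; congruence | exists I2; split; congruence | exists I3; split;
    congruence].
Qed.

Lemma exists_other (i : index3) : exists j, i <> j.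
Proof. destruct i; [exists I2 | exists I1 | exists I1]; congruence. Qed.

Lemma sum3_single (F : index3 -> C) (i : index3) :
  (forall j, j <> i -> F j = 0) -> sum3 F = F i.
Proof.
intros H. unfold sum3. destruct i.
- rewrite (H I2), (H I3) by congruence. ring.
- rewrite (H I1), (H I3) by congruence. ring.
- rewrite (H I1), (H I2) by congruence. ring.
Qed.

Lemma has_rdiff_sum3 {V : RMod} (F : index3 -> V -> C) (p : V) l :
  (forall i, has_rdiff (F i) p (l i)) ->
  has_rdiff (fun q => sum3 (fun i => F i q)) p (fun v => sum3 (fun i => l i v)).
Proof.
intros H. unfold sum3. apply has_rdiff_plus; [apply has_rdiff_plus|]; apply H.
Qed.

Lemma sum3_ext (F G : index3 -> C) : (forall i, F i = G i) -> sum3 F = sum3 G.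
Proof. intros H. unfold sum3. now rewrite !H. Qed.

Lemma has_cderiv_rdiff h z d (v : C) : has_cderiv h z d -> rdiffC h z v = d * v.
Proof. exact (@has_rdiff_rdiff C_R h z _ v). Qed.

(** The equation h' = lam psi h says that h exp(-lam L) has zero derivative when L is a logarithm of
    phi, so it is locally a constant k. *)
Lemma local_power (W : C -> Prop) (phi psi h : C -> C) (lam z : C) :
  openC W -> W z ->
  (forall t, W t -> phi t <> 0 /\ has_cderiv phi t (psi t * phi t)) ->
  (forall t, W t -> h t <> 0 /\ has_cderiv h t (lam * psi t * h t)) ->
  exists (L : C -> C) (k : C), k <> 0 /\ locallyC z (fun t =>
    continuousC L t /\ Cexp (L t) = phi t /\ h t = k * Cexp (lam * L t)).
Proof.
intros HW Wz Hphi Hh.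
destruct (locally_log phi psi z) as [L HL]; [|now apply Hphi|].
{ generalize (HW z Wz). apply filter_imp. intros t Wt. now apply Hphi. }
exists L, (h z * Cexp (- lam * L z)). split.
{ apply Cmult_neq_0; [now apply Hh | apply Cexp_neq_0]. }
assert (K : locallyC z (fun t => h t * Cexp (- lam * L t) = h z * Cexp (- lam * L z))).
{ apply (@has_rdiff_0_locally_const C_R (fun t => h t * Cexp (- lam * L t)) z).
  generalize (filter_and _ _ HL (HW z Wz)). apply filter_imp. intros t [[_ [_ DL]] Wt].
  eapply has_rdiff_ext_lin.
  - apply (@has_rdiff_mult C_R).
    + exact (proj2 (Hh t Wt)).
    + exact (has_cderiv_comp _ Cexp t _ _ (has_rdiff_cmult_l (- lam) _ _ _ DL) (has_cderiv_Cexp _)).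
  - introC. ring. }
generalize (filter_and _ _ HL K). apply filter_imp. intros t [[CL [EL _]] Kt].
split; [exact CL|]. split; [exact EL|]. rewrite <- Kt.
transitivity (h t * (Cexp (- lam * L t) * Cexp (lam * L t))); [|ring].
rewrite <- Cexp_plus. replace (- lam * L t + lam * L t) with (RtoC 0) by ring.
rewrite Cexp_0. ring.
Qed.

(** Locally h is a constant times a branch of phi^lam; c is that constant at the base point, and
    connectedness carries the normalisation along each coordinate. Since the coordinates [Z i] agree
    at p0, the same c works on all three images. *)
Lemma power_branch_exists (Omega : C3 -> Prop) (Z : index3 -> C3 -> C)
  (phi psi h : C -> C) (lam : C) (p0 : C3) :
  openC3 Omega -> connected_open Omega ->
  (forall i p, Omega p -> continuous3 (Z i) p) ->
  Omega p0 -> (forall i j, Z i p0 = Z j p0) ->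
  openC (values Omega Z) ->
  (forall t, values Omega Z t -> phi t <> 0 /\ has_cderiv phi t (psi t * phi t)) ->
  (forall t, values Omega Z t -> h t <> 0 /\ has_cderiv h t (lam * psi t * h t)) ->
  exists c : C, c <> 0 /\ power_branch (values Omega Z) phi lam (fun t => h t / c).
Proof.
intros Ho Hc HZ Hp0 H0 HW Hphi Hh.
assert (Wi : forall i p, Omega p -> values Omega Z (Z i p)) by (intros i p Hp; now exists i, p).
destruct (local_power _ phi psi h lam (Z I1 p0) HW (Wi I1 p0 Hp0) Hphi Hh) as [L0 [c [Nc HL0]]].
exists c. split; [exact Nc|].
set (G := fun (L : C -> C) t => continuousC L t /\ Cexp (L t) = phi t /\ h t / c = Cexp (lam * L
  t)).
assert (K : forall i p, Omega p -> exists L, locallyC (Z i p) (G L)).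
{ intros i. apply (connected_clopen Omega (fun p => exists L, locallyC (Z i p) (G L)) p0 Ho Hc).
  - intros p Hp [L HL]. generalize (HZ i p Hp _ (@locally_locally C_UniformSpace _ _ HL)).
    unfold filtermap. apply filter_imp. intros q Hq. now exists L.
  - intros p Hp Hd.
    destruct (local_power _ phi psi h lam (Z i p) HW (Wi i p Hp) Hphi Hh) as [L [k [Nk HL]]].
    destruct (Hd _ (HZ i p Hp _ HL)) as [q [[_ [E1 E2]] [Oq [L' HL']]]].
    destruct (locally_singleton _ _ HL') as [_ [E1' E2']].
    (* The two logarithms differ at [Z i q] by d, with exp d = 1. Shifting L by d multiplies exp(lam
       L) by exp(lam d), which is exactly the discrepancy k / c. *)
    set (d := L' (Z i q) - L (Z i q)).
    assert (Ed : Cexp d = 1).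
    { unfold d, Cminus. rewrite Cexp_plus, Cexp_opp, E1, E1'. field. rewrite <- E1. apply
      Cexp_neq_0. }
    assert (Ek : k / c = Cexp (lam * d)).
    { replace (lam * d) with (lam * L' (Z i q) + - (lam * L (Z i q))) by (unfold d; ring).
      rewrite Cexp_plus, <- E2', E2, Cexp_opp. field. split; [apply Cexp_neq_0 | exact Nc]. }
    exists (fun t => L t + d). revert HL. apply filter_imp. intros t [C1 [C2 C3']]. unfold G.
    split; [|split].
    + apply (@continuous_Cplus C_UniformSpace); [exact C1 | apply continuous_Cconst].
    + rewrite Cexp_plus, Ed, C2. ring.
    + rewrite Cmult_plus_distr_l, Cexp_plus, <- Ek, C3'. field. exact Nc.
  - exact Hp0.
  - exists L0. rewrite (H0 i I1). revert HL0. apply filter_imp. intros t [C1 [C2 C3']].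
    split; [exact C1|]. split; [exact C2|]. rewrite C3'. field. exact Nc. }
intros z [i [p [Hp ->]]]. destruct (K i p Hp) as [L HL]. now exists L.
Qed.

Lemma power_branch_has_cderiv (A : C -> Prop) (phi psi h : C -> C) (lam z : C) :
  openC A -> A z -> (forall t, A t -> has_cderiv phi t (psi t * phi t)) ->
  power_branch A phi lam h -> has_cderiv h z (lam * psi z * h z) /\ h z <> 0.
Proof.
intros HA Az Hphi Hh. destruct (Hh z Az) as [L HL].
destruct (locally_singleton _ _ HL) as [CL [EL Eh]].
assert (DL : has_cderiv L z (psi z)).
{ apply (continuous_log_has_cderiv phi); [exact CL | | now apply Hphi].
  revert HL. apply filter_imp. tauto. }
split.
- apply (has_cderiv_ext_loc (fun t => Cexp (lam * L t))).
  + revert HL. apply filter_imp. intros t [_ [_ E]]. now symmetry.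
  + eapply has_cderiv_ext_d.
    apply (has_cderiv_chain (fun t => lam * L t) Cexp).
    exact (has_cderiv_mult _ _ _ _ _ (has_cderiv_const lam z) DL). apply has_cderiv_Cexp.
    cbv beta. rewrite Eh. ring.
- rewrite Eh. apply Cexp_neq_0.
Qed.

Lemma power_branch_inv (A : C -> Prop) (phi h : C -> C) (lam : C) :
  power_branch A phi lam h -> power_branch A phi (- lam) (fun t => / h t).
Proof.
intros H z Az. destruct (H z Az) as [L HL]. exists L. revert HL. apply filter_imp.
intros t [C1 [C2 C3']]. split; [exact C1|]. split; [exact C2|].
rewrite C3', <- Cexp_opp. f_equal. ring.
Qed.

(** * Closed forms in a system with the symmetries of the cosine law *)

Section System.
Variables (Omega : C3 -> Prop) (y : C3 -> C3) (u : index3 -> C3 -> C).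
Variables (E : index3 -> index3 -> C3 -> C) (mu : C3 -> C).
Variables (sg psi psi1 psi2 tu theta : C -> C).
Notation yc i p := (coord i (y p)).

Definition dycoord (i : index3) (p v : C3) : C :=
  tu (u i p) / mu p * sum3 (fun j => E i j p * u j v).

(* What the two parts of the theorem have in common: part 1 is u_i = x_i with
   sg = tu = sin, part 2 is u_i = r_i with sg = tan (t/2) and tu = cos.  psi and
   theta are the logarithmic derivatives of sg and tu; psi1 = psi' and
   psi2 = psi''. *)
Record cosine_system : Prop := {
  cs_open : openC3 Omega;
  cs_connected : connected_open Omega;
  cs_clinear : forall i, clinear (u i);
  cs_dual : forall i c, exists v, u i v = c /\ forall j, j <> i -> u j v = 0;
  cs_dy : forall p i, Omega p -> has_rdiff3 (fun q => yc i q) p (dycoord i p);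
  cs_sym : forall p i j, Omega p -> E i j p = E j i p;
  cs_mu : forall p, Omega p -> mu p <> 0;
  cs_tu : forall p i, Omega p -> tu (u i p) <> 0;
  cs_sg : forall p i, Omega p -> sg (yc i p) <> 0;
  cs_sine : forall p i j, Omega p ->
    sg (yc i p) * tu (u j p) = sg (yc j p) * tu (u i p);
  cs_dsg : forall p i, Omega p -> has_cderiv sg (yc i p) (psi (yc i p) * sg (yc i p));
  cs_dpsi : forall p i, Omega p -> has_cderiv psi (yc i p) (psi1 (yc i p));
  cs_dpsi1 : forall p i, Omega p -> has_cderiv psi1 (yc i p) (psi2 (yc i p));
  cs_dtu : forall p i, Omega p -> has_cderiv tu (u i p) (theta (u i p) * tu (u i p));
  cs_indep : forall p i j a b, Omega p -> i <> j ->
    (forall m, a * E i m p = b * E j m p) -> a = 0 /\ b = 0;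
  (* In the application [al] and [be] are f_z g_zbar tau / mu and the conjugate of tau / mu times
     f_zbar g_z. Only density of such points can be expected: at isolated places E may have zeros or
     be real. *)
  cs_generic : forall p (N : C3 -> Prop), Omega p -> locally3 p N ->
    exists q, N q /\ Omega q /\ (forall i j, i <> j -> E i j q <> 0) /\
      forall al be : index3 -> C,
        (forall i j, al i * E i j q = be j * Cconj (E i j q)) ->
        forall i, al i = 0 /\ be i = 0;
  cs_base : exists p0, Omega p0 /\
    forall i j, yc i p0 = yc j p0 /\ u i p0 = u j p0;
  (* The values w and s are prescribed independently, because non-constancy yields a non-zero
     derivative of f near y_i(p) and one of g near u_i(p) at unrelated points. The field also makes
     the images of y_i and u_i open. *)
  cs_image : forall p i (N : C3 -> Prop), Omega p -> locally3 p N ->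
    exists d : posreal, forall w s,
      (Cmod (w - yc i p) < d)%R -> (Cmod (s - u i p) < d)%R ->
      exists q, N q /\ yc i q = w /\ u i q = s;
  (* This provides a denominator without zeros for lambda: psi itself in part 2, its derivative in
     part 1. *)
  cs_case : (forall p i, Omega p -> psi (yc i p) <> 0) \/
    (forall p i, Omega p -> psi1 (yc i p) <> 0)
}.

Hypothesis S : cosine_system.

Lemma u_linear i : @is_linear R_AbsRing C3_R C_R (u i).
Proof. apply clinear_is_linear, (cs_clinear S). Qed.

Lemma has_rdiff_u i p : has_rdiff3 (u i) p (u i).
Proof. apply has_rdiff_linear, u_linear. Qed.

Lemma Omega_locally p : Omega p -> locally3 p Omega.
Proof. apply open_locally, (cs_open S). Qed.

Lemma Omega_locally_imp p (P : C3 -> Prop) :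
  Omega p -> (forall q, Omega q -> P q) -> locally3 p P.
Proof. intros Hp H. generalize (Omega_locally p Hp). now apply filter_imp. Qed.

Lemma rdiff_comp_u (g : C -> C) i p v :
  @rdiff C3_R (fun q => g (u i q)) p v = rdiffC g (u i p) (u i v).
Proof.
unfold rdiff.
assert (K : forall t : R, u i (@plus C3_R p (scal t v)) =
  @plus C_R (u i p) (scal t (u i v))).
{ intros t. rewrite (linear_plus _ (u_linear i)). f_equal. apply (linear_scal _ (u_linear i)). }
apply injective_projections; apply Derive_ext; intros t; now rewrite K.
Qed.

Lemma fdg_form_u (f g : C -> C) p v :
  fdg_form f g y u p v = sum3 (fun i => f (yc i p) * rdiffC g (u i p) (u i v)).
Proof. apply sum3_ext. intros i. now rewrite rdiff_comp_u. Qed.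

Lemma continuous_y i p : Omega p -> continuous3 (fun q => yc i q) p.
Proof. intros Hp. exact (has_rdiff_continuous _ _ _ (cs_dy S p i Hp)). Qed.

Lemma continuous_u i p : continuous3 (u i) p.
Proof. exact (has_rdiff_continuous _ _ _ (has_rdiff_u i p)). Qed.

Lemma dycoord_dual i j p v c :
  u j v = c -> (forall k, k <> j -> u k v = 0) ->
  dycoord i p v = tu (u i p) / mu p * (E i j p * c).
Proof.
intros <- H. unfold dycoord. f_equal. rewrite (sum3_single _ j); [reflexivity|].
intros k Hk. rewrite (H k Hk). ring.
Qed.

Lemma y_image_open (O : C3 -> Prop) z :
  (forall p, O p -> Omega p /\ locally3 p O) ->
  (exists i p, O p /\ z = yc i p) ->
  locallyC z (fun w => exists i p, O p /\ w = yc i p).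
Proof.
intros HO [i [p [Op ->]]]. destruct (HO p Op) as [Hp Lp].
destruct (cs_image S p i O Hp Lp) as [d Hd]. apply locally_C_iff. exists d.
intros w Hw. destruct (Hd w (u i p) Hw) as [q [Oq [Eq _]]].
{ replace (u i p - u i p) with (RtoC 0) by ring. rewrite Cmod_0. apply cond_pos. }
exists i, q. now split.
Qed.

Lemma u_image_open (O : C3 -> Prop) z :
  (forall p, O p -> Omega p /\ locally3 p O) ->
  (exists i p, O p /\ z = u i p) ->
  locallyC z (fun w => exists i p, O p /\ w = u i p).
Proof.
intros HO [i [p [Op ->]]]. destruct (HO p Op) as [Hp Lp].
destruct (cs_image S p i O Hp Lp) as [d Hd]. apply locally_C_iff. exists d.
intros w Hw. destruct (Hd (yc i p) w) as [q [Oq [_ Eq]]]; [|exact Hw|].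
{ replace (yc i p - yc i p) with (RtoC 0) by ring. rewrite Cmod_0. apply cond_pos. }
exists i, q. now split.
Qed.

Lemma y_values_open : openC (y_values Omega y).
Proof.
intros z Hz. apply (y_image_open Omega); [|exact Hz].
intros p Hp. split; [exact Hp | now apply Omega_locally].
Qed.

Lemma u_values_open : openC (values Omega u).
Proof.
intros z Hz. apply (u_image_open Omega); [|exact Hz].
intros p Hp. split; [exact Hp | now apply Omega_locally].
Qed.

(** The points of [cs_generic] are dense and Z is continuous, so an equation obtained after dividing
    by entries of E, or by means of their non-reality, extends to all of Omega. *)
Lemma generic_eq (Z : C3 -> C) p :
  Omega p -> continuous3 Z p ->
  locally3 p (fun q => Omega q -> (forall i j, i <> j -> E i j q <> 0) ->
    (forall al be : index3 -> C,
        (forall i j, al i * E i j q = be j * Cconj (E i j q)) ->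
        forall i, al i = 0 /\ be i = 0) -> Z q = 0) -> Z p = 0.
Proof.
intros Hp HZ H. apply NNPP. intros N.
destruct (cs_generic S p _ Hp (filter_and _ _ H (neq_locally Z p 0 HZ N))) as
  [q [[H1 H2] [H3 [H4 H5]]]].
apply H2. now apply H1.
Qed.

(** * Consequences of closedness for f and g *)

Section Closed.
Variables (f g : C -> C) (U V : C -> Prop).
Hypotheses (HU : openC U) (HV : openC V).
Hypotheses (yU : forall z, y_values Omega y z -> U z) (uV : forall z, values Omega u z -> V z).
Hypotheses (Hf : smooth_on U f) (Hg : smooth_on V g).
Hypothesis Hclosed : closed_form Omega (fdg_form f g y u).

Lemma y_in_U p i : Omega p -> U (yc i p).
Proof. intros Hp. apply yU. now exists i, p. Qed.

Lemma u_in_V p i : Omega p -> V (u i p).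
Proof. intros Hp. apply uV. now exists i, p. Qed.

(** In the exterior derivative the second derivatives of g cancel by symmetry, and only the products
    of first derivatives of f and g remain. *)
Lemma closed_sum p v w : Omega p ->
  sum3 (fun i => rdiffC f (yc i p) (dycoord i p w) * rdiffC g (u i p) (u i v)) =
  sum3 (fun i => rdiffC f (yc i p) (dycoord i p v) * rdiffC g (u i p) (u i w)).
Proof.
intros Hp.
assert (D : forall v w, @rdiff C3_R (fun q => fdg_form f g y u q v) p w =
  sum3 (fun i => rdiffC f (yc i p) (dycoord i p w) * rdiffC g (u i p) (u i v) +
    f (yc i p) * rdiffC (fun z => rdiffC g z (u i v)) (u i p) (u i w))).
{ intros a b. apply (@has_rdiff_rdiff C3_R (fun q => fdg_form f g y u q a) p
    (fun w => sum3 (fun i => rdiffC f (yc i p) (dycoord i p w) * rdiffC g (u i p) (u i a) +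
    f (yc i p) * rdiffC (fun z => rdiffC g z (u i a)) (u i p) (u i w)))).
  eapply has_rdiff_ext. intros q. symmetry. apply fdg_form_u.
  apply has_rdiff_sum3. intros i.
  apply (@has_rdiff_mult C3_R (fun q => f (yc i q)) (fun q => rdiffC g (u i q) (u i a)) p
    (fun w => rdiffC f (yc i p) (dycoord i p w))
    (fun w => rdiffC (fun z => rdiffC g z (u i a)) (u i p) (u i w))).
  - apply (@has_rdiff_comp C3_R C_R (fun q => yc i q) f p (dycoord i p) (rdiffC f (yc i p))).
    exact (cs_dy S p i Hp). apply (smooth_has_rdiff U); [exact Hf | now apply y_in_U].
  - apply (@has_rdiff_comp C3_R C_R (u i) (fun z => rdiffC g z (u i a)) p (u i)
      (rdiffC (fun z => rdiffC g z (u i a)) (u i p))).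
    exact (has_rdiff_u i p).
    apply (smooth_has_rdiff V); [now apply smooth_rdiff | now apply u_in_V]. }
pose proof (proj2 Hclosed w v p Hp) as K. rewrite !D in K.
assert (Sym : forall i, rdiffC (fun z => rdiffC g z (u i v)) (u i p) (u i w) =
  rdiffC (fun z => rdiffC g z (u i w)) (u i p) (u i v)).
{ intros i. apply (rdiff_sym V); [exact HV | exact Hg | now apply u_in_V]. }
unfold sum3 in *. rewrite !Sym in K.
match goal with |- ?a = ?b => apply Ceq_minus; match type of K with ?c = ?d =>
  replace (a - b) with (c - d) by ring; rewrite K; ring end end.
Qed.

Notation T i p := (tu (u i p) / mu p).

Lemma T_neq_0 i p : Omega p -> T i p <> 0.
Proof.
intros Hp. unfold Cdiv. apply Cmult_neq_0. now apply (cs_tu S).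
intros Z. pose proof (cs_mu S p Hp) as M. apply C1_nz.
rewrite <- (Cinv_r (mu p) M), Z. ring.
Qed.

(** For v and w dual to u_j and u_i, a single term survives in each of the two sums. *)
Lemma closed_pair p i j (xi eta : C) : Omega p ->
  rdiffC f (yc j p) (T j p * (E j i p * eta)) * rdiffC g (u j p) xi =
  rdiffC f (yc i p) (T i p * (E i j p * xi)) * rdiffC g (u i p) eta.
Proof.
intros Hp.
destruct (cs_dual S j xi) as [v [v1 v2]]. destruct (cs_dual S i eta) as [w [w1 w2]].
pose proof (closed_sum p v w Hp) as K.
assert (Z : forall k, rdiffC g (u k p) (RtoC 0) = 0).
{ intros k. rewrite (smooth_rdiff_decomp V g _ _ Hg (u_in_V p k Hp)).
  replace (Cconj 0) with (RtoC 0) by (apply injective_projections; cbn; ring). ring. }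
rewrite (sum3_single _ j) in K.
2: { intros k Hk. rewrite (v2 k Hk), Z. ring. }
rewrite (sum3_single (fun k => _ (dycoord k p v) * _) i) in K.
2: { intros k Hk. rewrite (w2 k Hk), Z. ring. }
rewrite v1, w1, (dycoord_dual j i p w eta w1 w2), (dycoord_dual i j p v xi v1 v2) in K.
exact K.
Qed.

(** These are the coefficients of xi eta and of conj(xi) eta in [closed_pair]. The coefficient of xi
    conj(eta) is the second relation with i and j exchanged, and that of conj(xi) conj(eta) is the
    first relation for the conjugates of f and g. *)
Lemma closed_coefs p i j : Omega p ->
  dz f (yc j p) * (T j p * E j i p) * dz g (u j p) =
    dz f (yc i p) * (T i p * E i j p) * dz g (u i p) /\
  dz f (yc j p) * (T j p * E j i p) * dzbar g (u j p) =
    dzbar f (yc i p) * Cconj (T i p * E i j p) * dz g (u i p).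
Proof.
intros Hp.
set (a := dz f (yc j p)). set (b := dzbar f (yc j p)). set (a' := dz f (yc i p)). set (b' :=
  dzbar f (yc i p)).
set (r := dz g (u j p)). set (s := dzbar g (u j p)). set (r' := dz g (u i p)). set (s' := dzbar g
  (u i p)).
set (X := T j p * E j i p). set (W := T i p * E i j p).
destruct (bilinear_coefs (a * X * r - a' * W * r') (b * Cconj X * r - a' * W * s')
  (a * X * s - b' * Cconj W * r') (b * Cconj X * s - b' * Cconj W * s')) as [H1 [_ [H3 _]]].
- intros xi eta. pose proof (closed_pair p i j xi eta Hp) as K.
  rewrite (smooth_rdiff_decomp U f (yc j p) _ Hf (y_in_U p j Hp)) in K.
  rewrite (smooth_rdiff_decomp U f (yc i p) _ Hf (y_in_U p i Hp)) in K.
  rewrite (smooth_rdiff_decomp V g (u j p) _ Hg (u_in_V p j Hp)) in K.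
  rewrite (smooth_rdiff_decomp V g (u i p) _ Hg (u_in_V p i Hp)) in K.
  fold a b a' b' r s r' s' in K.
  replace (T j p * (E j i p * eta)) with (X * eta) in K by (unfold X; ring).
  replace (T i p * (E i j p * xi)) with (W * xi) in K by (unfold W; ring).
  rewrite !Cmult_conj in K.
  ring_diff K.
- split; apply Ceq_minus; assumption.
Qed.

Definition form_coef (i : index3) (p : C3) : C :=
  dz f (yc i p) * dz g (u i p) * tu (u i p).

Lemma continuous_dzf i p : Omega p -> continuous3 (fun q => dz f (yc i q)) p.
Proof.
intros Hp. apply (@continuous_Ccomp C3_R). now apply continuous_y.
apply (smooth_continuous_dz U); [exact Hf | now apply y_in_U].
Qed.

Lemma continuous_dzbarf i p : Omega p -> continuous3 (fun q => dzbar f (yc i q)) p.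
Proof.
intros Hp. apply (@continuous_Ccomp C3_R). now apply continuous_y.
apply (smooth_continuous_dzbar U); [exact Hf | now apply y_in_U].
Qed.

Lemma continuous_dzg i p : Omega p -> continuous3 (fun q => dz g (u i q)) p.
Proof.
intros Hp. apply (@continuous_Ccomp C3_R). now apply continuous_u.
apply (smooth_continuous_dz V); [exact Hg | now apply u_in_V].
Qed.

Lemma continuous_dzbarg i p : Omega p -> continuous3 (fun q => dzbar g (u i q)) p.
Proof.
intros Hp. apply (@continuous_Ccomp C3_R). now apply continuous_u.
apply (smooth_continuous_dzbar V); [exact Hg | now apply u_in_V].
Qed.

Lemma continuous_form_coef i p : Omega p -> continuous3 (form_coef i) p.
Proof.
intros Hp. apply (@continuous_Cmult C3_R). apply (@continuous_Cmult C3_R).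
now apply continuous_dzf. now apply continuous_dzg.
apply (@continuous_Ccomp C3_R). now apply continuous_u.
exact (has_cderiv_continuous _ _ _ (cs_dtu S p i Hp)).
Qed.

(** The first relation of [closed_coefs] is this equality multiplied by E_ij / mu; the factor
    cancels where E_ij is non-zero, and [generic_eq] fills in the remaining points. *)
Lemma form_coef_indep p i j : Omega p -> form_coef i p = form_coef j p.
Proof.
intros Hp. destruct (classic (i = j)) as [->|Hij]; [reflexivity|].
apply Ceq_minus.
apply (generic_eq (fun q => form_coef i q - form_coef j q) p Hp).
- apply (@continuous_Cplus C3_R (form_coef i) (fun q => - form_coef j q)). now apply
    continuous_form_coef.
  apply (@continuous_Copp C3_R (form_coef j)). now apply continuous_form_coef.
- apply filter_forall. intros q Hq HE _.
  destruct (closed_coefs q i j Hq) as [K _]. rewrite (cs_sym S q j i Hq) in K.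
  apply (Cmult_reg_l (E i j q / mu q)).
  + unfold Cdiv. apply Cmult_neq_0; [now apply HE|]. intros Z. pose proof (cs_mu S q Hq) as M.
    apply C1_nz. rewrite <- (Cinv_r _ M), Z. ring.
  + unfold form_coef. pose proof (cs_mu S q Hq) as M.
    match type of K with ?c = ?d => transitivity (d - c); [field; exact M | rewrite K; ring] end.
Qed.

Lemma mixed_zero p i : Omega p ->
  dz f (yc i p) * dzbar g (u i p) = 0 /\ dzbar f (yc i p) * dz g (u i p) = 0.
Proof.
intros Hp.
assert (K : forall q, Omega q -> (forall al be : index3 -> C,
        (forall i j, al i * E i j q = be j * Cconj (E i j q)) ->
        forall i, al i = 0 /\ be i = 0) ->
  dz f (yc i q) * dzbar g (u i q) = 0 /\ dzbar f (yc i q) * dz g (u i q) = 0).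
{ intros q Hq HG.
  (* With E symmetric, the second relation of [closed_coefs] has precisely the form al_j E_jk = be_k
     conj(E_jk). *)
  destruct (HG (fun k => dz f (yc k q) * dzbar g (u k q) * T k q)
    (fun k => dzbar f (yc k q) * dz g (u k q) * Cconj (T k q))) with (i := i) as [A B].
  - intros j k. destruct (closed_coefs q k j Hq) as [_ K]. rewrite Cmult_conj in K.
    rewrite (cs_sym S q k j Hq) in K.
    ring_from K.
  - split.
    + destruct (Cmult_integral _ _ A) as [|Z]; [assumption|]. exfalso. exact (T_neq_0 i q Hq Z).
    + destruct (Cmult_integral _ _ B) as [|Z]; [assumption|]. exfalso. apply (T_neq_0 i q Hq).
      rewrite <- (Cconj_conj (T i q)), Z. apply injective_projections; cbn; ring. }
split.
- apply (generic_eq (fun q => dz f (yc i q) * dzbar g (u i q)) p Hp).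
  apply (@continuous_Cmult C3_R); [now apply continuous_dzf | now apply continuous_dzbarg].
  apply filter_forall. intros q Hq _ HG. now apply K.
- apply (generic_eq (fun q => dzbar f (yc i q) * dz g (u i q)) p Hp).
  apply (@continuous_Cmult C3_R); [now apply continuous_dzbarf | now apply continuous_dzg].
  apply filter_forall. intros q Hq _ HG. now apply K.
Qed.

Lemma nonconstant_coef :
  nonconstant_pair Omega y u f g ->
  exists p i, Omega p /\
    ((dz f (yc i p) <> 0 /\ dz g (u i p) <> 0) \/
     (dzbar f (yc i p) <> 0 /\ dzbar g (u i p) <> 0)).
Proof.
intros [p [i [Hp [Nf Ng]]]].
destruct (cs_image S p i Omega Hp (Omega_locally p Hp)) as [d Hd].
destruct (nonconstant_rdiff U f _ d HU Hf (y_in_U p i Hp) Nf) as [w [Hw Dw]].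
destruct (nonconstant_rdiff V g _ d HV Hg (u_in_V p i Hp) Ng) as [s [Hs Ds]].
destruct (Hd w s Hw Hs) as [q [Hq [Ew Es]]].
exists q, i. split; [exact Hq|]. destruct (mixed_zero q i Hq) as [M1 M2].
rewrite Ew, Es in *.
destruct Dw as [A|A].
- left. split; [exact A|]. destruct (Cmult_integral _ _ M1) as [|Z]; [contradiction|].
  destruct Ds; [assumption | contradiction].
- right. split; [exact A|]. destruct (Cmult_integral _ _ M2) as [|Z]; [contradiction|].
  destruct Ds; [contradiction | assumption].
Qed.

(** Index 1 stands for all three by [form_coef_indep]. At such a point f_z(y_i) and g_z(u_i) are
    non-zero, so [mixed_zero] kills the zbar-derivatives. *)
Definition nondeg (p : C3) : Prop := Omega p /\ form_coef I1 p <> 0.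

Lemma nondeg_locally p : nondeg p -> Omega p /\ locally3 p nondeg.
Proof.
intros [Hp Np]. split; [exact Hp|]. apply filter_and. now apply Omega_locally.
apply neq_locally; [|exact Np]. now apply continuous_form_coef.
Qed.

Lemma nondeg_coef p i : nondeg p ->
  dz f (yc i p) <> 0 /\ dz g (u i p) <> 0 /\
  dzbar f (yc i p) = 0 /\ dzbar g (u i p) = 0 /\ form_coef i p <> 0.
Proof.
intros [Hp Np].
rewrite (form_coef_indep p I1 i Hp) in Np.
assert (A : dz f (yc i p) <> 0). { intros Z. apply Np. unfold form_coef. rewrite Z. ring. }
assert (B : dz g (u i p) <> 0). { intros Z. apply Np. unfold form_coef. rewrite Z. ring. }
destruct (mixed_zero p i Hp) as [M1 M2].
repeat split; auto.
- destruct (Cmult_integral _ _ M2); [assumption | contradiction].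
- destruct (Cmult_integral _ _ M1); [contradiction | assumption].
Qed.

Definition y_nondeg (z : C) : Prop := exists i p, nondeg p /\ z = yc i p.
Definition u_nondeg (z : C) : Prop := exists i p, nondeg p /\ z = u i p.

Lemma y_nondeg_open : openC y_nondeg.
Proof. intros z Hz. apply (y_image_open nondeg); [apply nondeg_locally | exact Hz]. Qed.

Lemma u_nondeg_open : openC u_nondeg.
Proof. intros z Hz. apply (u_image_open nondeg); [apply nondeg_locally | exact Hz]. Qed.

Lemma dzbar_0_CR h z : dzbar h z = 0 -> rdiffC h z Ci = Ci * rdiffC h z (RtoC 1).
Proof.
unfold dzbar. intros Z.
assert (Z' : rdiffC h z (RtoC 1) + Ci * rdiffC h z Ci = 0).
{ replace (rdiffC h z (RtoC 1) + Ci * rdiffC h z Ci) with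
    (2 * ((rdiffC h z (RtoC 1) + Ci * rdiffC h z Ci) / 2)) by field. rewrite Z. ring. }
replace (rdiffC h z Ci) with (Ci * (rdiffC h z (RtoC 1) - (rdiffC h z (RtoC 1) + Ci * rdiffC h z
  Ci))).
rewrite Z'. ring.
replace (Ci * (rdiffC h z (RtoC 1) - (rdiffC h z (RtoC 1) + Ci * rdiffC h z Ci))) with
  (- (Ci * Ci) * rdiffC h z Ci) by ring.
rewrite Ci2. ring.
Qed.

Lemma dz_Cder h z : rdiffC h z Ci = Ci * rdiffC h z (RtoC 1) -> dz h z = Cder h z.
Proof.
intros H. unfold dz, Cder. rewrite H.
replace (rdiffC h z (RtoC 1) - Ci * (Ci * rdiffC h z (RtoC 1))) with
  (rdiffC h z (RtoC 1) - (Ci * Ci) * rdiffC h z (RtoC 1)) by ring.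
rewrite Ci2. field.
Qed.

Lemma hol_f : hol y_nondeg f.
Proof.
split.
- apply (smooth_incl U); [|exact Hf]. intros z [i [p [[Hp _] ->]]]. apply yU. now exists i, p.
- intros z [i [p [Np ->]]]. apply dzbar_0_CR. now apply nondeg_coef.
Qed.

Lemma hol_g : hol u_nondeg g.
Proof.
split.
- apply (smooth_incl V); [|exact Hg]. intros z [i [p [[Hp _] ->]]]. apply uV. now exists i, p.
- intros z [i [p [Np ->]]]. apply dzbar_0_CR. now apply nondeg_coef.
Qed.

Lemma y_nondeg_i i p : nondeg p -> y_nondeg (yc i p).
Proof. intros Np. now exists i, p. Qed.

Lemma u_nondeg_i i p : nondeg p -> u_nondeg (u i p).
Proof. intros Np. now exists i, p. Qed.

Lemma Cder_f_neq_0 i p : nondeg p -> Cder f (yc i p) <> 0.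
Proof.
intros Np. rewrite <- dz_Cder. now apply nondeg_coef.
apply hol_f. now apply y_nondeg_i.
Qed.

Lemma Cder_g_neq_0 i p : nondeg p -> Cder g (u i p) <> 0.
Proof.
intros Np. rewrite <- dz_Cder. now apply nondeg_coef.
apply hol_g. now apply u_nondeg_i.
Qed.

Lemma form_coef_Cder i p : nondeg p -> form_coef i p = Cder f (yc i p) * Cder g (u i p) * tu (u i
  p).
Proof.
intros Np. unfold form_coef. rewrite !dz_Cder; [reflexivity | |].
apply hol_g. now apply u_nondeg_i. apply hol_f. now apply y_nondeg_i.
Qed.

(** * Logarithmic derivatives of f' and g', and the constant lambda *)

Definition phi (z : C) : C := Cder (Cder f) z / Cder f z.
Definition gphi (z : C) : C := Cder (Cder g) z / Cder g z.

Lemma hol_Cder_f : hol y_nondeg (Cder f).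
Proof. apply hol_Cder; [apply y_nondeg_open | apply hol_f]. Qed.

Lemma hol_Cder_g : hol u_nondeg (Cder g).
Proof. apply hol_Cder; [apply u_nondeg_open | apply hol_g]. Qed.

Lemma phi_derivatives : exists phi1 phi2 : C -> C, forall z, y_nondeg z ->
  has_cderiv phi z (phi1 z) /\ has_cderiv phi1 z (phi2 z).
Proof.
pose proof hol_Cder_f as H1. pose proof (hol_Cder _ _ y_nondeg_open H1) as H2.
pose proof (hol_Cder _ _ y_nondeg_open H2) as H3.
eexists. eexists. intros z Wz.
assert (N : Cder f z <> 0). { destruct Wz as [i [p [Np ->]]]. now apply Cder_f_neq_0. }
pose proof (hol_has_cderiv _ _ z H1 Wz) as D1.
pose proof (hol_has_cderiv _ _ z H2 Wz) as D2.
pose proof (hol_has_cderiv _ _ z H3 Wz) as D3.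
split.
- exact (has_cderiv_div _ _ z _ _ N D2 D1).
- refine (has_cderiv_div (fun z => Cder (Cder (Cder f)) z * Cder f z - Cder (Cder f) z * Cder
    (Cder f) z)
    (fun z => Cder f z * Cder f z) z _ _ (Cmult_neq_0 _ _ N N) _ _).
  + apply has_cderiv_minus; [exact (has_cderiv_mult _ _ z _ _ D3 D1) | exact (has_cderiv_mult _ _
    z _ _ D2 D2)].
  + exact (has_cderiv_mult _ _ z _ _ D1 D1).
Qed.

(* Since dy_i and dy_j are linearly independent, a relation between functions
   of y_i and of y_j can be differentiated in y_i and in y_j separately. *)
Lemma separate_derivatives (P Q R T P1 Q1 R1 T1 : C -> C) p i j :
  i <> j -> Omega p -> locally3 p (fun q => P (yc i q) * Q (yc j q) = R (yc i q) * T (yc j q)) ->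
  has_cderiv P (yc i p) (P1 (yc i p)) -> has_cderiv R (yc i p) (R1 (yc i p)) ->
  has_cderiv Q (yc j p) (Q1 (yc j p)) -> has_cderiv T (yc j p) (T1 (yc j p)) ->
  P1 (yc i p) * Q (yc j p) = R1 (yc i p) * T (yc j p) /\
  P (yc i p) * Q1 (yc j p) = R (yc i p) * T1 (yc j p).
Proof.
intros Hij Hp Hloc HP HR HQ HT.
pose proof (cs_dy S p i Hp) as Di. pose proof (cs_dy S p j Hp) as Dj.
assert (K : forall v,
  P1 (yc i p) * dycoord i p v * Q (yc j p) + P (yc i p) * (Q1 (yc j p) * dycoord j p v) =
  R1 (yc i p) * dycoord i p v * T (yc j p) + R (yc i p) * (T1 (yc j p) * dycoord j p v)).
{ intros v.
  apply (@has_rdiff_eq C3_R (fun q => P (yc i q) * Q (yc j q)) (fun q => R (yc i q) * T (yc j q)) p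
   (fun v => P1 (yc i p) * dycoord i p v * Q (yc j p) + P (yc i p) * (Q1 (yc j p) * dycoord j p v))
   (fun v => R1 (yc i p) * dycoord i p v * T (yc j p) + R (yc i p) * (T1 (yc j p) * dycoord j p
     v)) v Hloc).
  - exact (@has_rdiff_mult C3_R _ _ p _ _ (has_cderiv_comp _ P p _ _ Di HP) (has_cderiv_comp _ Q
      p _ _ Dj HQ)).
  - exact (@has_rdiff_mult C3_R _ _ p _ _ (has_cderiv_comp _ R p _ _ Di HR) (has_cderiv_comp _ T
      p _ _ Dj HT)). }
set (X := P1 (yc i p) * Q (yc j p) - R1 (yc i p) * T (yc j p)).
set (Z := R (yc i p) * T1 (yc j p) - P (yc i p) * Q1 (yc j p)).
destruct (cs_indep S p i j (X * (tu (u i p) / mu p)) (Z * (tu (u j p) / mu p)) Hp Hij) as [A B].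
- intros m. destruct (cs_dual S m 1) as [v [v1 v2]]. specialize (K v).
  rewrite (dycoord_dual i m p v 1 v1 v2), (dycoord_dual j m p v 1 v1 v2) in K.
  unfold X, Z. match type of K with ?a = ?b => apply Ceq_minus;
   match goal with |- ?c = _ => transitivity (a - b); [ring | rewrite K; ring] end end.
- split; apply Ceq_minus.
  + destruct (Cmult_integral _ _ A) as [|N]; [assumption|]. exfalso. exact (T_neq_0 i p Hp N).
  + destruct (Cmult_integral _ _ B) as [N|N].
    * replace (P (yc i p) * Q1 (yc j p) - R (yc i p) * T1 (yc j p)) with (- Z) by (unfold Z; ring).
      rewrite N. ring.
    * exfalso. exact (T_neq_0 j p Hp N).
Qed.

(** Logarithmic differential of [cs_sine]. It will be compared with that of the common value of
    [form_coef], in which the same dy_i and dy_j occur. *)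
Lemma log_sine p i j v : Omega p ->
  psi (yc i p) * dycoord i p v + theta (u j p) * u j v =
  psi (yc j p) * dycoord j p v + theta (u i p) * u i v.
Proof.
intros Hp.
assert (D : forall i j, has_rdiff3 (fun q => sg (yc i q) * tu (u j q)) p
  (fun v => psi (yc i p) * sg (yc i p) * dycoord i p v * tu (u j p) +
    sg (yc i p) * (theta (u j p) * tu (u j p) * u j v))).
{ intros k l. exact (@has_rdiff_mult C3_R _ _ p _ _
   (has_cderiv_comp _ sg p _ _ (cs_dy S p k Hp) (cs_dsg S p k Hp))
   (has_cderiv_comp _ tu p _ _ (has_rdiff_u l p) (cs_dtu S p l Hp))). }
pose proof (@has_rdiff_eq C3_R _ _ p _ _ v
  (Omega_locally_imp p _ Hp (fun q Hq => cs_sine S q i j Hq)) (D i j) (D j i)) as K.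
cbv beta in K. pose proof (cs_sine S p i j Hp) as Sn.
apply (Cmult_reg_l (sg (yc i p) * tu (u j p))).
- apply Cmult_neq_0; [now apply (cs_sg S) | now apply (cs_tu S)].
- rewrite Sn at 2.
  ring_from K.
Qed.

Lemma has_rdiff_form_coef i p : nondeg p -> has_rdiff3 (form_coef i) p
  (fun v => form_coef i p * (phi (yc i p) * dycoord i p v + (gphi (u i p) + theta (u i p)) * u i
    v)).
Proof.
intros Np. pose proof (proj1 Np) as Hp.
apply (@has_rdiff_ext_loc C3_R (fun q => Cder f (yc i q) * Cder g (u i q) * tu (u i q))).
- generalize (proj2 (nondeg_locally p Np)). apply filter_imp. intros q Nq. symmetry.
  now apply form_coef_Cder.
- eapply has_rdiff_ext_lin.
  + apply (@has_rdiff_mult C3_R). apply (@has_rdiff_mult C3_R).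
    * exact (has_cderiv_comp _ (Cder f) p _ _ (cs_dy S p i Hp)
       (hol_has_cderiv _ _ _ hol_Cder_f (y_nondeg_i i p Np))).
    * exact (has_cderiv_comp _ (Cder g) p _ _ (has_rdiff_u i p)
       (hol_has_cderiv _ _ _ hol_Cder_g (u_nondeg_i i p Np))).
    * exact (has_cderiv_comp _ tu p _ _ (has_rdiff_u i p) (cs_dtu S p i Hp)).
  + intros w. cbv beta. rewrite form_coef_Cder by exact Np. unfold phi, gphi.
    field. split; [now apply Cder_g_neq_0 | now apply Cder_f_neq_0].
Qed.

Lemma log_coef p i j v : nondeg p ->
  phi (yc i p) * dycoord i p v + (gphi (u i p) + theta (u i p)) * u i v =
  phi (yc j p) * dycoord j p v + (gphi (u j p) + theta (u j p)) * u j v.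
Proof.
intros Np. pose proof (proj1 Np) as Hp.
pose proof (@has_rdiff_eq C3_R _ _ p _ _ v
  (Omega_locally_imp p _ Hp (fun q Hq => form_coef_indep q i j Hq))
  (has_rdiff_form_coef i p Np) (has_rdiff_form_coef j p Np)) as K.
cbv beta in K. rewrite <- (form_coef_indep p i j Hp) in K.
apply (Cmult_reg_l (form_coef i p)); [now apply nondeg_coef | exact K].
Qed.

Lemma phi_psi p i j : nondeg p -> i <> j ->
  phi (yc i p) * psi (yc j p) = phi (yc j p) * psi (yc i p).
Proof.
intros Np Hij. pose proof (proj1 Np) as Hp. apply Ceq_minus.
destruct phi_derivatives as [phi1 [phi2 Hphi]].
assert (Cphi : forall k, continuous3 (fun q => phi (yc k q)) p).
{ intros k. apply (@continuous_Ccomp C3_R); [now apply continuous_y|].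
  exact (has_cderiv_continuous _ _ _ (proj1 (Hphi _ (y_nondeg_i k p Np)))). }
assert (Cpsi : forall k, continuous3 (fun q => psi (yc k q)) p).
{ intros k. apply (@continuous_Ccomp C3_R); [now apply continuous_y|].
  exact (has_cderiv_continuous _ _ _ (cs_dpsi S p k Hp)). }
apply (generic_eq (fun q => phi (yc i q) * psi (yc j q) - phi (yc j q) * psi (yc i q)) p Hp).
- apply (@continuous_Cplus C3_R). now apply (@continuous_Cmult C3_R).
  apply (@continuous_Copp C3_R). now apply (@continuous_Cmult C3_R).
- generalize (proj2 (nondeg_locally p Np)). apply filter_imp. intros q Nq Hq HE _.
  (* In the direction dual to u_k both du_i and du_j vanish, leaving phi(y_i) X = phi(y_j) Z and
     psi(y_i) X = psi(y_j) Z, where X and Z are the increments of y_i and y_j. Genericity makes Z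
     non-zero, so X and Z can be eliminated. *)
  destruct (exists_third i j Hij) as [k [Hki Hkj]].
  destruct (cs_dual S k 1) as [v [v1 v2]].
  pose proof (log_coef q i j v Nq) as A. pose proof (log_sine q i j v Hq) as B.
  rewrite (v2 i), (v2 j) in A, B by congruence.
  rewrite (dycoord_dual i k q v 1 v1 v2), (dycoord_dual j k q v 1 v1 v2) in A, B.
  set (X := tu (u i q) / mu q * (E i k q * 1)) in *.
  set (Z := tu (u j q) / mu q * (E j k q * 1)) in *.
  assert (NZ : Z <> 0).
  { unfold Z. apply Cmult_neq_0; [now apply T_neq_0|]. apply Cmult_neq_0; [|apply C1_nz].
    apply HE. congruence. }
  apply (Cmult_reg_l Z _ _ NZ).
  assert (A' : phi (yc i q) * X = phi (yc j q) * Z).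
  { ring_from A. }
  assert (B' : psi (yc i q) * X = psi (yc j q) * Z).
  { ring_from B. }
  transitivity (phi (yc i q) * (psi (yc j q) * Z) - psi (yc i q) * (phi (yc j q) * Z)); [ring|].
  rewrite <- A', <- B'. ring.
Qed.

(* If the ratio A / B takes the same value at y_i and at y_j, it is locally
   constant because y_i and y_j are independent. *)
Lemma ratio_locally_const (A B A1 B1 : C -> C) p i :
  Omega p -> locally3 p (fun q => forall i j, i <> j -> A (yc i q) * B (yc j q) = B (yc i q) * A
    (yc j q)) ->
  locally3 p (fun q => forall i, has_cderiv A (yc i q) (A1 (yc i q)) /\ has_cderiv B (yc i q) (B1
    (yc i q))
     /\ B (yc i q) <> 0) ->
  locally3 p (fun q => A (yc i q) / B (yc i q) = A (yc i p) / B (yc i p)).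
Proof.
intros Hp H HD. apply (@has_rdiff_0_locally_const C3_R (fun q => A (yc i q) / B (yc i q))).
pose proof (@locally_locally C3_R _ _ H) as H'.
pose proof (@filter_and C3_R (locally3 p) _ _ _ (Omega_locally p Hp) (@filter_and C3_R (locally3
  p) _ _ _ H' HD)) as K.
revert K. apply filter_imp. intros q [Hq [Lq Dq]].
destruct (Dq i) as [DA [DB NB]].
eapply has_rdiff_ext_lin.
- exact (has_cderiv_comp _ (fun z => A z / B z) q _ _ (cs_dy S q i Hq) (has_cderiv_div _ _ _ _ _
    NB DA DB)).
- intros v. cbv beta. destruct (exists_other i) as [j Hij].
  destruct (Dq j) as [DA' [DB' NB']].
  destruct (separate_derivatives A B B A A1 B1 B1 A1 q i j Hij Hq) as [K _]; auto.
  { revert Lq. apply filter_imp. intros q' Hq'. now apply Hq'. }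
  pose proof (locally_singleton _ _ Lq i j Hij) as K0.
  assert (Z : A1 (yc i q) * B (yc i q) - A (yc i q) * B1 (yc i q) = 0).
  { apply (Cmult_reg_l (B (yc j q)) _ _ NB').
    transitivity ((A1 (yc i q) * B (yc j q)) * B (yc i q) - (A (yc i q) * B (yc j q)) * B1 (yc i
      q)); [ring|].
    rewrite K, K0. ring. }
  rewrite Z. unfold Cdiv. ring.
Qed.

(** [phi_psi] relates different coordinates only. It makes a suitable quotient independent of the
    coordinate, and [ratio_locally_const] then makes that quotient locally constant. *)
Lemma phi_multiple : exists lam : C3 -> C, forall p, nondeg p ->
  (forall i, phi (yc i p) = lam p * psi (yc i p)) /\ locally3 p (fun q => lam q = lam p).
Proof.
destruct phi_derivatives as [phi1 [phi2 Hphi]].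
assert (HD : forall p i, nondeg p -> has_cderiv phi (yc i p) (phi1 (yc i p)) /\
   has_cderiv phi1 (yc i p) (phi2 (yc i p))).
{ intros p i Np. apply Hphi. now apply y_nondeg_i. }
destruct (cs_case S) as [N|N].
- exists (fun p => phi (yc I1 p) / psi (yc I1 p)). intros p Np. pose proof (proj1 Np) as Hp. split.
  + intros i. destruct (classic (I1 = i)) as [<-|Hi].
    * field. now apply N.
    * apply (Cmult_reg_l (psi (yc I1 p))); [now apply N|].
      transitivity (phi (yc I1 p) * psi (yc i p)); [|field; now apply N].
      rewrite (phi_psi p I1 i Np Hi). ring.
  + apply (ratio_locally_const phi psi phi1 psi1 p I1 Hp).
    * generalize (proj2 (nondeg_locally p Np)). apply filter_imp. intros q Nq i j Hij.
      rewrite (phi_psi q i j Nq Hij). ring.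
    * generalize (proj2 (nondeg_locally p Np)). apply filter_imp. intros q Nq i.
      pose proof (proj1 Nq) as Hq.
      split; [now apply HD | split; [now apply (cs_dpsi S) | now apply N]].
(* Here psi may vanish, so [phi_psi] is differentiated in y_i, then in y_j. The result [K2]
   identifies the quotients phi1 / psi1 at all coordinates, and [K1] shows that their common value
   is also the factor between phi and psi. *)
- assert (K1 : forall p i j, nondeg p -> i <> j -> phi1 (yc i p) * psi (yc j p) = psi1 (yc i p) *
    phi (yc j p)).
  { intros p i j Np Hij. pose proof (proj1 Np) as Hp.
    apply (separate_derivatives phi psi psi phi phi1 psi1 psi1 phi1 p i j Hij Hp);
      try (now apply HD); try (now apply (cs_dpsi S)).
    generalize (proj2 (nondeg_locally p Np)). apply filter_imp. intros q Nq.
    rewrite (phi_psi q i j Nq Hij). ring. }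
  assert (K2 : forall p i j, nondeg p -> i <> j -> phi1 (yc i p) * psi1 (yc j p) = psi1 (yc i p)
    * phi1 (yc j p)).
  { intros p i j Np Hij. pose proof (proj1 Np) as Hp.
    apply (separate_derivatives phi1 psi psi1 phi phi2 psi1 psi2 phi1 p i j Hij Hp);
      try (now apply HD); try (now apply (cs_dpsi S)); try (now apply (cs_dpsi1 S)).
    generalize (proj2 (nondeg_locally p Np)). apply filter_imp. intros q Nq. now apply K1. }
  exists (fun p => phi1 (yc I1 p) / psi1 (yc I1 p)). intros p Np. pose proof (proj1 Np) as Hp.
    split.
  + intros j. destruct (exists_other j) as [i Hij].
    assert (R : phi1 (yc i p) / psi1 (yc i p) = phi1 (yc I1 p) / psi1 (yc I1 p)).
    { destruct (classic (I1 = i)) as [<-|Hi]; [reflexivity|].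
      apply (Cmult_reg_l (psi1 (yc I1 p) * psi1 (yc i p))).
      apply Cmult_neq_0; now apply N.
      transitivity (psi1 (yc I1 p) * phi1 (yc i p)); [field; now apply N|].
      rewrite <- (K2 p I1 i Np Hi). field. now apply N. }
    rewrite <- R. apply (Cmult_reg_l (psi1 (yc i p))); [now apply N|].
    rewrite <- (K1 p i j Np); [|congruence]. field. now apply N.
  + apply (ratio_locally_const phi1 psi1 phi2 psi2 p I1 Hp).
    * generalize (proj2 (nondeg_locally p Np)). apply filter_imp. intros q Nq i j Hij. now apply K2.
    * generalize (proj2 (nondeg_locally p Np)). apply filter_imp. intros q Nq i.
      pose proof (proj1 Nq) as Hq.
      split; [now apply HD | split; [now apply (cs_dpsi1 S) | now apply N]].
Qed.

(** Origin of the exponent -lambda - 1: in the direction dual to u_i, subtracting lam times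
    [log_sine] from [log_coef] removes all dy terms and leaves gphi + theta = -lam theta. *)
Lemma gphi_multiple lam p : nondeg p ->
  (forall i, phi (yc i p) = lam * psi (yc i p)) ->
  forall i, gphi (u i p) = (- lam - 1) * theta (u i p).
Proof.
intros Np H i. pose proof (proj1 Np) as Hp. destruct (exists_other i) as [j Hij].
destruct (cs_dual S i 1) as [v [v1 v2]].
pose proof (log_coef p i j v Np) as A. pose proof (log_sine p i j v Hp) as B.
rewrite (H i), (H j), v1, (v2 j) in A by congruence. rewrite v1, (v2 j) in B by congruence.
apply Ceq_minus.
match type of A with ?a = ?b => match type of B with ?c = ?d =>
  transitivity ((a - b) - lam * (c - d)); [ring | rewrite A, B; ring] end end.
Qed.

(** By [gphi_multiple] the logarithmic differential of [form_coef] is lam (psi dy_1 - theta du_1),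
    that is lam d(L(y_1) - M(u_1)). *)
Lemma log_transport lam (L M : C -> C) p :
  nondeg p -> (forall i, phi (yc i p) = lam * psi (yc i p)) ->
  has_cderiv L (yc I1 p) (psi (yc I1 p)) -> has_cderiv M (u I1 p) (theta (u I1 p)) ->
  has_rdiff3 (fun q => form_coef I1 q * Cexp (- lam * (L (yc I1 q) - M (u I1 q)))) p (fun _ => 0).
Proof.
intros Np Hphi HL HM. pose proof (proj1 Np) as Hp.
pose proof (gphi_multiple lam p Np Hphi I1) as Hgam.
assert (D : has_rdiff3 (form_coef I1) p
  (fun v => form_coef I1 p * (phi (yc I1 p) * dycoord I1 p v + (gphi (u I1 p) + theta (u I1 p)) *
    u I1 v)))
  by now apply has_rdiff_form_coef.
pose proof (has_cderiv_comp _ L p _ _ (cs_dy S p I1 Hp) HL) as DL.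
pose proof (has_cderiv_comp _ M p _ _ (has_rdiff_u I1 p) HM) as DM.
pose proof (has_rdiff_cmult_l (- lam) _ _ _ (has_rdiff_minus _ _ _ _ _ DL DM)) as DE.
pose proof (has_cderiv_comp _ Cexp p _ _ DE (has_cderiv_Cexp _)) as DX.
eapply has_rdiff_ext_lin. exact (has_rdiff_mult _ _ _ _ _ D DX).
intros v. cbv beta. rewrite Hgam, (Hphi I1). ring.
Qed.

(* Along a segment form_coef I1 is a constant multiple of the exponential of
   lam (L (y_1) - M (u_1)), L = log sg and M = log tu, as long as lam keeps its
   value, so it cannot tend to zero inside Omega. *)
Lemma propagation p0 : nondeg p0 ->
  exists lam, forall p, Omega p -> nondeg p /\ forall i, phi (yc i p) = lam * psi (yc i p).
Proof.
intros N0. destruct phi_multiple as [lam Hlam]. exists (lam p0).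
assert (K : forall p, Omega p -> nondeg p /\ lam p = lam p0).
2: { intros p Hp. destruct (K p Hp) as [Np E']. split; [exact Np|].
  intros i. rewrite <- E'. now apply Hlam. }
apply (connected_clopen Omega (fun p => nondeg p /\ lam p = lam p0) p0
  (cs_open S) (cs_connected S)); [| |exact (proj1 N0) | now split].
{ intros p Hp [Np Ep]. apply (@filter_and C3_R (locally3 p) (@filter_filter _ _ (locally_filter
  p))).
  now apply nondeg_locally. rewrite <- Ep. now apply Hlam. }
intros p1 Hp1 Hd.
set (z1 := yc I1 p1). set (s1 := u I1 p1).
assert (LL : exists L, locallyC z1 (fun t => continuousC L t /\ Cexp (L t) = sg t /\ has_cderiv L
  t (psi t))).
{ apply locally_log; [|now apply (cs_sg S)].
  assert (Y : locallyC z1 (fun w => exists i p, Omega p /\ w = yc i p)).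
  { apply (y_image_open Omega). intros p Hp. split; [exact Hp | now apply Omega_locally]. now
    exists I1, p1. }
  revert Y. apply filter_imp. intros w [i [p [Hp ->]]]. now apply (cs_dsg S). }
assert (MM : exists M, locallyC s1 (fun t => continuousC M t /\ Cexp (M t) = tu t /\ has_cderiv M
  t (theta t))).
{ apply locally_log; [|now apply (cs_tu S)].
  assert (Y : locallyC s1 (fun w => exists i p, Omega p /\ w = u i p)).
  { apply (u_image_open Omega). intros p Hp. split; [exact Hp | now apply Omega_locally]. now
    exists I1, p1. }
  revert Y. apply filter_imp. intros w [i [p [Hp ->]]]. now apply (cs_dtu S). }
destruct LL as [L HL]. destruct MM as [M HM].
pose proof (continuous_y I1 p1 Hp1 _ HL) as HL'. pose proof (continuous_u I1 p1 _ HM) as HM'.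
pose proof (@filter_and C3_R (locally3 p1) _ _ _ (Omega_locally p1 Hp1)
  (@filter_and C3_R (locally3 p1) _ _ _ HL' HM')) as HN.
destruct (proj1 (@locally_norm_iff C3_R _ _) HN) as [eps Heps].
destruct (Hd (fun q => (norm (@minus C3_R q p1) < eps)%R)) as [q [Hq [Oq [Nq Eq]]]].
{ apply (@locally_norm_iff C3_R). exists eps. auto. }
set (w := @minus C3_R q p1).
set (c := fun s : R => @plus C3_R p1 (scal s w)).
assert (c1 : c 1%R = q) by (exact (@segment_1 C3_R p1 q)).
assert (c0 : c 0%R = p1) by (exact (@segment_0 C3_R p1 q)).
assert (Hc : forall s, (0 <= s <= 1)%R -> Omega (c s) /\
  has_cderiv L (yc I1 (c s)) (psi (yc I1 (c s))) /\ has_cderiv M (u I1 (c s)) (theta (u I1 (c s)))).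
{ intros s Hs. destruct (Heps (c s)) as [A [[_ [_ B]] [_ [_ D]]]].
  - eapply Rle_lt_trans; [exact (@norm_segment C3_R p1 q s Hs) | exact Hq].
  - split; [exact A|]. split; [exact B | exact D]. }
assert (Cc : forall s, @continuous R_UniformSpace C3_R c s).
{ intros s. exact (@filterdiff_continuous R_AbsRing R_NormedModule C3_R c s
    (ex_intro _ _ (@filterdiff_line C3_R p1 w s))). }
set (e := fun s => form_coef I1 (c s) * Cexp (- lam p0 * (L (yc I1 (c s)) - M (u I1 (c s))))).
assert (De : forall s, (0 <= s <= 1)%R -> nondeg (c s) -> lam (c s) = lam p0 ->
  @is_derive R_AbsRing C_R e s zero).
{ intros s Hs Ns Es. destruct (Hc s Hs) as [A [B D]].
  eapply filterdiff_ext_lin.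
  - refine (@has_rdiff_line C3_R (fun q => form_coef I1 q * Cexp (- lam p0 * (L (yc I1 q) - M (u
      I1 q)))) p1 w s (fun _ => 0) _).
    apply log_transport; auto. rewrite <- Es. now apply Hlam.
  - intros t. cbv beta. rewrite Cmult_0_r. symmetry. apply (@scal_zero_r R_AbsRing C_R). }
assert (Ce : forall s, (0 <= s <= 1)%R -> @continuous R_UniformSpace C_UniformSpace e s).
{ intros s Hs. destruct (Hc s Hs) as [A [B D]].
  apply (@continuous_comp R_UniformSpace C3_R C_UniformSpace c (fun q => form_coef I1 q * Cexp (-
    lam p0 * (L (yc I1 q) - M (u I1 q))))).
  apply Cc. apply (@continuous_Cmult C3_R). now apply continuous_form_coef.
  apply (@continuous_Ccomp C3_R). apply (@continuous_Cmult C3_R). apply continuous_Cconst.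
  apply (@continuous_Cplus C3_R). apply (@continuous_Ccomp C3_R). now apply continuous_y.
  exact (has_cderiv_continuous _ _ _ B). apply (@continuous_Copp C3_R).
  apply (@continuous_Ccomp C3_R). apply continuous_u. exact (has_cderiv_continuous _ _ _ D).
  exact (has_cderiv_continuous _ _ _ (has_cderiv_Cexp _)). }
(* The induction starts at the nondegenerate point q = c 1 and ends at the limit point p1 = c 0,
   hence the parameter 1 - t. *)
assert (All : forall t, (0 <= t <= 1)%R -> nondeg (c (1 - t)%R) /\ lam (c (1 - t)%R) = lam p0).
2: { assert (H1 : (0 <= 1 <= 1)%R) by lra. specialize (All 1%R H1). replace (1 - 1)%R with 0%R in
  All by ring. now rewrite c0 in All. }
apply real_induction.
- intros t Ht Hlt.
  destruct (Req_dec t 0) as [->|Nt].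
  { replace (1 - 0)%R with 1%R by ring. rewrite c1. now split. }
  assert (Ec : forall s, (1 - t < s <= 1)%R -> e s = e 1%R).
  { intros s Hs. destruct (Req_dec s 1) as [->|N1]; [reflexivity|].
    apply (@eq_is_derive C_R e s 1); [|lra].
    intros r Hr. assert (Hr1 : (0 <= 1 - r < t)%R) by lra.
    destruct (Hlt (1 - r)%R Hr1) as [A B].
    replace (1 - (1 - r))%R with r in A, B by ring. apply De; [lra | exact A | exact B]. }
  assert (E1 : e 1%R <> 0).
  { unfold e. rewrite c1. apply Cmult_neq_0; [exact (proj2 Nq) | apply Cexp_neq_0]. }
  (* [e] is constant to the right of 1 - t and continuous there, so it keeps its non-zero value; as
     the exponential factor is finite, [form_coef] cannot vanish. *)
  assert (Et : e (1 - t)%R = e 1%R).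
  { apply NNPP. intros N.
    assert (Ht1 : (0 <= 1 - t <= 1)%R) by lra.
    pose proof (@neq_locally R_UniformSpace e (1 - t)%R _ (Ce _ Ht1) N) as [d Hd'].
    pose proof (cond_pos d) as Pd.
    set (s := (1 - t + Rmin (d / 2) t)%R).
    assert (Hs : (1 - t < s <= 1 /\ s - (1 - t) < d)%R).
    { unfold s. pose proof (Rmin_l (d / 2) t). pose proof (Rmin_r (d / 2) t).
      assert (0 < Rmin (d / 2) t)%R by (apply Rmin_glb_lt; lra). lra. }
    apply (Hd' s); [|apply Ec; lra].
    change (Rabs (s - (1 - t)) < d)%R. rewrite Rabs_pos_eq; lra. }
  assert (Nd : nondeg (c (1 - t)%R)).
  { split; [apply Hc; lra|]. intros Z. apply E1. rewrite <- Et. unfold e. rewrite Z. ring. }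
  split; [exact Nd|].
  pose proof (Cc (1 - t)%R _ (proj2 (Hlam _ Nd))) as [d Hd'].
  pose proof (cond_pos d) as Pd.
  set (s := (t - Rmin (d / 2) t)%R).
  assert (Hs : (0 <= s < t /\ t - s < d)%R).
  { unfold s. pose proof (Rmin_l (d / 2) t). pose proof (Rmin_r (d / 2) t).
    assert (0 < Rmin (d / 2) t)%R by (apply Rmin_glb_lt; lra). lra. }
  rewrite <- (proj2 (Hlt s (proj1 Hs))). symmetry. apply Hd'.
  change (Rabs (1 - s - (1 - t)) < d)%R. rewrite Rabs_pos_eq; lra.
- intros t Ht [Nt Et].
  assert (Op : locally3 (c (1 - t)%R) (fun r => nondeg r /\ lam r = lam p0)).
  { apply (@filter_and C3_R (locally3 (c (1 - t)%R)) (@filter_filter _ _ (locally_filter _))).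
    now apply nondeg_locally.
    rewrite <- Et. now apply Hlam. }
  pose proof (Cc (1 - t)%R _ Op) as [d Hd']. exists d. intros s Hs Hst. apply Hd'.
  change (Rabs (1 - s - (1 - t)) < d)%R. replace (1 - s - (1 - t))%R with (- (s - t))%R by ring.
  now rewrite Rabs_Ropp.
Qed.

Lemma classification : (exists p i, Omega p /\ dz f (yc i p) <> 0 /\ dz g (u i p) <> 0) ->
  exists (lam c : C) (F G F1 G1 : C -> C), c <> 0 /\
    power_branch (y_values Omega y) sg lam F1 /\
    power_branch (values Omega u) tu (- lam - 1) G1 /\
    (forall z, y_values Omega y z -> has_cderiv F z (F1 z)) /\
    (forall z, values Omega u z -> has_cderiv G z (G1 z)) /\
    form_eq Omega (fdg_form f g y u) (form_scale c (fdg_form F G y u)).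
Proof.
intros [p [i [Hp [Nf Ng]]]].
assert (Np : nondeg p).
{ split; [exact Hp|]. rewrite (form_coef_indep p I1 i Hp). unfold form_coef.
  apply Cmult_neq_0; [now apply Cmult_neq_0 | now apply (cs_tu S)]. }
destruct (propagation p Np) as [lam Hlam].
destruct (cs_base S) as [p0 [Hp0 Hb]].
assert (Wy : forall z, y_values Omega y z -> exists i p, nondeg p /\ z = yc i p).
{ intros z [k [q [Hq ->]]]. exists k, q. split; [now apply Hlam | reflexivity]. }
assert (Wu : forall z, values Omega u z -> exists i p, nondeg p /\ z = u i p).
{ intros z [k [q [Hq ->]]]. exists k, q. split; [now apply Hlam | reflexivity]. }
(* f' satisfies h' = lam psi h, so it is a constant c1 times a branch of sg^lam; g' is likewise c2
   times a branch of tu^(-lam-1). The scaling factor of the form is c1 c2. *)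
destruct (power_branch_exists Omega (fun i q => yc i q) sg psi (Cder f) lam p0) as [c1 [Nc1 Hc1]].
{ apply (cs_open S). } { apply (cs_connected S). } { intros k q. apply continuous_y. }
{ exact Hp0. } { intros k l. apply Hb. }
{ apply y_values_open. }
{ intros t [k [q [Hq ->]]]. split; [now apply (cs_sg S) | now apply (cs_dsg S)]. }
{ intros t [k [q [Hq ->]]]. destruct (Hlam q Hq) as [Nq Eq]. split; [now apply Cder_f_neq_0|].
  eapply has_cderiv_ext_d. exact (hol_has_cderiv _ _ _ hol_Cder_f (y_nondeg_i k q Nq)).
  rewrite <- (Eq k). unfold phi. field. now apply Cder_f_neq_0. }
destruct (power_branch_exists Omega u tu theta (Cder g) (- lam - 1) p0) as [c2 [Nc2 Hc2]].
{ apply (cs_open S). } { apply (cs_connected S). } { intros k q _. apply continuous_u. }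
{ exact Hp0. } { intros k l. apply Hb. }
{ apply u_values_open. }
{ intros t [k [q [Hq ->]]]. split; [now apply (cs_tu S) | now apply (cs_dtu S)]. }
{ intros t [k [q [Hq ->]]]. destruct (Hlam q Hq) as [Nq Eq]. split; [now apply Cder_g_neq_0|].
  eapply has_cderiv_ext_d. exact (hol_has_cderiv _ _ _ hol_Cder_g (u_nondeg_i k q Nq)).
  rewrite <- (gphi_multiple lam q Nq Eq k). unfold gphi. field. now apply Cder_g_neq_0. }
assert (Df : forall z, y_values Omega y z -> has_cderiv (fun z => f z / c1) z (Cder f z / c1)).
{ intros z Hz. destruct (Wy z Hz) as [k [q [Nq ->]]].
  eapply has_cderiv_ext_d. apply has_cderiv_div; [exact Nc1 | | apply has_cderiv_const].
  exact (hol_has_cderiv _ _ _ hol_f (y_nondeg_i k q Nq)). cbv beta. field. exact Nc1. }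
assert (Dg : forall z, values Omega u z -> has_cderiv g z (Cder g z) /\ has_cderiv (fun z => g z
  / c2) z (Cder g z / c2)).
{ intros z Hz. destruct (Wu z Hz) as [k [q [Nq ->]]].
  pose proof (hol_has_cderiv _ _ _ hol_g (u_nondeg_i k q Nq)) as D. split; [exact D|].
  eapply has_cderiv_ext_d. apply has_cderiv_div; [exact Nc2 | exact D | apply has_cderiv_const].
  cbv beta. field. exact Nc2. }
exists lam, (c1 * c2), (fun z => f z / c1), (fun z => g z / c2), (fun z => Cder f z / c1), (fun z
  => Cder g z / c2).
split; [now apply Cmult_neq_0|]. split; [exact Hc1|]. split; [exact Hc2|].
split; [exact Df|]. split; [intros z Hz; now apply Dg|].
intros q v Hq. unfold form_scale. rewrite !fdg_form_u.
assert (R : forall k, rdiffC g (u k q) (u k v) = c2 * rdiffC (fun z : C => g z / c2) (u k q) (u k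
  v)).
{ intros k. destruct (Dg (u k q)) as [D1 D2]. now exists k, q.
  rewrite (has_cderiv_rdiff _ _ _ (u k v) D1), (has_cderiv_rdiff _ _ _ (u k v) D2). field. exact
    Nc2. }
unfold sum3. rewrite !R. field. exact Nc1.
Qed.
End Closed.

(** * The converse: forms built from powers are closed and holomorphic *)

Section Power.
Variables (lam : C) (F G F1 G1 : C -> C).
Hypotheses (BF : power_branch (y_values Omega y) sg lam F1)
  (BG : power_branch (values Omega u) tu (- lam - 1) G1).
Hypotheses (DF : forall z, y_values Omega y z -> has_cderiv F z (F1 z))
  (DG : forall z, values Omega u z -> has_cderiv G z (G1 z)).

Lemma branch_y p i : Omega p ->
  has_cderiv F1 (yc i p) (lam * psi (yc i p) * F1 (yc i p)) /\ F1 (yc i p) <> 0.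
Proof.
intros Hp. apply (power_branch_has_cderiv (y_values Omega y) sg psi F1 lam).
- apply y_values_open.
- now exists i, p.
- intros t [k [q [Hq ->]]]. now apply (cs_dsg S).
- exact BF.
Qed.

Lemma branch_u p i : Omega p ->
  has_cderiv G1 (u i p) ((- lam - 1) * theta (u i p) * G1 (u i p)) /\ G1 (u i p) <> 0.
Proof.
intros Hp. apply (power_branch_has_cderiv (values Omega u) tu theta G1 (- lam - 1)).
- apply u_values_open.
- now exists i, p.
- intros t [k [q [Hq ->]]]. now apply (cs_dtu S).
- exact BG.
Qed.

Lemma power_form p v : Omega p ->
  fdg_form F G y u p v = sum3 (fun i => F (yc i p) * G1 (u i p) * u i v).
Proof.
intros Hp. rewrite fdg_form_u. apply sum3_ext. intros i.
rewrite (has_cderiv_rdiff _ _ _ (u i v) (DG (u i p) (ex_intro _ i (ex_intro _ p (conj Hp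
  eq_refl))))). ring.
Qed.

Lemma has_rdiff_power_coef p i : Omega p -> has_rdiff3 (fun q => F (yc i q) * G1 (u i q)) p
  (fun w => F1 (yc i p) * dycoord i p w * G1 (u i p) +
    F (yc i p) * ((- lam - 1) * theta (u i p) * G1 (u i p) * u i w)).
Proof.
intros Hp. apply (@has_rdiff_mult C3_R (fun q => F (yc i q)) (fun q => G1 (u i q)) p
  (fun w => F1 (yc i p) * dycoord i p w) (fun w => (- lam - 1) * theta (u i p) * G1 (u i p) * u i
    w)).
- apply (has_cderiv_comp (fun q => yc i q) F); [exact (cs_dy S p i Hp)|]. apply DF. now exists i, p.
- apply (has_cderiv_comp (u i) G1); [exact (has_rdiff_u i p)|]. now apply branch_u.
Qed.

Lemma has_rdiff_power_form p v : Omega p ->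
  has_rdiff3 (fun q => fdg_form F G y u q v) p
    (fun w => sum3 (fun i => (F1 (yc i p) * dycoord i p w * G1 (u i p) +
    F (yc i p) * ((- lam - 1) * theta (u i p) * G1 (u i p) * u i w)) * u i v)).
Proof.
intros Hp.
apply (@has_rdiff_ext_loc C3_R (fun q => sum3 (fun i => F (yc i q) * G1 (u i q) * u i v))).
- apply (Omega_locally_imp p _ Hp). intros q Hq. symmetry. now apply power_form.
- apply has_rdiff_sum3. intros i.
  eapply has_rdiff_ext_lin.
  + apply (@has_rdiff_mult C3_R (fun q => F (yc i q) * G1 (u i q)) (fun _ => u i v)).
    now apply has_rdiff_power_coef. apply has_rdiff_const.
  + intros w. cbv beta. ring.
Qed.

(** The exponents lam and -lam - 1, with the extra factor tu, give each product the logarithmic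
    differential lam (psi dy_i - theta du_i), the same for all i by [log_sine]. So the quotients are
    constant, and they are 1 at the base point. *)
Lemma power_coef_indep p i j : Omega p ->
  F1 (yc i p) * G1 (u i p) * tu (u i p) = F1 (yc j p) * G1 (u j p) * tu (u j p).
Proof.
intros Hp.
set (Q := fun k q => F1 (yc k q) * G1 (u k q) * tu (u k q)).
assert (N : forall k q, Omega q -> Q k q <> 0).
{ intros k q Hq. unfold Q. apply Cmult_neq_0; [|now apply (cs_tu S)].
  apply Cmult_neq_0; [now apply branch_y | now apply branch_u]. }
assert (D : forall k q, Omega q -> has_rdiff3 (Q k) q
  (fun v => lam * (psi (yc k q) * dycoord k q v - theta (u k q) * u k v) * Q k q)).
{ intros k q Hq. eapply has_rdiff_ext_lin.
  - apply (@has_rdiff_mult C3_R). apply (@has_rdiff_mult C3_R).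
    + exact (has_cderiv_comp _ F1 q _ _ (cs_dy S q k Hq) (proj1 (branch_y q k Hq))).
    + exact (has_cderiv_comp _ G1 q _ _ (has_rdiff_u k q) (proj1 (branch_u q k Hq))).
    + exact (has_cderiv_comp _ tu q _ _ (has_rdiff_u k q) (cs_dtu S q k Hq)).
  - intros v. cbv beta. unfold Q. ring. }
assert (K : Q i p / Q j p = 1).
{ destruct (cs_base S) as [p0 [Hp0 Hb]].
  transitivity (Q i p0 / Q j p0).
  - apply (has_rdiff_0_const Omega (fun q => Q i q / Q j q) (cs_open S) (cs_connected S));
      [|exact Hp | exact Hp0].
    intros q Hq. eapply has_rdiff_ext_lin.
    + exact (has_rdiff_div _ _ _ _ _ (N j q Hq) (D i q Hq) (D j q Hq)).
    + intros v. cbv beta. pose proof (log_sine q i j v Hq) as Sn.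
      replace (psi (yc i q) * dycoord i q v - theta (u i q) * u i v) with
        (psi (yc j q) * dycoord j q v - theta (u j q) * u j v).
      field. now apply N.
      apply Ceq_minus. ring_diff_rev Sn.
  - replace (Q i p0) with (Q j p0); [field; now apply N|].
    unfold Q. now destruct (Hb i j) as [-> ->]. }
change (Q i p = Q j p).
transitivity (Q i p / Q j p * Q j p); [field; now apply N|].
rewrite K. ring.
Qed.

Lemma clinear_dycoord i p : clinear (dycoord i p).
Proof.
unfold dycoord. apply clinear_scal. unfold sum3.
apply clinear_plus; [apply clinear_plus|]; apply clinear_scal, (cs_clinear S).
Qed.

Lemma holomorphic_power_coef i : holomorphic_fun Omega (fun q => F (yc i q) * G1 (u i q)).
Proof.
intros p Hp. apply ex_filterdiff_C3. eexists. split; [|exact (has_rdiff_power_coef p i Hp)].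
assert (E1 : clinear (fun w => (F1 (yc i p) * G1 (u i p)) * dycoord i p w +
  (F (yc i p) * ((- lam - 1) * theta (u i p) * G1 (u i p))) * u i w)).
{ apply clinear_plus; apply clinear_scal; [apply clinear_dycoord | apply (cs_clinear S)]. }
destruct E1 as [a Ha]. exists a. intros v. rewrite <- Ha. ring.
Qed.

Lemma holomorphic_power_form : holomorphic_form Omega (fdg_form F G y u).
Proof.
destruct (cs_clinear S I1) as [a1 H1]. destruct (cs_clinear S I2) as [a2 H2].
destruct (cs_clinear S I3) as [a3 H3].
(* The form is first a combination of the du_i; with u_i = sum_j a_i(j) x_j this is its coefficient
   along dx_j. *)
exists (fun j q => F (yc I1 q) * G1 (u I1 q) * a1 j + F (yc I2 q) * G1 (u I2 q) * a2 j +
   F (yc I3 q) * G1 (u I3 q) * a3 j). split.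
- intros j p Hp. apply ex_filterdiff_C3.
  pose proof (fun i => proj1 (ex_filterdiff_C3 _ _) (holomorphic_power_coef i p Hp)) as K.
  destruct (K I1) as [l1 [L1 D1]]. destruct (K I2) as [l2 [L2 D2]]. destruct (K I3) as [l3 [L3 D3]].
  exists (fun v => a1 j * l1 v + a2 j * l2 v + a3 j * l3 v). split.
  + apply clinear_plus; [apply clinear_plus|]; now apply clinear_scal.
  + apply (@has_rdiff_ext C3_R (fun q => a1 j * (F (yc I1 q) * G1 (u I1 q)) +
      a2 j * (F (yc I2 q) * G1 (u I2 q)) + a3 j * (F (yc I3 q) * G1 (u I3 q)))).
    intros q. ring.
    exact (has_rdiff_plus _ _ _ _ _ (has_rdiff_plus _ _ _ _ _
      (has_rdiff_cmult_l (a1 j) _ _ _ D1) (has_rdiff_cmult_l (a2 j) _ _ _ D2))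
      (has_rdiff_cmult_l (a3 j) _ _ _ D3)).
- intros p v Hp. rewrite power_form by exact Hp. unfold sum3 at 1. rewrite (H1 v), (H2 v), (H3 v).
  unfold sum3. ring.
Qed.

(** The derivative of the form contributes H / mu times the bilinear form of E, with H independent
    of the index, and a diagonal part from G1'. Both are symmetric in the two vectors, the first
    because E is. *)
Lemma closed_power_form : closed_form Omega (fdg_form F G y u).
Proof.
split.
- intros v p Hp. eexists. exact (has_rdiff_power_form p v Hp).
- intros a b p Hp.
  etransitivity; [exact (has_rdiff_rdiff _ _ _ a (has_rdiff_power_form p b Hp))|].
  etransitivity; [|symmetry; exact (has_rdiff_rdiff _ _ _ b (has_rdiff_power_form p a Hp))].
  cbv beta.
  pose proof (power_coef_indep p I1 I2 Hp) as K2. pose proof (power_coef_indep p I1 I3 Hp) as K3.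
  set (H := F1 (yc I1 p) * G1 (u I1 p) * tu (u I1 p)) in *.
  assert (R : forall k w, (F1 (yc k p) * dycoord k p w * G1 (u k p)) =
    H / mu p * sum3 (fun j => E k j p * u j w)).
  { intros k w. unfold dycoord. destruct k; [unfold H | rewrite K2 | rewrite K3]; field; now
    apply (cs_mu S). }
  unfold sum3. rewrite !R. unfold sum3.
  rewrite (cs_sym S p I2 I1 Hp), (cs_sym S p I3 I1 Hp), (cs_sym S p I3 I2 Hp). ring.
Qed.

Lemma quotient_power_form : exists m,
  power_branch (values Omega u) tu (lam + 1) m /\
  form_eq Omega (fdg_form F G y u) (quotient_form F m y u).
Proof.
exists (fun t => / G1 t). split.
- pose proof (power_branch_inv _ _ _ _ BG) as K.
  now replace (- (- lam - 1)) with (lam + 1) in K by ring.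
- intros p v Hp. rewrite power_form by exact Hp. apply sum3_ext. intros i.
  assert (R : @rdiff C3_R (u i) p v = u i v) by exact (has_rdiff_rdiff _ _ _ v (has_rdiff_u i p)).
  cbv beta. rewrite R. field. now apply branch_u.
Qed.
End Power.

(** * Scaling, conjugation and the conclusion for a cosine system *)

Lemma holomorphic_form_scale (c : C) (w w' : Defs.form1) :
  form_eq Omega w (form_scale c w') -> holomorphic_form Omega w' -> holomorphic_form Omega w.
Proof.
intros Hw [P [HP Hw']]. exists (fun i p => c * P i p). split.
- intros i p Hp. apply ex_filterdiff_C3.
  destruct (proj1 (ex_filterdiff_C3 _ _) (HP i p Hp)) as [l [L D]].
  exists (fun v => c * l v). split; [now apply clinear_scal | exact (has_rdiff_cmult_l c _ _ _ D)].
- intros p v Hp. rewrite (Hw p v Hp). unfold form_scale. rewrite (Hw' p v Hp). unfold sum3. ring.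
Qed.

Lemma fdg_form_conj (f g : C -> C) p v :
  fdg_form (fun z => Cconj (f z)) (fun z => Cconj (g z)) y u p v = Cconj (fdg_form f g y u p v).
Proof.
unfold fdg_form, sum3. rewrite !Cplus_conj, !Cmult_conj.
now rewrite !(@rdiff_Cconj C3_R (fun q => g (u _ q))).
Qed.

Lemma closed_form_conj (w : Defs.form1) : closed_form Omega w -> closed_form Omega (form_conj w).
Proof.
intros [H1 H2]. unfold form_conj. split.
- intros v p Hp. destruct (H1 v p Hp) as [l Hl]. eexists. exact (has_rdiff_conj _ _ _ Hl).
- intros a b p Hp. rewrite !(@rdiff_Cconj C3_R (fun q => w q _)). f_equal. now apply H2.
Qed.

Theorem cosine_system_closed_forms :
  (forall f g : C -> C,
    smooth_nonconstant_pair Omega y u f g ->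
    closed_form Omega (fdg_form f g y u) ->
    (exists (lambda c : C) (F G : C -> C),
       c <> 0 /\
       power_antiderivative (y_values Omega y) sg lambda F /\
       power_antiderivative (values Omega u) tu (- lambda - 1) G /\
       (form_eq Omega (fdg_form f g y u) (form_scale c (fdg_form F G y u)) \/
        form_eq Omega (fdg_form f g y u)
          (form_scale c (form_conj (fdg_form F G y u))))) /\
    (holomorphic_form Omega (fdg_form f g y u) \/
     antiholomorphic_form Omega (fdg_form f g y u))) /\
  (forall (lambda : C) (F G : C -> C),
    power_antiderivative (y_values Omega y) sg lambda F ->
    power_antiderivative (values Omega u) tu (- lambda - 1) G ->
    closed_form Omega (fdg_form F G y u) /\
    exists m : C -> C,
      power_branch (values Omega u) tu (lambda + 1) m /\
      form_eq Omega (fdg_form F G y u) (quotient_form F m y u)).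
Proof.
split.
- intros f g [[U [HU [yU Hf]]] [[V [HV [uV Hg]]] Hn]] Hcl.
  destruct (nonconstant_coef f g U V HU HV yU uV Hf Hg Hcl Hn) as [p [i [Hp [[A B]|[A B]]]]].
  + destruct (classification f g U V HV yU uV Hf Hg Hcl)
      as [lam [c [F [G [F1 [G1 [Nc [BF [BG [DF [DG HE]]]]]]]]]]]; [now exists p, i|].
    pose proof (holomorphic_form_scale _ _ _ HE (holomorphic_power_form lam F G F1 G1 BG DF DG))
      as HH.
    split; [|now left]. exists lam, c, F, G. split; [exact Nc|].
    split; [exists F1; split; [exact BF | intros z Hz; now apply has_cderiv_is_derive, DF]|].
    split; [exists G1; split; [exact BG | intros z Hz; now apply has_cderiv_is_derive, DG]|].
    now left.
  (* Here f_zbar and g_zbar are non-zero. The conjugates of f and g define the conjugate form, and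
     the holomorphic case applies to them. *)
  + assert (Hcl' : closed_form Omega (fdg_form (fun z => Cconj (f z)) (fun z => Cconj (g z)) y u)).
    { replace (fdg_form (fun z => Cconj (f z)) (fun z => Cconj (g z)) y u) with (form_conj
      (fdg_form f g y u)).
      now apply closed_form_conj.
      apply functional_extensionality. intros q. apply functional_extensionality. intros v.
      symmetry. apply fdg_form_conj. }
    destruct (classification (fun z => Cconj (f z)) (fun z => Cconj (g z)) U V HV yU uV
       (smooth_conj U f Hf) (smooth_conj V g Hg) Hcl')
      as [lam [c [F [G [F1 [G1 [Nc [BF [BG [DF [DG HE]]]]]]]]]]].
    { exists p, i. split; [exact Hp|]. rewrite !dz_conj.
      split; intros Z; [apply A | apply B].
      - rewrite <- (Cconj_conj (dzbar f _)), Z. apply injective_projections; cbn; ring.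
      - rewrite <- (Cconj_conj (dzbar g _)), Z. apply injective_projections; cbn; ring. }
    assert (HE' : form_eq Omega (form_conj (fdg_form f g y u)) (form_scale c (fdg_form F G y u))).
    { intros q v Hq. rewrite <- (HE q v Hq). symmetry. apply fdg_form_conj. }
    split.
    * exists lam, (Cconj c), F, G. split.
      { intros Z. apply Nc. rewrite <- (Cconj_conj c), Z. apply injective_projections; cbn; ring. }
      split; [exists F1; split; [exact BF | intros z Hz; now apply has_cderiv_is_derive, DF]|].
      split; [exists G1; split; [exact BG | intros z Hz; now apply has_cderiv_is_derive, DG]|].
      right. intros q v Hq. unfold form_scale, form_conj. rewrite <- Cmult_conj.
      change (c * fdg_form F G y u q v) with (form_scale c (fdg_form F G y u) q v).
      rewrite <- (HE' q v Hq). unfold form_conj. now rewrite Cconj_conj.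
    * right. exact (holomorphic_form_scale _ _ _ HE' (holomorphic_power_form lam F G F1 G1 BG DF
      DG)).
- intros lam F G [F1 [BF DF]] [G1 [BG DG]].
  assert (DF' : forall z, y_values Omega y z -> has_cderiv F z (F1 z)) by (intros z Hz; now apply
    has_cderiv_is_derive, DF).
  assert (DG' : forall z, values Omega u z -> has_cderiv G z (G1 z)) by (intros z Hz; now apply
    has_cderiv_is_derive, DG).
  split.
  + exact (closed_power_form lam F G F1 G1 BF BG DF' DG').
  + exact (quotient_power_form lam F G G1 BG DG').
Qed.

End System.

(** * The cosine law function *)

Lemma Ccos_plus a b : Ccos (a + b) = Ccos a * Ccos b - Csin a * Csin b.
Proof.
unfold Ccos, Csin. rewrite !Cexp_opp.
replace (Ci * (a + b)) with (Ci * a + Ci * b) by ring. rewrite Cexp_plus.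
set (e := Cexp (Ci * a)). set (f := Cexp (Ci * b)).
assert (Ne : e <> 0) by apply Cexp_neq_0. assert (Nf : f <> 0) by apply Cexp_neq_0.
replace ((e - / e) / (2 * Ci) * ((f - / f) / (2 * Ci))) with ((e - / e) * (f - / f) / (4 * (Ci *
  Ci)))
  by (field; repeat split; auto; apply Ci_nz).
rewrite Ci2. field. auto.
Qed.

Lemma Ccos_opp a : Ccos (- a) = Ccos a.
Proof.
unfold Ccos. replace (Ci * - a) with (- (Ci * a)) by ring.
replace (- - (Ci * a)) with (Ci * a) by ring. f_equal. ring.
Qed.

Lemma Csin_opp a : Csin (- a) = - Csin a.
Proof.
unfold Csin. replace (Ci * - a) with (- (Ci * a)) by ring.
replace (- - (Ci * a)) with (Ci * a) by ring. unfold Cdiv. ring.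
Qed.

Lemma Ccos_minus a b : Ccos (a - b) = Ccos a * Ccos b + Csin a * Csin b.
Proof. unfold Cminus. rewrite Ccos_plus, Ccos_opp, Csin_opp. ring. Qed.

Lemma Csin_half t : Csin t = 2 * Csin (t / 2) * Ccos (t / 2).
Proof.
unfold Ccos, Csin. rewrite !Cexp_opp.
replace (Ci * t) with (Ci * (t / 2) + Ci * (t / 2)) by field. rewrite Cexp_plus.
set (e := Cexp (Ci * (t / 2))). assert (Ne : e <> 0) by apply Cexp_neq_0.
field. auto using Ci_nz.
Qed.

Lemma Ccos_half t : Ccos t = 2 * (Ccos (t / 2) * Ccos (t / 2)) - 1.
Proof.
replace (Ccos t) with (Ccos (t / 2 + t / 2)) by (f_equal; field).
rewrite Ccos_plus. rewrite <- (Csin2_Ccos2 (t / 2)). ring.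
Qed.

Lemma Ctan_half t : Csin t <> 0 -> Ctan (t / 2) = Csin t / (1 + Ccos t).
Proof.
intros N. rewrite Ccos_half, Csin_half. rewrite Csin_half in N. unfold Ctan.
assert (Ccos (t / 2) <> 0). { intros Z. apply N. rewrite Z. ring. }
assert (1 + (2 * (Ccos (t / 2) * Ccos (t / 2)) - 1) <> 0).
{ replace (1 + (2 * (Ccos (t / 2) * Ccos (t / 2)) - 1)) with (2 * (Ccos (t / 2) * Ccos (t / 2)))
  by ring.
  apply Cmult_neq_0; [apply C2_nz | now apply Cmult_neq_0]. }
field. auto.
Qed.

Lemma Csin_factor t : (1 - Ccos t) * (1 + Ccos t) = Csin t * Csin t.
Proof.
transitivity (1 - Ccos t * Ccos t); [ring|]. rewrite <- (Csin2_Ccos2 t). ring.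
Qed.

Lemma one_plus_Ccos_neq_0 t : Csin t <> 0 -> 1 + Ccos t <> 0.
Proof.
intros N Z. apply (Cmult_neq_0 _ _ N N). rewrite <- Csin_factor, Z. ring.
Qed.

Lemma one_minus_Ccos_neq_0 t : Csin t <> 0 -> 1 - Ccos t <> 0.
Proof.
intros N Z. apply (Cmult_neq_0 _ _ N N). rewrite <- Csin_factor, Z. ring.
Qed.

(** The differential takes only real values, while complex linearity gives l(iv) = i l(v); both
    values are real only if l(v) = 0. *)
Lemma real_valued_differential (Z : C3 -> C) p l v :
  clinear l -> has_rdiff3 Z p l -> locally3 p (fun q => Z q = Cconj (Z q)) -> l v = 0.
Proof.
intros [a Ha] D H.
assert (R : forall w, l w = Cconj (l w)).
{ intros w. exact (@has_rdiff_eq C3_R Z (fun q => Cconj (Z q)) p l (fun w => Cconj (l w)) w H D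
  (has_rdiff_conj _ _ _ D)). }
pose (iv := ((Ci * coord I1 v, Ci * coord I2 v, Ci * coord I3 v) : C3)).
assert (Ei : l iv = Ci * l v).
{ rewrite !Ha. unfold sum3. cbn. ring. }
pose proof (R iv) as R2. rewrite Ei, Cmult_conj, <- R in R2.
replace (Cconj Ci) with (- Ci) in R2 by (apply injective_projections; cbn; ring).
destruct (Cmult_integral (2 * Ci) (l v)) as [N|]; [|exfalso; exact (two_Ci_nz N) | assumption].
transitivity (Ci * l v - - Ci * l v); [ring|]. rewrite <- R2. ring.
Qed.

Lemma locally3_coord (p : C3) (N : C3 -> Prop) :
  locally3 p N -> exists eps : posreal, forall q,
    (forall i, (Cmod (coord i q - coord i p) < eps)%R) -> N q.
Proof.
intros [e He]. exists e. intros q Hq. apply He.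
pose proof (Hq I1) as H1. pose proof (Hq I2) as H2. pose proof (Hq I3) as H3.
destruct q as [[q1 q2] q3], p as [[p1 p2] p3]. cbn in H1, H2, H3.
split; [split|]; cbn; apply C_NormedModule_mixin_compat1; assumption.
Qed.

Lemma continuous_coord i p : continuous3 (coord i) p.
Proof.
exact (has_rdiff_continuous _ _ _ (has_rdiff_linear _ p (clinear_is_linear _ (clinear_coord i)))).
Qed.

(** * The sine law and the differential of y *)

Section Law.
Variables (Omega : C3 -> Prop) (y : C3 -> C3).
Hypothesis Hy : cosine_law_function Omega y.
Notation yc i p := (coord i (y p)).
Notation cx i p := (Ccos (coord i p)).
Notation sx i p := (Csin (coord i p)).
Notation cy i p := (Ccos (coord i (y p))).
Notation sy i p := (Csin (coord i (y p))).

Lemma distinct3_exists i : exists j k, distinct3 i j k.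
Proof.
destruct i; [exists I2, I3 | exists I1, I3 | exists I1, I2]; repeat split; congruence.
Qed.

Lemma distinct3_rot i j k : distinct3 i j k -> distinct3 j k i.
Proof. unfold distinct3. intros [A [B D]]. repeat split; congruence. Qed.

Lemma distinct3_swap i j k : distinct3 i j k -> distinct3 j i k.
Proof. unfold distinct3. intros [A [B D]]. repeat split; congruence. Qed.

Lemma Csin_y_neq_0 p i : Omega p -> sy i p <> 0.
Proof.
intros Hp Z. destruct (distinct3_exists i) as [j [k D]].
apply (clf_nonzero _ _ Hy p i j k Hp D). rewrite Z. ring.
Qed.

Lemma Csin_x_neq_0 p i : Omega p -> sx i p <> 0.
Proof.
intros Hp Z. destruct (distinct3_exists i) as [j [k D]].
apply (clf_nonzero _ _ Hy p j i k Hp (distinct3_swap _ _ _ D)). rewrite Z. ring.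
Qed.

Lemma law_mult p i j k : Omega p -> distinct3 i j k ->
  cy i p * (sx j p * sx k p) =
  cx i p + cx j p * cx k p.
Proof.
intros Hp D. rewrite (clf_law _ _ Hy p i j k Hp D). field.
split; now apply Csin_x_neq_0.
Qed.

Lemma has_rdiff_y i p : Omega p -> exists l, clinear l /\ has_rdiff3 (fun q => yc i q) p l.
Proof. intros Hp. apply ex_filterdiff_C3. exact (clf_holomorphic _ _ Hy i p Hp). Qed.

Definition sine_product (i j k : index3) (p : C3) : C :=
  sy i p * sx j p * sx k p.

Lemma sine_product_neq_0 p i j k : Omega p -> sine_product i j k p <> 0.
Proof.
intros Hp. unfold sine_product. apply Cmult_neq_0; [apply Cmult_neq_0|].
now apply Csin_y_neq_0. now apply Csin_x_neq_0. now apply Csin_x_neq_0.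
Qed.

(** The right-hand side is symmetric in the three indices: it is the determinant of the symmetric
    matrix with diagonal 1 and off-diagonal entries -cos x_i, -cos x_j, -cos x_k. *)
Lemma sine_product_square p i j k : Omega p -> distinct3 i j k ->
  sine_product i j k p * sine_product i j k p =
  1 - cx i p * cx i p - cx j p * cx j p
    - cx k p * cx k p
    - 2 * cx i p * cx j p * cx k p.
Proof.
intros Hp D. pose proof (law_mult p i j k Hp D) as L. unfold sine_product.
set (sj := sx j p) in *. set (sk := sx k p) in *.
transitivity (sy i p * sy i p * (sj * sj) * (sk * sk)); [ring|].
rewrite <- (Csin_factor (yc i p)).
transitivity ((sj * sj) * (sk * sk) - (cy i p * (sj * sk)) * (cy i p * (sj * sk))); [ring|].
rewrite L. unfold sj, sk. rewrite <- !Csin_factor. ring.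
Qed.

Lemma has_rdiff_sine_product p i j k : Omega p -> exists l, has_rdiff3 (sine_product i j k) p l.
Proof.
intros Hp. destruct (has_rdiff_y i p Hp) as [l [_ Dl]].
pose proof (fun m => has_rdiff_linear _ p (clinear_is_linear _ (clinear_coord m))) as Dx.
eexists. apply (@has_rdiff_mult C3_R). apply (@has_rdiff_mult C3_R).
- exact (has_cderiv_comp _ Csin p _ _ Dl (has_cderiv_Csin _)).
- exact (has_cderiv_comp _ Csin p _ _ (Dx j) (has_cderiv_Csin _)).
- exact (has_cderiv_comp _ Csin p _ _ (Dx k) (has_cderiv_Csin _)).
Qed.

(* The squares agree and the signs agree at the base point. *)
Lemma sine_product_indep p i j k : Omega p -> distinct3 i j k ->
  sine_product i j k p = sine_product j i k p.
Proof.
intros Hp D.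
set (Q := fun q => sine_product i j k q / sine_product j i k q).
assert (N : forall q, Omega q -> sine_product j i k q <> 0) by (intros; now apply
  sine_product_neq_0).
assert (Q2 : forall q, Omega q -> Q q * Q q = 1).
{ intros q Hq. transitivity ((sine_product i j k q * sine_product i j k q) /
    (sine_product j i k q * sine_product j i k q)); [unfold Q; field; now apply N|].
  rewrite (sine_product_square q i j k Hq D).
  replace (1 - cx i q * cx i q - cx j q * cx j q -
    cx k q * cx k q - 2 * cx i q * cx j q * cx k q)
    with (sine_product j i k q * sine_product j i k q).
  - field. now apply N.
  - rewrite (sine_product_square q j i k Hq (distinct3_swap _ _ _ D)). ring. }
destruct (clf_base _ _ Hy) as [a [b [Hab Eab]]].
assert (Q1 : Q p = 1).
{ transitivity (Q (a, a, a)).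
  - apply (has_rdiff_0_const Omega Q (clf_open _ _ Hy) (clf_connected _ _ Hy)); [|exact Hp |
      exact Hab].
    intros q Hq. destruct (has_rdiff_sine_product q i j k Hq) as [l Dl].
    destruct (has_rdiff_sine_product q j i k Hq) as [l' Dl'].
    pose proof (has_rdiff_div _ _ _ _ _ (N q Hq) Dl Dl') as DQ. fold Q in DQ.
    eapply has_rdiff_ext_lin. exact DQ.
    intros v. cbv beta. match goal with |- ?d = _ => set (dd := d) end.
    (* Differentiating Q^2 = 1 gives 2 Q dQ = 0, and Q has no zero. *)
    assert (E : dd * Q q + Q q * dd = 0).
    { apply (@has_rdiff_eq C3_R (fun q => Q q * Q q) (fun _ => RtoC 1) q _ (fun _ => 0) v) with
        (2 := has_rdiff_mult _ _ _ _ _ DQ DQ).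
      - generalize (open_locally _ _ (clf_open _ _ Hy) Hq). apply filter_imp. exact Q2.
      - apply has_rdiff_const. }
    destruct (Cmult_integral (2 * Q q) dd) as [Z|Z]; [rewrite <- E; ring | | exact Z].
    exfalso. destruct (Cmult_integral _ _ Z) as [Z'|Z']; [exact (C2_nz Z')|].
    apply C1_nz. rewrite <- (Q2 q Hq), Z'. ring.
  - assert (Ex : forall m, coord m (a, a, a) = a) by (intros []; reflexivity).
    assert (Ey : forall m, yc m (a, a, a) = b) by (intros m; rewrite Eab; destruct m; reflexivity).
    assert (Es : sine_product i j k (a, a, a) = sine_product j i k (a, a, a)).
    { unfold sine_product. now rewrite !Ex, !Ey. }
    unfold Q. rewrite Es. field. now apply N. }
transitivity (Q p * sine_product j i k p); [unfold Q; field; now apply N|].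
rewrite Q1. ring.
Qed.

Lemma sine_product_swap p i j k : sine_product i j k p = sine_product i k j p.
Proof. unfold sine_product. ring. Qed.

(** The common value of sin y_i sin x_j sin x_k; it plays the part of mu for the coordinates x_i. *)
Definition area (p : C3) : C := sine_product I1 I2 I3 p.

Lemma area_eq p i j k : Omega p -> distinct3 i j k -> sine_product i j k p = area p.
Proof.
intros Hp D. unfold area.
assert (E2 : sine_product I1 I2 I3 p = sine_product I2 I1 I3 p)
  by (apply sine_product_indep; [exact Hp | repeat split; congruence]).
assert (E3 : sine_product I1 I3 I2 p = sine_product I3 I1 I2 p)
  by (apply sine_product_indep; [exact Hp | repeat split; congruence]).
destruct D as [D1 [D2 D3]].
destruct i, j, k; try congruence.
- apply sine_product_swap.
- now rewrite (sine_product_swap p I2 I3 I1).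
- rewrite <- E3. apply sine_product_swap.
- rewrite (sine_product_swap p I3 I2 I1), <- E3. apply sine_product_swap.
Qed.

Lemma area_neq_0 p : Omega p -> area p <> 0.
Proof. intros Hp. now apply sine_product_neq_0. Qed.

(** Differentiating the cosine law gives coefficients in sines and cosines of x. The law at the
    other two indices turns them into cos y_k and cos y_j, which exhibits a symmetric matrix. *)
Lemma has_rdiff_y_law p i j k : Omega p -> distinct3 i j k ->
  has_rdiff3 (fun q => yc i q) p (fun v => sx i p / area p *
    (coord i v + cy k p * coord j v + cy j p * coord k v)).
Proof.
intros Hp D. destruct (has_rdiff_y i p Hp) as [l [_ Dl]].
eapply has_rdiff_ext_lin; [exact Dl|]. intros v.
pose proof (fun m => has_rdiff_linear _ p (clinear_is_linear _ (clinear_coord m))) as Dx.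
pose proof (fun m => has_cderiv_comp _ Csin p _ _ (Dx m) (has_cderiv_Csin _)) as Ds.
pose proof (fun m => has_cderiv_comp _ Ccos p _ _ (Dx m) (has_cderiv_Ccos _)) as Dc.
pose proof (has_cderiv_comp _ Ccos p _ _ Dl (has_cderiv_Ccos _)) as Dcy.
pose proof (@has_rdiff_eq C3_R _ _ p _ _ v
  (filter_imp (F := locally3 p) _ _ (fun q Hq => law_mult q i j k Hq D) (open_locally _ _
    (clf_open _ _ Hy) Hp))
  (has_rdiff_mult _ _ _ _ _ Dcy (has_rdiff_mult _ _ _ _ _ (Ds j) (Ds k)))
  (has_rdiff_plus _ _ _ _ _ (Dc i) (has_rdiff_mult _ _ _ _ _ (Dc j) (Dc k)))) as K.
cbv beta in K.
pose proof (Csin_x_neq_0 p j Hp) as Nj. pose proof (Csin_x_neq_0 p k Hp) as Nk.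
pose proof (Csin_x_neq_0 p i Hp) as Ni.
pose proof (law_mult p i j k Hp D) as Li.
pose proof (law_mult p j k i Hp (distinct3_rot _ _ _ D)) as Lj.
pose proof (law_mult p k i j Hp (distinct3_rot _ _ _ (distinct3_rot _ _ _ D))) as Lk.
(* After multiplication by sin x_j, the law at k followed by the law at i reduces this to sin^2 x_j
   + cos^2 x_j = 1; [Fj] is the same with j and k exchanged. *)
assert (Fk : sx i p * cy k p =
  sx j p * cx k p + cy i p * cx j p * sx k p).
{ apply (Cmult_reg_l _ _ _ Nj).
  transitivity (cy k p * (sx i p * sx j p)); [ring|]. rewrite Lk.
  transitivity ((sx j p * sx j p) * cx k p +
    cx j p * (cy i p * (sx j p * sx k p))); [|ring].
  rewrite Li, <- Csin_factor. ring. }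
assert (Fj : sx i p * cy j p =
  sx k p * cx j p + cy i p * cx k p * sx j p).
{ apply (Cmult_reg_l _ _ _ Nk).
  transitivity (cy j p * (sx k p * sx i p)); [ring|]. rewrite Lj.
  transitivity ((sx k p * sx k p) * cx j p +
    cx k p * (cy i p * (sx j p * sx k p))); [|ring].
  rewrite Li, <- Csin_factor. ring. }
pose proof (area_neq_0 p Hp) as NA.
apply (Cmult_reg_l (area p) _ _ NA).
transitivity (sx i p * coord i v + (sx i p * cy k p) * coord j v +
  (sx i p * cy j p) * coord k v); [|field; exact NA].
rewrite Fk, Fj, <- (area_eq p i j k Hp D). unfold sine_product.
apply Ceq_minus. ring_diff_rev K.
Qed.

(** * Prescribing y_i together with one coordinate *)

Lemma point_exists i j k (a b c : C) : distinct3 i j k ->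
  exists q, coord i q = a /\ coord j q = b /\ coord k q = c.
Proof.
intros [D1 [D2 D3]].
destruct i, j, k; try congruence;
  first [exists (a, b, c); now repeat split | exists (a, c, b); now repeat split
    | exists (b, a, c); now repeat split | exists (b, c, a); now repeat split
    | exists (c, a, b); now repeat split | exists (c, b, a); now repeat split].
Qed.

Lemma distinct3_cases i j k l : distinct3 i j k -> l = i \/ l = j \/ l = k.
Proof. intros [D1 [D2 D3]]. destruct i, j, k, l; try congruence; tauto. Qed.

(** Product-to-sum formulas isolate cos(x_j - x_k), so the law can be solved for it by dividing by
    cos w - 1, which is non-zero where sin w is. *)
Lemma law_sum p i j k (w : C) : distinct3 i j k ->
  Ccos w * (sx j p * sx k p) =
    cx i p + cx j p * cx k p <->
  (Ccos w - 1) * Ccos (coord j p - coord k p) =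
    2 * cx i p + (Ccos w + 1) * Ccos (coord j p + coord k p).
Proof.
intros D. rewrite Ccos_plus, Ccos_minus.
set (sj := sx j p). set (sk := sx k p).
set (cj := cx j p). set (ck := cx k p). set (ci := cx i p).
split; intros H.
- apply Ceq_minus. match type of H with ?a = ?b => transitivity (2 * (a - b)); [ring | rewrite H;
    ring] end.
- apply (Cmult_reg_l 2 _ _ C2_nz). apply Ceq_minus.
  ring_diff H.
Qed.

Lemma locally_pair (z1 z2 z3 : C) (h : C * C * C -> C) (N : C -> Prop) :
  continuous3 h (z1, z2, z3) -> locallyC (h (z1, z2, z3)) N ->
  exists d : posreal, forall w1 w2 w3, (Cmod (w1 - z1) < d)%R -> (Cmod (w2 - z2) < d)%R ->
    (Cmod (w3 - z3) < d)%R -> N (h (w1, w2, w3)).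
Proof.
intros Hh HN. destruct (locally3_coord _ _ (Hh _ HN)) as [d Hd]. exists d.
intros w1 w2 w3 H1 H2 H3. apply (Hd (w1, w2, w3)). now intros [].
Qed.

(* With x_i and x_j + x_k prescribed, the cosine law with given y_i determines
   cos (x_j - x_k), and cos is an open map. *)
Lemma law_image p i j k (N : C3 -> Prop) : Omega p -> distinct3 i j k -> locally3 p N ->
  exists d : posreal, forall w a n, (Cmod (w - yc i p) < d)%R -> (Cmod (a - coord i p) < d)%R ->
    (Cmod (n - (coord j p + coord k p)) < d)%R ->
    exists q, N q /\ Omega q /\ yc i q = w /\ coord i q = a /\ coord j q + coord k q = n.
Proof.
intros Hp D HN.
destruct (Ccos_inj_local (yc i p) (Csin_y_neq_0 p i Hp)) as [e1 He1].
destruct (has_rdiff_y i p Hp) as [l [_ Dl]].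
assert (Hy' : locally3 p (fun q => (Cmod (yc i q - yc i p) < e1)%R)).
{ apply (has_rdiff_continuous _ _ _ Dl (fun v : C => (Cmod (v - yc i p) < e1)%R)).
  apply locally_C_iff. exists e1. auto. }
pose proof (open_locally _ _ (clf_open _ _ Hy) Hp) as HO.
destruct (locally3_coord p _ (@filter_and C3_R (locally3 p) _ _ _ HN
  (@filter_and C3_R (locally3 p) _ _ _ HO Hy'))) as [eps Heps].
set (m0 := coord j p - coord k p). set (n0 := coord j p + coord k p).
destruct (Ccos_open m0 eps) as [del Hdel].
(* The value of cos(x_j - x_k) forced by y_i, x_i and x_j + x_k, which are stored as the three
   components of z. *)
set (h := fun z : C3 => (2 * cx I2 z + (cx I1 z + 1) * cx I3 z) / (cx I1 z - 1)).
pose proof (Csin_y_neq_0 p i Hp) as Ny.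
assert (N1 : cy i p - 1 <> 0).
{ intros Z. apply (one_minus_Ccos_neq_0 _ Ny).
  transitivity (- (cy i p - 1)); [ring | rewrite Z; ring]. }
assert (h0 : h (yc i p, coord i p, n0) = Ccos m0).
{ pose proof (proj1 (law_sum p i j k (yc i p) D) (law_mult p i j k Hp D)) as E. fold m0 n0 in E.
  unfold h. cbn. rewrite <- E. field. exact N1. }
assert (Cx : forall m z, continuous3 (fun z => cx m z) z).
{ intros m z. apply (@continuous_Ccomp C3_R). apply continuous_coord.
  exact (has_cderiv_continuous _ _ _ (has_cderiv_Ccos _)). }
assert (Hc : continuous3 h (yc i p, coord i p, n0)).
{ unfold h, Cdiv, Cminus. apply (@continuous_Cmult C3_R).
  - apply (@continuous_Cplus C3_R); apply (@continuous_Cmult C3_R); auto.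
    apply continuous_Cconst. apply (@continuous_Cplus C3_R); [auto | apply continuous_Cconst].
  - apply (@continuous_Ccomp C3_R (fun z => cx I1 z + - (1)) Cinv).
    apply (@continuous_Cplus C3_R); [auto | apply continuous_Cconst].
    exact (has_cderiv_continuous _ _ _ (has_cderiv_inv _ N1)). }
destruct (locally_pair _ _ _ h (fun v => (Cmod (v - Ccos m0) < del)%R /\ True) Hc) as [d1 Hd1].
{ rewrite h0. apply locally_C_iff. exists del. auto. }
assert (Hc1 : continuous3 (fun z => cx I1 z - 1) (yc i p, coord i p, n0)).
{ apply (@continuous_Cplus C3_R); [auto | apply continuous_Cconst]. }
destruct (locally_pair _ _ _ (fun z => cx I1 z - 1) (fun v => v <> 0) Hc1) as [d2 Hd2].
{ apply (@neq_locally C_UniformSpace (fun v => v)); [apply continuous_id | exact N1]. }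
pose proof (cond_pos d1). pose proof (cond_pos d2). pose proof (cond_pos e1). pose proof
  (cond_pos eps).
assert (Pd : (0 < Rmin (Rmin d1 d2) (Rmin e1 eps))%R) by (repeat apply Rmin_glb_lt; assumption).
exists (mkposreal _ Pd). cbn. intros w a n Hw Ha Hn.
pose proof (Rmin_l (Rmin d1 d2) (Rmin e1 eps)). pose proof (Rmin_r (Rmin d1 d2) (Rmin e1 eps)).
pose proof (Rmin_l d1 d2). pose proof (Rmin_r d1 d2). pose proof (Rmin_l e1 eps). pose proof
  (Rmin_r e1 eps).
destruct (Hd1 w a n) as [K1 _]; try lra. fold n0 in Hn.
assert (K2 : Ccos w - 1 <> 0) by (apply (Hd2 w a n); lra).
destruct (Hdel _ K1) as [m [Hm Em]].
destruct (point_exists i j k a ((n + m) / 2) ((n - m) / 2) D) as [q [qi [qj qk]]].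
assert (half : forall u v : C, (Cmod u < eps)%R -> (Cmod v < eps)%R -> (Cmod ((u + v) / 2) <
  eps)%R).
{ intros u v Hu Hv. rewrite Cmod_div by apply C2_nz. rewrite Cmod_2.
  pose proof (Cmod_triangle u v). lra. }
destruct (Heps q) as [Nq [Oq Yq]].
{ intros r. destruct (distinct3_cases i j k r D) as [->|[->| ->]].
  - rewrite qi. lra.
  - rewrite qj. replace ((n + m) / 2 - coord j p) with (((n - n0) + (m - m0)) / 2) by (unfold n0,
      m0; field).
    apply half; lra.
  - rewrite qk. replace ((n - m) / 2 - coord k p) with (((n - n0) + - (m - m0)) / 2) by (unfold
      n0, m0; field).
    apply half; [lra | rewrite Cmod_opp; lra]. }
exists q. split; [exact Nq|]. split; [exact Oq|]. split; [|split; [exact qi | rewrite qj, qk;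
  field]].
(* The law fixes only cos y_i(q) = cos w. Since y is a given branch, equality follows because y_i(q)
   and w are both close to y_i(p), where cos is injective. *)
apply He1; [exact Yq | lra |].
assert (Ns : sx j q * sx k q <> 0).
{ apply Cmult_neq_0; apply Csin_x_neq_0; exact Oq. }
apply (Cmult_reg_l _ _ _ Ns). rewrite (Cmult_comm _ (Ccos w)), Cmult_comm, (law_mult q i j k Oq D).
symmetry. apply (law_sum q i j k w D). rewrite qi, qj, qk.
replace ((n + m) / 2 - (n - m) / 2) with m by field. replace ((n + m) / 2 + (n - m) / 2) with n
  by field.
rewrite Em. unfold h. cbn. field. exact K2.
Qed.

Lemma clinear_law (a b c d : C) i j k :
  clinear (fun v => a * (b * coord i v + c * coord j v + d * coord k v)).
Proof.
apply clinear_scal. apply clinear_plus; [apply clinear_plus|]; apply clinear_scal, clinear_coord.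
Qed.

Lemma has_rdiff_Ccos_y p i j k : Omega p -> distinct3 i j k ->
  has_rdiff3 (fun q => cy i q) p (fun v => - sy i p * sx i p / area p *
    (1 * coord i v + cy k p * coord j v + cy j p * coord k v)).
Proof.
intros Hp D. eapply has_rdiff_ext_lin.
- exact (has_cderiv_comp _ Ccos p _ _ (has_rdiff_y_law p i j k Hp D) (has_cderiv_Ccos _)).
- intros v. cbv beta. field. now apply area_neq_0.
Qed.

(** The conclusion gives a whole neighbourhood because being non-real is an open condition; several
    functions can thus be made non-real one after another. *)
Lemma nonreal_dense (Z : C3 -> C) :
  (forall p, Omega p -> continuous3 Z p) ->
  (forall p, Omega p -> ~ locally3 p (fun q => Z q = Cconj (Z q))) ->
  forall p (N : C3 -> Prop), Omega p -> locally3 p N ->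
  exists q, Omega q /\ locally3 q (fun r => N r /\ Z r <> Cconj (Z r)).
Proof.
intros HZ HR p N Hp HN.
apply NNPP. intros NE. apply (HR p Hp).
generalize (@filter_and C3_R (locally3 p) _ _ _ (open_locally _ _ (clf_open _ _ Hy) Hp)
  (@locally_locally C3_R p N HN)).
apply filter_imp. intros q [Hq Nq]. apply NNPP. intros NZ. apply NE. exists q. split; [exact Hq|].
apply (@filter_and C3_R (locally3 q) (@filter_filter _ _ (locally_filter q))); [exact Nq|].
assert (Hc : continuous3 (fun r => Z r - Cconj (Z r)) q).
{ apply (@continuous_Cplus C3_R); [now apply HZ|]. apply (@continuous_Copp C3_R).
  apply (@continuous_Ccomp C3_R); [now apply HZ|].
  exact (has_rdiff_continuous _ _ _ (has_rdiff_conj _ _ _ (has_rdiff_id (Z q)))). }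
generalize (neq_locally _ q 0 Hc (fun E => NZ (proj2 (Ceq_minus _ _) E))). apply filter_imp.
intros r Hr E. exact (Hr (proj1 (Ceq_minus _ _) E)).
Qed.

Lemma clinear_comp_scal (a : C) (l : C3 -> C) : clinear l -> clinear (fun v => l v * a).
Proof.
intros H. destruct (clinear_scal a l H) as [b Hb]. exists b. intros v. rewrite <- Hb. ring.
Qed.

(** If the square were real near p, its differential 2 cos y_k d(cos y_k) would vanish. As d(cos
    y_k) has a non-zero component along x_k, cos y_k itself would vanish near p, and then so would
    d(cos y_k). *)
Lemma Ccos_y_square_nonreal p k : Omega p ->
  ~ locally3 p (fun q => cy k q * cy k q = Cconj (cy k q * cy k q)).
Proof.
intros Hp H. destruct (distinct3_exists k) as [i [j D]].
destruct (point_exists k i j 1 0 0 D) as [v [v1 [v2 v3]]].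
assert (Z : locally3 p (fun q => cy k q = 0)).
{ generalize (@filter_and C3_R (locally3 p) _ _ _ (open_locally _ _ (clf_open _ _ Hy) Hp)
    (@locally_locally C3_R _ _ H)). apply filter_imp. intros q [Hq Lq].
  pose proof (has_rdiff_Ccos_y q k i j Hq D) as Dq.
  set (m := fun v => - sy k q * sx k q / area q *
    (1 * coord k v + cy j q * coord i v + cy i q * coord j v)) in *.
  pose proof (real_valued_differential (fun q => cy k q * cy k q) q
    (fun v => m v * cy k q + cy k q * m v) v) as R.
  assert (E : m v * cy k q + cy k q * m v = 0).
  { apply R; [| exact (has_rdiff_mult _ _ _ _ _ Dq Dq) | exact Lq].
    apply clinear_plus; [apply clinear_comp_scal | apply clinear_scal]; apply clinear_law. }
  destruct (Cmult_integral (2 * m v) (cy k q)) as [E'|]; [rewrite <- E; ring | | assumption].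
  exfalso. unfold m in E'. rewrite v1, v2, v3 in E'.
  apply (Cmult_neq_0 (sy k q) (sx k q)).
  now apply Csin_y_neq_0. now apply Csin_x_neq_0.
  pose proof (area_neq_0 q Hq).
  transitivity (- area q / 2 * (2 * (- sy k q * sx k q / area q * (1 * 1 + cy j q * 0 + cy i q *
    0)))).
  field; assumption. rewrite E'. ring. }
pose proof (@has_rdiff_eq C3_R _ (fun _ => RtoC 0) p _ (fun _ => 0) v Z (has_rdiff_Ccos_y p k i j
  Hp D) (has_rdiff_const _ _)) as E.
cbv beta in E. rewrite v1, v2, v3 in E.
apply (Cmult_neq_0 (sy k p) (sx k p)).
now apply Csin_y_neq_0. now apply Csin_x_neq_0.
pose proof (area_neq_0 p Hp).
transitivity (- area p * (- sy k p * sx k p / area p * (1 * 1 + cy j p * 0 + cy i p * 0))).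
field; assumption. rewrite E. ring.
Qed.

Lemma continuous_Ccos_y p i : Omega p -> continuous3 (fun q => cy i q) p.
Proof.
intros Hp. destruct (distinct3_exists i) as [j [k D]].
exact (has_rdiff_continuous _ _ _ (has_rdiff_Ccos_y p i j k Hp D)).
Qed.

(** * The coordinates x_i form a cosine system *)

Definition third (i j : index3) : index3 :=
  match i, j with
  | I1, I2 | I2, I1 => I3
  | I1, I3 | I3, I1 => I2
  | I2, I3 | I3, I2 => I1
  | _, _ => i
  end.

Definition index_eqb (i j : index3) : bool :=
  match i, j with I1, I1 | I2, I2 | I3, I3 => true | _, _ => false end.

Definition cot (t : C) : C := Ccos t / Csin t.

(** The matrix of [has_rdiff_y_law]. [third] is consulted only for i different from j, so its
    diagonal value is a mere default. *)
Definition coord_matrix (i j : index3) (p : C3) : C :=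
  if index_eqb i j then 1 else Ccos (yc (third i j) p).

Lemma has_cderiv_cot t : Csin t <> 0 -> has_cderiv cot t (- / (Csin t * Csin t)).
Proof.
intros N. eapply has_cderiv_ext_d.
- exact (has_cderiv_div _ _ t _ _ N (has_cderiv_Ccos t) (has_cderiv_Csin t)).
- transitivity (- (Csin t * Csin t + Ccos t * Ccos t) / (Csin t * Csin t)); [field; exact N|].
  rewrite Csin2_Ccos2. field. exact N.
Qed.

Lemma has_cderiv_cot_deriv t : Csin t <> 0 ->
  has_cderiv (fun t => - / (Csin t * Csin t)) t (2 * Ccos t / (Csin t * Csin t * Csin t)).
Proof.
intros N. eapply has_cderiv_ext_d.
- apply has_cderiv_opp. apply (has_cderiv_chain (fun t => Csin t * Csin t) Cinv).
  exact (has_cderiv_mult _ _ t _ _ (has_cderiv_Csin t) (has_cderiv_Csin t)).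
  apply has_cderiv_inv. now apply Cmult_neq_0.
- cbv beta. field. exact N.
Qed.

Lemma coord_cosine_system : cosine_system Omega y coord coord_matrix area
  Csin cot (fun t => - / (Csin t * Csin t)) (fun t => 2 * Ccos t / (Csin t * Csin t * Csin t))
    Csin cot.
Proof.
split.
- exact (clf_open _ _ Hy).
- exact (clf_connected _ _ Hy).
- apply clinear_coord.
- intros i c. destruct (distinct3_exists i) as [j [k D]].
  destruct (point_exists i j k c 0 0 D) as [v [v1 [v2 v3]]]. exists v. split; [exact v1|].
  intros l Hl. destruct (distinct3_cases i j k l D) as [->|[->| ->]]; [contradiction | exact v2 |
    exact v3].
- intros p i Hp. destruct i.
  + eapply has_rdiff_ext_lin. apply (has_rdiff_y_law p I1 I2 I3 Hp). repeat split; congruence.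
    intros v. unfold dycoord, sum3, coord_matrix, third, index_eqb. ring.
  + eapply has_rdiff_ext_lin. apply (has_rdiff_y_law p I2 I1 I3 Hp). repeat split; congruence.
    intros v. unfold dycoord, sum3, coord_matrix, third, index_eqb. ring.
  + eapply has_rdiff_ext_lin. apply (has_rdiff_y_law p I3 I1 I2 Hp). repeat split; congruence.
    intros v. unfold dycoord, sum3, coord_matrix, third, index_eqb. ring.
- intros p [] [] _; reflexivity.
- exact area_neq_0.
- intros p i. apply Csin_x_neq_0.
- intros p i. apply Csin_y_neq_0.
- intros p i j Hp. destruct (classic (i = j)) as [->|Hij]; [reflexivity|].
  destruct (exists_third i j Hij) as [k [Hki Hkj]].
  assert (D : distinct3 i j k) by (repeat split; congruence).
  apply (Cmult_reg_l (sx k p) _ _ (Csin_x_neq_0 p k Hp)).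
  transitivity (sine_product i j k p); [unfold sine_product; ring|].
  rewrite (sine_product_indep p i j k Hp D). unfold sine_product. ring.
- intros p i Hp. eapply has_cderiv_ext_d. apply has_cderiv_Csin.
  unfold cot. field. now apply Csin_y_neq_0.
- intros p i Hp. now apply has_cderiv_cot, Csin_y_neq_0.
- intros p i Hp. now apply has_cderiv_cot_deriv, Csin_y_neq_0.
- intros p i Hp. eapply has_cderiv_ext_d. apply has_cderiv_Csin.
  unfold cot. field. now apply Csin_x_neq_0.
- intros p i j a b Hp Hij H.
  pose proof (H i) as Hi. pose proof (H j) as Hj.
  assert (Eii : forall l, coord_matrix l l p = 1) by (intros []; reflexivity).
  assert (Eij : coord_matrix i j p = Ccos (yc (third i j) p) /\ coord_matrix j i p = Ccos (yc
    (third i j) p)).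
  { destruct i, j; try congruence; split; reflexivity. }
  destruct Eij as [E1 E2]. rewrite !Eii in *. rewrite E1 in Hj. rewrite E2 in Hi.
  set (c := Ccos (yc (third i j) p)) in *.
  assert (Nc : (1 - c) * (1 + c) <> 0).
  { unfold c. rewrite Csin_factor. apply Cmult_neq_0; now apply Csin_y_neq_0. }
  (* Columns i and j read a = b c and a c = b, so b (1 - c^2) = 0. *)
  assert (B : b = 0).
  { destruct (Cmult_integral b ((1 - c) * (1 + c))) as [|Z]; [| assumption | contradiction].
    transitivity (b * 1 - (b * c) * c); [ring|]. rewrite <- Hi, <- Hj. ring. }
  split; [|exact B]. transitivity (a * 1); [ring|]. rewrite Hi, B. ring.
- intros p N Hp HN.
  pose proof (fun k => nonreal_dense (fun q => cy k q * cy k q)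
    (fun p Hp => continuous_Cmult _ _ p (continuous_Ccos_y p k Hp) (continuous_Ccos_y p k Hp))
    (fun p Hp => Ccos_y_square_nonreal p k Hp)) as ND.
  destruct (ND I1 p N Hp HN) as [q1 [H1 N1]].
  destruct (ND I2 q1 _ H1 N1) as [q2 [H2 N2]].
  destruct (ND I3 q2 _ H2 N2) as [q [H3 N3]].
  destruct (locally_singleton _ _ N3) as [[[Nq R1] R2] R3].
  assert (R : forall k, cy k q * cy k q <> Cconj (cy k q * cy k q)) by (intros []; assumption).
  exists q. split; [exact Nq|]. split; [exact H3|]. split.
  + intros i j Hij Z.
    assert (Z' : Ccos (yc (third i j) q) = 0) by (rewrite <- Z; destruct i, j; try congruence;
      reflexivity).
    apply (R (third i j)). rewrite Z'. apply injective_projections; cbn; ring.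
  + intros al be HH i. destruct (exists_other i) as [j Hij].
    pose proof (HH i i) as Eii. pose proof (HH j j) as Ejj. pose proof (HH i j) as Eij. pose
      proof (HH j i) as Eji.
    assert (M : forall l, coord_matrix l l q = 1) by (intros []; reflexivity).
    assert (M1 : coord_matrix i j q = Ccos (yc (third i j) q) /\ coord_matrix j i q = Ccos (yc
      (third i j) q)).
    { destruct i, j; try congruence; split; reflexivity. }
    destruct M1 as [M1 M2]. rewrite M in Eii, Ejj. rewrite M1 in Eij. rewrite M2 in Eji.
    set (c := Ccos (yc (third i j) q)) in *.
    replace (Cconj 1) with (RtoC 1) in * by (apply injective_projections; cbn; ring).
    assert (A : al i = be i) by (rewrite <- (Cmult_1_r (al i)), Eii; ring).
    assert (B : al j = be j) by (rewrite <- (Cmult_1_r (al j)), Ejj; ring).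
    (* The diagonal equations give al = be, so al_i c = al_j conj(c) and al_j c = al_i conj(c).
       Eliminating al_j leaves c^2, which is why non-reality of the square is required. *)
    assert (K : al i * (c * c - Cconj (c * c)) = 0).
    { rewrite Cmult_conj. transitivity ((al i * c) * c - (al i * Cconj c) * Cconj c); [ring|].
      rewrite A at 2. rewrite Eij, <- Eji, <- B. ring. }
    assert (Z : al i = 0).
    { destruct (Cmult_integral _ _ K) as [|Z]; [assumption|]. exfalso. apply (R (third i j)).
      now apply Ceq_minus. }
    split; [exact Z | now rewrite <- A].
- destruct (clf_base _ _ Hy) as [a [b [Hab Eab]]]. exists (a, a, a). split; [exact Hab|].
  intros i j. rewrite Eab. destruct i, j; split; reflexivity.
- intros p i N Hp HN. destruct (distinct3_exists i) as [j [k D]].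
  destruct (law_image p i j k N Hp D HN) as [d Hd]. exists d. intros w s Hw Hs.
  destruct (Hd w s (coord j p + coord k p) Hw Hs) as [q [Nq [_ [Eq [Es _]]]]].
  { replace (coord j p + coord k p - (coord j p + coord k p)) with (RtoC 0) by ring.
    rewrite Cmod_0. apply cond_pos. }
  exists q. now split.
(* cot vanishes where cos y_i does, but its derivative -1/sin^2 never does. *)
- right. intros p i Hp Z. apply C1_nz. pose proof (Csin_y_neq_0 p i Hp) as N.
  transitivity (- (sy i p * sy i p) * - / (sy i p * sy i p)); [field; exact N|].
  rewrite Z. ring.
Qed.

(** * The radii r_i form a cosine system *)

Lemma radius_sum p i j k : distinct3 i j k -> coord i p = radius j p + radius k p.
Proof.
intros [D1 [D2 D3]]. unfold radius, sum3. destruct i, j, k; try congruence; field.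
Qed.

Lemma clinear_radius i : clinear (radius i).
Proof.
exists (fun j => if index_eqb i j then - / 2 else / 2). intros v.
unfold radius, sum3. destruct i; cbn; field.
Qed.

Lemma radius_eq i j k v : distinct3 i j k -> radius i v = (coord j v + coord k v - coord i v) / 2.
Proof.
intros [D1 [D2 D3]]. unfold radius, sum3. destruct i, j, k; try congruence; field.
Qed.

(** By the law the left-hand side is cos x_i + cos(x_j - x_k). With x_i = r_j + r_k and x_j - x_k =
    r_k - r_j this becomes a product. *)
Lemma one_plus_Ccos_y p i j k : Omega p -> distinct3 i j k ->
  (1 + cy i p) * (sx j p * sx k p) =
  2 * Ccos (radius j p) * Ccos (radius k p).
Proof.
intros Hp D.
transitivity (cy i p * (sx j p * sx k p) + sx j p * sx k p); [ring|].
rewrite (law_mult p i j k Hp D).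
transitivity (cx i p + Ccos (coord j p - coord k p)); [rewrite Ccos_minus; ring|].
replace (coord j p - coord k p) with (radius k p - radius j p).
- rewrite (radius_sum p i j k D), Ccos_plus, Ccos_minus. ring.
- rewrite (radius_sum p j k i), (radius_sum p k i j). ring.
  now apply distinct3_rot, distinct3_rot. now apply distinct3_rot.
Qed.

Lemma Ccos_radius_neq_0 p i : Omega p -> Ccos (radius i p) <> 0.
Proof.
intros Hp Z. destruct (distinct3_exists i) as [j [k D]].
apply distinct3_swap in D.
apply (Cmult_neq_0 (1 + cy j p) (sx i p * sx k p)).
- now apply one_plus_Ccos_neq_0, Csin_y_neq_0.
- apply Cmult_neq_0; now apply Csin_x_neq_0.
- rewrite (one_plus_Ccos_y p j i k Hp D), Z. ring.
Qed.

(** Dividing by cos r_i makes the right-hand side symmetric, so tan(y_i/2) / cos r_i does not depend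
    on i. *)
Lemma Ctan_half_y p i j k : Omega p -> distinct3 i j k ->
  Ctan (yc i p / 2) = area p / (2 * Ccos (radius j p) * Ccos (radius k p)).
Proof.
intros Hp D. rewrite Ctan_half by now apply Csin_y_neq_0.
rewrite <- (one_plus_Ccos_y p i j k Hp D), <- (area_eq p i j k Hp D). unfold sine_product.
pose proof (one_plus_Ccos_neq_0 _ (Csin_y_neq_0 p i Hp)).
pose proof (Csin_x_neq_0 p j Hp). pose proof (Csin_x_neq_0 p k Hp).
field. auto.
Qed.

(** Substituting x_i = r_j + r_k in [has_rdiff_y_law] gives the row cos y_j + cos y_k, 1 + cos y_j,
    1 + cos y_k, which is not symmetric. The factor 1 + cos y_i, extracted from sin x_i / area by
    [radius_factor_eq], makes it so. *)
Definition radius_matrix (i j : index3) (p : C3) : C :=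
  if index_eqb i j
  then (1 + cy i p) * (sum3 (fun l => cy l p) - cy i p)
  else (1 + cy i p) * (1 + cy j p).

Definition radius_factor (p : C3) : C :=
  2 * area p * (Ccos (radius I1 p) * Ccos (radius I2 p) * Ccos (radius I3 p)) /
  (sx I1 p * sx I2 p * sx I3 p).

Lemma radius_factor_eq p i j k : Omega p -> distinct3 i j k ->
  sx i p / area p = Ccos (radius i p) / radius_factor p * (1 + cy i p).
Proof.
intros Hp D.
pose proof (fun l => Csin_x_neq_0 p l Hp) as Ns. pose proof (fun l => Ccos_radius_neq_0 p l Hp)
  as Nr.
pose proof (area_neq_0 p Hp) as NA.
replace (1 + cy i p) with (2 * Ccos (radius j p) * Ccos (radius k p) / (sx j p * sx k p)).
- unfold radius_factor. destruct D as [D1 [D2 D3]].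
  destruct i, j, k; try congruence; field; repeat split; auto.
- rewrite <- (one_plus_Ccos_y p i j k Hp D). field. split; apply Ns.
Qed.

Lemma radius_matrix_diag p i j k : distinct3 i j k ->
  radius_matrix i i p = (1 + cy i p) * (cy j p + cy k p).
Proof.
intros [D1 [D2 D3]]. unfold radius_matrix, sum3. destruct i, j, k; try congruence; cbn; ring.
Qed.

Lemma radius_matrix_off p i j : i <> j ->
  radius_matrix i j p = (1 + cy i p) * (1 + cy j p).
Proof. intros H. unfold radius_matrix. destruct i, j; try congruence; reflexivity. Qed.

Lemma sum3_distinct (F : index3 -> C) i j k : distinct3 i j k -> sum3 F = F i + F j + F k.
Proof. intros [D1 [D2 D3]]. unfold sum3. destruct i, j, k; try congruence; ring. Qed.

Lemma has_rdiff_y_radius p i : Omega p ->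
  has_rdiff3 (fun q => yc i q) p (dycoord radius radius_matrix radius_factor Ccos i p).
Proof.
intros Hp. destruct (distinct3_exists i) as [j [k D]].
eapply has_rdiff_ext_lin. exact (has_rdiff_y_law p i j k Hp D).
intros v. unfold dycoord.
rewrite (sum3_distinct _ i j k D), (radius_matrix_diag p i j k D).
rewrite !radius_matrix_off by apply D.
rewrite (radius_factor_eq p i j k Hp D).
rewrite (radius_sum v i j k D).
rewrite (radius_sum v j k i), (radius_sum v k i j).
ring. now apply distinct3_rot, distinct3_rot. now apply distinct3_rot.
Qed.

(** The usual form of the sine law: area is sin y_l times the product of the other two sines. It
    lets sin x be replaced by a common multiple of sin y. *)
Lemma sine_ratio p : Omega p -> exists r : C, r <> 0 /\
  forall l, sy l p = r * sx l p.
Proof.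
intros Hp. exists (area p / (sx I1 p * sx I2 p * sx I3 p)).
pose proof (fun l => Csin_x_neq_0 p l Hp) as Ns.
split.
- intros Z. apply (area_neq_0 p Hp).
  transitivity (area p / (sx I1 p * sx I2 p * sx I3 p) *
    (sx I1 p * sx I2 p * sx I3 p)); [field; auto | rewrite Z; ring].
- intros l. destruct (distinct3_exists l) as [j [k D]].
  rewrite <- (area_eq p l j k Hp D). unfold sine_product. destruct D as [D1 [D2 D3]].
  destruct l, j, k; try congruence; field; auto.
Qed.

(* The two equations are the components along x_1 and x_2 of
   d((c2 + c3) / (1 + c1)) = 0, where c_i = cos y_i. *)
Lemma nonreal_elimination (c1 c2 c3 : C) :
  1 + c1 <> 0 -> (1 - c2) * (1 + c2) <> 0 -> (1 - c3) * (1 + c3) <> 0 ->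
  (1 - c2 * c2) * c3 + (1 - c3 * c3) * c2 = (c2 + c3) * (1 - c1) ->
  (1 - c2 * c2) + (1 - c3 * c3) * c1 = (c2 + c3) * (1 - c1) * c3 -> False.
Proof.
intros N1 N2 N3 R1 R2.
assert (K : (c2 + c3) * (c1 - c2 * c3) = 0).
{ transitivity ((1 - c2 * c2) * c3 + (1 - c3 * c3) * c2 - (c2 + c3) * (1 - c1)); [ring|]. rewrite
  R1. ring. }
destruct (Cmult_integral _ _ K) as [Z|Z].
- assert (E : c3 = - c2) by (transitivity (c2 + c3 - c2); [ring | rewrite Z; ring]).
  apply (Cmult_neq_0 _ _ N2 N1). rewrite E in R2.
  transitivity ((1 - c2 * c2) + (1 - - c2 * - c2) * c1); [ring|]. rewrite R2. ring.
- assert (E : c1 = c2 * c3) by now apply Ceq_minus.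
  apply (Cmult_neq_0 _ _ N2 N3). rewrite E in R2.
  transitivity ((1 - c2 * c2) + (1 - c3 * c3) * (c2 * c3) - (c2 + c3) * (1 - c2 * c3) * c3);
    [ring|].
  rewrite R2. ring.
Qed.

(** Removing the factors 1 + cos y_i and 1 + cos y_j from rows and columns turns every off-diagonal
    entry of [radius_matrix] into 1 and the first diagonal entry into this function. Hence E is real
    up to phases only if it is real. *)
Definition cos_ratio (p : C3) : C := (cy I2 p + cy I3 p) / (1 + cy I1 p).

Lemma clinear_ext (l l' : C3 -> C) : (forall v, l v = l' v) -> clinear l -> clinear l'.
Proof. intros H [a Ha]. exists a. intros v. now rewrite <- H. Qed.

Lemma cos_ratio_nonreal p : Omega p -> ~ locally3 p (fun q => cos_ratio q = Cconj (cos_ratio q)).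
Proof.
intros Hp H.
assert (D1 : distinct3 I1 I2 I3) by (repeat split; congruence).
assert (D2 : distinct3 I2 I3 I1) by (repeat split; congruence).
assert (D3 : distinct3 I3 I1 I2) by (repeat split; congruence).
destruct (sine_ratio p Hp) as [r [Nr Hr]].
pose proof (area_neq_0 p Hp) as NA.
pose proof (one_plus_Ccos_neq_0 _ (Csin_y_neq_0 p I1 Hp)) as N1.
assert (N : forall l, (1 - cy l p) * (1 + cy l p) <> 0).
{ intros l. rewrite Csin_factor. apply Cmult_neq_0; now apply Csin_y_neq_0. }
(* By [sine_ratio], the factor -sin y_l sin x_l / area in d(cos y_l) is K sin^2 y_l with the same K
   for every l, so K cancels and only cosines of y remain. *)
set (K := - / (r * area p)).
assert (NK : K <> 0).
{ intros Z. apply C1_nz. transitivity (- (r * area p) * K); [unfold K; field; auto | rewrite Z;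
  ring]. }
assert (W : forall l, - sy l p * sx l p / area p =
  K * ((1 - cy l p) * (1 + cy l p))).
{ intros l. unfold K. rewrite Csin_factor, (Hr l). field. auto. }
assert (Dc : forall i j k, distinct3 i j k -> has_rdiff3 (fun q => cy i q) p
  (fun v => K * ((1 - cy i p) * (1 + cy i p)) *
    (1 * coord i v + cy k p * coord j v + cy j p * coord k v))).
{ intros i j k D. rewrite <- W. now apply has_rdiff_Ccos_y. }
set (la := fun v => K * ((1 - cy I2 p) * (1 + cy I2 p)) *
    (1 * coord I2 v + cy I1 p * coord I3 v + cy I3 p * coord I1 v) +
  K * ((1 - cy I3 p) * (1 + cy I3 p)) *
    (1 * coord I3 v + cy I2 p * coord I1 v + cy I1 p * coord I2 v)).
set (lb := fun v => 0 + K * ((1 - cy I1 p) * (1 + cy I1 p)) *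
    (1 * coord I1 v + cy I3 p * coord I2 v + cy I2 p * coord I3 v)).
assert (Da : has_rdiff3 (fun q => cy I2 q + cy I3 q) p la)
  by exact (has_rdiff_plus _ _ _ _ _ (Dc _ _ _ D2) (Dc _ _ _ D3)).
assert (Db : has_rdiff3 (fun q => 1 + cy I1 q) p lb)
  by exact (has_rdiff_plus _ _ _ _ _ (has_rdiff_const 1 (p : C3_R)) (Dc _ _ _ D1)).
pose proof (has_rdiff_div _ _ p _ _ N1 Da Db) as Dr.
assert (Cl : clinear (fun v => (la v * (1 + cy I1 p) - (cy I2 p + cy I3 p) * lb v) /
  ((1 + cy I1 p) * (1 + cy I1 p)))).
{ apply clinear_comp_scal.
  apply (clinear_ext (fun v => (1 + cy I1 p) * la v + - (cy I2 p + cy I3 p) * lb v)).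
  intros v. ring.
  apply clinear_plus; apply clinear_scal.
  - apply clinear_plus; apply clinear_law.
  - apply (clinear_ext (fun v => K * ((1 - cy I1 p) * (1 + cy I1 p)) *
      (1 * coord I1 v + cy I3 p * coord I2 v + cy I2 p * coord I3 v))).
    intros v. unfold lb. ring. apply clinear_law. }
pose proof (fun v => real_valued_differential cos_ratio p _ v Cl Dr H) as R. cbv beta in R.
assert (R' : forall v, la v * (1 + cy I1 p) = (cy I2 p + cy I3 p) * lb v).
{ intros v. apply Ceq_minus.
  transitivity (((1 + cy I1 p) * (1 + cy I1 p)) *
    ((la v * (1 + cy I1 p) - (cy I2 p + cy I3 p) * lb v) /
     ((1 + cy I1 p) * (1 + cy I1 p)))); [field; exact N1 | rewrite R; ring]. }
destruct (point_exists I1 I2 I3 1 0 0 D1) as [v [v1 [v2 v3]]].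
destruct (point_exists I1 I2 I3 0 1 0 D1) as [w [w1 [w2 w3]]].
pose proof (R' v) as E1. pose proof (R' w) as E2. unfold la, lb in E1, E2.
rewrite v1, v2, v3 in E1. rewrite w1, w2, w3 in E2.
pose proof (N I2) as N2. pose proof (N I3) as N3.
set (c1 := Ccos (coord I1 (y p))) in *. set (c2 := Ccos (coord I2 (y p))) in *. set (c3 := Ccos
  (coord I3 (y p))) in *.
apply (nonreal_elimination c1 c2 c3 N1 N2 N3); apply (Cmult_reg_l (K * (1 + c1)));
  try (now apply Cmult_neq_0).
- ring_from E1.
- ring_from E2.
Qed.

Lemma has_cderiv_Ctan_half t : Csin t <> 0 ->
  has_cderiv (fun t => Ctan (t / 2)) t (/ Csin t * Ctan (t / 2)).
Proof.
intros N. pose proof N as N'. rewrite Csin_half in N'.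
assert (Nc : Ccos (t / 2) <> 0) by (intros Z; apply N'; rewrite Z; ring).
assert (Ns : Csin (t / 2) <> 0) by (intros Z; apply N'; rewrite Z; ring).
assert (Dh : has_cderiv (fun t => t / 2) t (/ 2)).
{ eapply has_cderiv_ext_d. exact (has_cderiv_mult _ _ t _ _ (has_cderiv_id t) (has_cderiv_const
  (/ 2) t)).
  cbv beta. ring. }
eapply has_cderiv_ext_d.
- exact (has_cderiv_chain (fun t => t / 2) Ctan t _ _ Dh
    (has_cderiv_div Csin Ccos (t / 2) _ _ Nc (has_cderiv_Csin _) (has_cderiv_Ccos _))).
- rewrite (Csin_half t). unfold Ctan.
  transitivity ((Csin (t / 2) * Csin (t / 2) + Ccos (t / 2) * Ccos (t / 2)) * / 2 / (Ccos (t / 2)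
    * Ccos (t / 2))).
  field; exact Nc. rewrite Csin2_Ccos2. field. auto.
Qed.

Lemma has_cderiv_Csin_inv t : Csin t <> 0 ->
  has_cderiv (fun t => / Csin t) t (- Ccos t / (Csin t * Csin t)).
Proof.
intros N. eapply has_cderiv_ext_d.
- exact (has_cderiv_chain Csin Cinv t _ _ (has_cderiv_Csin t) (has_cderiv_inv _ N)).
- field. exact N.
Qed.

Lemma radius_cosine_system :
  cosine_system Omega y radius radius_matrix radius_factor
    (fun t => Ctan (t / 2)) (fun t => / Csin t) (fun t => - Ccos t / (Csin t * Csin t))
    (fun t => (Csin t * Csin t + 2 * (Ccos t * Ccos t)) / (Csin t * Csin t * Csin t))
    Ccos (fun t => - Csin t / Ccos t).
Proof.
split.
- exact (clf_open _ _ Hy).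
- exact (clf_connected _ _ Hy).
- apply clinear_radius.
- intros i c. destruct (distinct3_exists i) as [j [k D]].
  (* r_i = c and r_j = r_k = 0 amount to x_i = 0 and x_j = x_k = c. *)
  destruct (point_exists i j k 0 c c D) as [v [v1 [v2 v3]]]. exists v. split.
  + rewrite (radius_eq i j k v D), v1, v2, v3. field.
  + intros l Hl. destruct (distinct3_cases i j k l D) as [->|[->| ->]]; [contradiction | |].
    * rewrite (radius_eq j k i v (distinct3_rot _ _ _ D)), v1, v2, v3. field.
    * rewrite (radius_eq k i j v (distinct3_rot _ _ _ (distinct3_rot _ _ _ D))), v1, v2, v3. field.
- exact has_rdiff_y_radius.
- intros p i j _. destruct (classic (i = j)) as [->|Hij]; [reflexivity|].
  rewrite !radius_matrix_off by congruence. ring.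
- intros p Hp. unfold radius_factor, Cdiv. apply Cmult_neq_0.
  + apply Cmult_neq_0; [apply Cmult_neq_0; [apply C2_nz | now apply area_neq_0]|].
    apply Cmult_neq_0; [apply Cmult_neq_0|]; now apply Ccos_radius_neq_0.
  + rewrite <- (Cmult_1_l (/ _)). intros Z.
    assert (M : sx I1 p * sx I2 p * sx I3 p <> 0).
    { apply Cmult_neq_0; [apply Cmult_neq_0|]; now apply Csin_x_neq_0. }
    apply C1_nz. rewrite <- (Cinv_r _ M), <- (Cmult_1_l (/ _)), Z. ring.
- intros p i Hp. now apply Ccos_radius_neq_0.
- intros p i Hp. destruct (distinct3_exists i) as [j [k D]].
  rewrite Ctan_half by now apply Csin_y_neq_0. intros Z.
  pose proof (one_plus_Ccos_neq_0 _ (Csin_y_neq_0 p i Hp)) as N.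
  apply (Csin_y_neq_0 p i Hp).
  transitivity (sy i p / (1 + cy i p) * (1 + cy i p)); [field; exact N | rewrite Z; ring].
- intros p i j Hp. destruct (classic (i = j)) as [->|Hij]; [reflexivity|].
  destruct (exists_third i j Hij) as [k [Hki Hkj]].
  assert (D : distinct3 i j k) by (repeat split; congruence).
  rewrite (Ctan_half_y p i j k Hp D), (Ctan_half_y p j i k Hp (distinct3_swap _ _ _ D)).
  field. repeat split; now apply Ccos_radius_neq_0.
- intros p i Hp. now apply has_cderiv_Ctan_half, Csin_y_neq_0.
- intros p i Hp. now apply has_cderiv_Csin_inv, Csin_y_neq_0.
- intros p i Hp. pose proof (Csin_y_neq_0 p i Hp) as N.
  eapply has_cderiv_ext_d.
  + exact (has_cderiv_div _ (fun t => Csin t * Csin t) _ _ _ (Cmult_neq_0 _ _ N N)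
      (has_cderiv_opp _ _ _ (has_cderiv_Ccos _)) (has_cderiv_mult _ _ _ _ _ (has_cderiv_Csin _)
        (has_cderiv_Csin _))).
  + cbv beta. field. exact N.
- intros p i Hp. eapply has_cderiv_ext_d. apply has_cderiv_Ccos.
  field. now apply Ccos_radius_neq_0.
- intros p i j a b Hp Hij H.
  destruct (exists_third i j Hij) as [k [Hki Hkj]].
  assert (D : distinct3 i j k) by (repeat split; congruence).
  pose proof (H i) as Hi. pose proof (H j) as Hj. pose proof (H k) as Hk.
  rewrite (radius_matrix_diag p i j k D), radius_matrix_off in Hi by congruence.
  rewrite (radius_matrix_diag p j i k (distinct3_swap _ _ _ D)), radius_matrix_off in Hj by
    congruence.
  rewrite !radius_matrix_off in Hk by congruence.
  pose proof (fun l => one_plus_Ccos_neq_0 _ (Csin_y_neq_0 p l Hp)) as N.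
  pose proof (one_minus_Ccos_neq_0 _ (Csin_y_neq_0 p k Hp)) as Nk.
  pose proof (N i) as Ni. pose proof (N j) as Nj. pose proof (N k) as Nk'.
  set (ci := cy i p) in *. set (cj := cy j p) in *. set (ck := cy k p) in *.
  (* Column k gives the common value rho = a (1 + ci) = b (1 + cj). Columns i and j then combine to
     2 rho (1 - ck) = 0. *)
  assert (R : a * (1 + ci) = b * (1 + cj)).
  { apply (Cmult_reg_l _ _ _ Nk'). ring_from Hk. }
  set (rho := a * (1 + ci)) in *.
  assert (K1 : rho * (cj + ck) = rho * (1 + ci)).
  { rewrite R at 2. unfold rho. ring_from Hi. }
  assert (K2 : rho * (1 + cj) = rho * (ci + ck)).
  { rewrite R at 2. unfold rho. ring_from Hj. }
  assert (Z : rho = 0).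
  { destruct (Cmult_integral rho (2 * (1 - ck))) as [|Z]; [| assumption |].
    - transitivity (rho * (1 + ci) - rho * (cj + ck) + (rho * (1 + cj) - rho * (ci + ck))); [ring|].
      rewrite K1, K2. ring.
    - exfalso. exact (Cmult_neq_0 _ _ C2_nz Nk Z). }
  split.
  + destruct (Cmult_integral a (1 + ci) Z); [assumption | contradiction].
  + rewrite R in Z. destruct (Cmult_integral b (1 + cj) Z); [assumption | contradiction].
- intros p N Hp HN.
  assert (Cr : forall p, Omega p -> continuous3 cos_ratio p).
  { intros q Hq. pose proof (one_plus_Ccos_neq_0 _ (Csin_y_neq_0 q I1 Hq)) as N1.
    unfold cos_ratio, Cdiv. apply (@continuous_Cmult C3_R).
    - apply (@continuous_Cplus C3_R); now apply continuous_Ccos_y.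
    - apply (@continuous_Ccomp C3_R (fun q => 1 + cy I1 q) Cinv).
      + apply (@continuous_Cplus C3_R); [apply continuous_Cconst | now apply continuous_Ccos_y].
      + exact (has_cderiv_continuous _ _ _ (has_cderiv_inv _ N1)). }
  destruct (nonreal_dense cos_ratio Cr cos_ratio_nonreal p N Hp HN) as [q [Hq Nq]].
  destruct (locally_singleton _ _ Nq) as [Nq' R].
  pose proof (fun l => one_plus_Ccos_neq_0 _ (Csin_y_neq_0 q l Hq)) as Ne.
  exists q. split; [exact Nq'|]. split; [exact Hq|]. split.
  + intros i j Hij. rewrite radius_matrix_off by exact Hij. apply Cmult_neq_0; apply Ne.
  + intros al be HH.
    assert (D1 : distinct3 I1 I2 I3) by (repeat split; congruence).
    pose proof (HH I1 I1) as H11. pose proof (HH I1 I2) as H12. pose proof (HH I3 I2) as H32.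
    pose proof (HH I3 I1) as H31.
    rewrite (radius_matrix_diag q I1 I2 I3 D1) in H11.
    rewrite !radius_matrix_off in H12, H32, H31 by congruence.
    assert (Ne' : forall l, Cconj (1 + cy l q) <> 0).
    { intros l Z. apply (Ne l). rewrite <- (Cconj_conj (1 + cy l q)), Z.
      apply injective_projections; cbn; ring. }
    assert (Off : forall i j, i <> j -> al i * ((1 + cy i q) * (1 + cy j q)) =
       be j * (Cconj (1 + cy i q) * Cconj (1 + cy j q))).
    { intros i j Hij. rewrite <- Cmult_conj, <- (radius_matrix_off q i j Hij). apply HH. }
    rewrite Cmult_conj in H11. rewrite !Cmult_conj in H12, H32, H31.
    unfold cos_ratio in R. rewrite Cdiv_conj in R by apply Ne.
    set (cc := cy I2 q + cy I3 q) in *.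
    pose proof (Ne I1) as Ne1. pose proof (Ne' I1) as Ne1'.
    pose proof (Ne I2) as Ne2. pose proof (Ne' I2) as Ne2'. pose proof (Ne' I3) as Ne3'. pose
      proof (Ne I3) as Ne3.
    set (e1 := 1 + cy I1 q) in *. set (e2 := 1 + cy I2 q) in *. set (e3 := 1 + cy I3 q) in *.
    set (f1 := Cconj e1) in *. set (f2 := Cconj e2) in *. set (f3 := Cconj e3) in *.
    (* The off-diagonal equations, used through the indices 2 and 3, give al_1 e1^2 = be_1 f1^2, as
       a real first diagonal entry would. Together with the actual diagonal equation this makes
       [cos_ratio] real unless al_1 = 0. *)
    assert (A1 : al I1 * e1 * f3 = al I3 * e3 * f1).
    { apply (Cmult_reg_l e2 _ _ Ne2).
      transitivity (al I1 * (e1 * e2) * f3); [ring|]. rewrite H12.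
      transitivity (be I2 * (f3 * f2) * f1); [ring|]. rewrite <- H32. ring. }
    assert (A2 : al I1 * (e1 * e1) = be I1 * (f1 * f1)).
    { apply (Cmult_reg_l f3 _ _ Ne3').
      transitivity (al I1 * e1 * f3 * e1); [ring|]. rewrite A1.
      transitivity (al I3 * (e3 * e1) * f1); [ring|]. rewrite H31. ring. }
    assert (A3 : al I1 * e1 * (cc * f1 - Cconj cc * e1) = 0).
    { transitivity (al I1 * (e1 * cc) * f1 - al I1 * (e1 * e1) * Cconj cc); [ring|].
      rewrite H11, A2. ring. }
    assert (al1 : al I1 = 0).
    { destruct (Cmult_integral _ _ A3) as [Z|Z].
      - destruct (Cmult_integral _ _ Z); [assumption | contradiction].
      - exfalso. apply R. apply Ceq_minus.
        transitivity ((cc * f1 - Cconj cc * e1) / (e1 * f1)); [field; auto | rewrite Z; field;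
          auto]. }
    assert (be1 : be I1 = 0).
    { destruct (Cmult_integral (be I1) (f1 * f1)) as [|Z]; [rewrite <- A2, al1; ring | assumption
      |].
      exfalso. exact (Cmult_neq_0 _ _ Ne1' Ne1' Z). }
    assert (Be : forall j, be j = 0).
    { intros j. destruct (classic (I1 = j)) as [<-|Hj]; [exact be1|].
      pose proof (Off I1 j Hj) as O. rewrite al1 in O.
      destruct (Cmult_integral (be j) (Cconj (1 + cy I1 q) * Cconj (1 + cy j q))) as [|Z];
        [rewrite <- O; ring | assumption |].
      exfalso. exact (Cmult_neq_0 _ _ (Ne' I1) (Ne' j) Z). }
    intros i. split; [|apply Be].
    destruct (exists_other i) as [j Hij]. pose proof (Off i j Hij) as O. rewrite (Be j) in O.
    destruct (Cmult_integral (al i) ((1 + cy i q) * (1 + cy j q))) as [|Z];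
      [rewrite O; ring | assumption |].
    exfalso. exact (Cmult_neq_0 _ _ (Ne i) (Ne j) Z).
- destruct (clf_base _ _ Hy) as [a [b [Hab Eab]]]. exists (a, a, a). split; [exact Hab|].
  intros i j. rewrite Eab. split; [destruct i, j; reflexivity|].
  unfold radius. destruct i, j; reflexivity.
- intros p i N Hp HN. destruct (distinct3_exists i) as [j [k D]].
  destruct (law_image p i j k N Hp D HN) as [d Hd].
  pose proof (cond_pos d) as Pd. assert (P2 : (0 < d / 2)%R) by lra.
  exists (mkposreal _ P2). cbn. intros w s Hw Hs.
  (* With x_i kept fixed, r_i = s means x_j + x_k = 2 s + x_i; the factor 2 explains the radius d /
     2. *)
  destruct (Hd w (coord i p) (2 * s + coord i p)) as [q [Nq [_ [Eq [Ei En]]]]].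
  + lra.
  + replace (coord i p - coord i p) with (RtoC 0) by ring. rewrite Cmod_0. exact Pd.
  + replace (2 * s + coord i p - (coord j p + coord k p)) with (2 * (s - radius i p))
      by (rewrite (radius_eq i j k p D); field).
    rewrite Cmod_mult, Cmod_2. lra.
  + exists q. split; [exact Nq|]. split; [exact Eq|].
    rewrite (radius_eq i j k q D), En, Ei. field.
(* Here psi is 1/sin, which has no zero. *)
- left. intros p i Hp Z. pose proof (Csin_y_neq_0 p i Hp) as N. apply C1_nz.
  rewrite <- (Cinv_r _ N), Z. ring.
Qed.

End Law.

Theorem theorem1p5 (Omega : C3 -> Prop) (y : C3 -> C3)
  (Hy : cosine_law_function Omega y) :
  (* (1) *)
  ((forall f g : C -> C,
      smooth_nonconstant_pair Omega y coord f g ->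
      closed_form Omega (fdg_form f g y coord) ->
      (exists (lambda c : C) (F G : C -> C),
         c <> 0 /\
         power_antiderivative (y_values Omega y) Csin lambda F /\
         power_antiderivative (values Omega coord) Csin (- lambda - 1) G /\
         (form_eq Omega (fdg_form f g y coord)
            (form_scale c (fdg_form F G y coord)) \/
          form_eq Omega (fdg_form f g y coord)
            (form_scale c (form_conj (fdg_form F G y coord))))) /\
      (holomorphic_form Omega (fdg_form f g y coord) \/
       antiholomorphic_form Omega (fdg_form f g y coord))) /\
   (forall (lambda : C) (F G : C -> C),
      power_antiderivative (y_values Omega y) Csin lambda F ->
      power_antiderivative (values Omega coord) Csin (- lambda - 1) G ->
      closed_form Omega (fdg_form F G y coord) /\
      exists m : C -> C,
        power_branch (values Omega coord) Csin (lambda + 1) m /\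
        form_eq Omega (fdg_form F G y coord) (quotient_form F m y coord))) /\
  (* (2) *)
  ((forall f g : C -> C,
      smooth_nonconstant_pair Omega y radius f g ->
      closed_form Omega (fdg_form f g y radius) ->
      (exists (lambda c : C) (F G : C -> C),
         c <> 0 /\
         power_antiderivative (y_values Omega y)
           (fun t => Ctan (t / 2)) lambda F /\
         power_antiderivative (values Omega radius) Ccos (- lambda - 1) G /\
         (form_eq Omega (fdg_form f g y radius)
            (form_scale c (fdg_form F G y radius)) \/
          form_eq Omega (fdg_form f g y radius)
            (form_scale c (form_conj (fdg_form F G y radius))))) /\
      (holomorphic_form Omega (fdg_form f g y radius) \/
       antiholomorphic_form Omega (fdg_form f g y radius))) /\
   (forall (lambda : C) (F G : C -> C),
      power_antiderivative (y_values Omega y)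
        (fun t => Ctan (t / 2)) lambda F ->
      power_antiderivative (values Omega radius) Ccos (- lambda - 1) G ->
      closed_form Omega (fdg_form F G y radius) /\
      exists m : C -> C,
        power_branch (values Omega radius) Ccos (lambda + 1) m /\
        form_eq Omega (fdg_form F G y radius) (quotient_form F m y radius))).
Proof.
split.
- exact (cosine_system_closed_forms _ _ _ _ _ _ _ _ _ _ _ (coord_cosine_system Omega y Hy)).
- exact (cosine_system_closed_forms _ _ _ _ _ _ _ _ _ _ _ (radius_cosine_system Omega y Hy)).
Qed.
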